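(* There is a polynomial-time (many-one) reduction from stopping simple stochastic games (that is, from the problem of deciding whether a given state of a given stopping simple stochastic game has value at least $1/2$) to the feasibility problem for semidefinite programs.
   Context: Simple stochastic game. The game is played by two players, Min and Max, on a finite directed graph with vertex set $V$ and edge set $E \subseteq V^2$, where every vertex (also called state) has at least one outgoing edge. The vertices are partitioned as $V = V_{\mathrm{Min}} \sqcup V_{\mathrm{Max}} \sqcup V_{\mathrm{Rand}}$. Every vertex in $V_{\mathrm{Rand}}$ has out-degree exactly two, and each of its two outgoing edges is taken with probability $1/2$. There are two special terminal states $\mathrm{Win}$ and $\mathrm{Lose}$, which are absorbing: the only outgoing edge of $\mathrm{Win}$ goes to $\mathrm{Win}$ and the only outgoing edge of $\mathrm{Lose}$ goes to $\mathrm{Lose}$. A policy of Min is a function $\sigma\colon V_{\mathrm{Min}} \to V$ with $(v,\sigma(v)) \in E$ for all $v$; a policy of Max is a function $\tau\colon V_{\mathrm{Max}}\to V$ with $(v,\tau(v))\in E$ for all $v$. Fixing policies $(\sigma,\tau)$ and an initial state $u$ yields a Markov chain on $V$; the reward of Max is $g(\sigma,\tau)_u = \mathbb{P}^u_{\sigma,\tau}(\text{the chain reaches } \mathrm{Win})$. Max maximizes and Min minimizes this reward. It is known that there exist policies $(\sigma^*,\tau^* )$ and a vector $\chi \in \mathbb{R}^V$ such that $g(\sigma^*,\tau)_u \le \chi_u \le g(\sigma,\tau^* )_u$ for every $u\in V$ and all policies $\sigma,\tau$; $\chi = g(\sigma^*,\tau^* )$ is the value of the game, and $\chi_u$ is the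 value of state $u$. The game is stopping if for every initial state $u$ and all policies $(\sigma,\tau)$ the chain reaches $\{\mathrm{Win},\mathrm{Lose}\}$ with probability one. The decision problem associated with stopping simple stochastic games is: given such a game and a state $k \in V$, decide whether the value of $k$ is at least $1/2$. Feasibility problem for semidefinite programs. Given symmetric matrices $A_1,\dots,A_n,B \in \mathbb{Q}^{m\times m}$, decide whether there is $x \in \mathbb{R}^n$ such that $x_1A_1+\dots+x_nA_n-B \succeq 0$, where $S \succeq 0$ means that $S$ is symmetric positive semidefinite. The representation size of the input is the sum of the bit lengths of all rational numbers in the input. *)

(* Defs.v *)
From Corelib Require Import BinNums.
From mathcomp Require Import all_boot all_order all_algebra.
From mathcomp Require Import all_classical all_reals all_analysis.
From mathcomp Require Import zify.
Set Implicit Arguments.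
Unset Strict Implicit.
Unset Printing Implicit Defensive.
Import Order.TTheory GRing.Theory Num.Theory.
Import numFieldNormedType.Exports.
Local Open Scope ring_scope.

Section MarkovChain.
Context {R : realType} {V : finType}.
Implicit Types (T : V -> V -> R) (u : V) (A : pred V).

(* Probability that the chain with transition probabilities [T] started at [u]
   follows the trajectory [u :: p] during its first [size p] steps. *)
Fixpoint path_prob T u (p : seq V) : R :=
  if p is v :: p' then T u v * path_prob T v p' else 1.

Definition reach_within T u A (n : nat) : R :=
  \sum_(p : n.-tuple V | has A (u :: p)) path_prob T u p.

(* The event of ever reaching [A] is the increasing union over [n] of the
   events of reaching it within [n] steps, whence the limit; see [reach_probE]
   below for the agreement with an arbitrary realisation of the chain. *)
Definition reach_prob T u A : R := limn (reach_within T u A).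

Local Open Scope classical_set_scope.
(* [X] is any process having the law of the chain started at [u], on any
   probability space. *)
Lemma reach_probE d (Omega : measurableType d) (P : probability Omega R)
    (X : nat -> Omega -> V) T u A :
  (forall t v, measurable [set w | X t w = v]) ->
  (forall p : seq V,
    P [set w | forall t, (t <= size p)%N -> X t w = nth u (u :: p) t] =
    (path_prob T u p)%:E) ->
  P [set w | exists t, A (X t w)] = (reach_prob T u A)%:E.
Proof.
move=> mX PX.
pose E (p : seq V) :=
  [set w | forall t, (t <= size p)%N -> X t w = nth u (u :: p) t].
have mE p : measurable (E p).
  have -> : E p = \bigcap_(t in [set t | (t <= size p)%N])
      [set w | X t w = nth u (u :: p) t] by [].
  by apply: bigcap_measurable => //; exists 0%N.
pose F n := \bigcup_(p in [set p : n.-tuple V | has A (u :: p)]) E p.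
have fin n : finite_set [set p : n.-tuple V | has A (u :: p)].
  exact: finite_finset.
have mF n : measurable (F n) by apply: fin_bigcup_measurable.
have PF n : P (F n) = (reach_within T u A n)%:E.
  rewrite (measure_fin_bigcup P (fin n))//; first last.
    move=> p q _ _ [w [Ep Eq]]; apply: val_inj; apply: (@eq_from_nth _ u).
      by rewrite !size_tuple.
    rewrite size_tuple => i ip /=.
    have := Ep i.+1; rewrite size_tuple => /(_ ip) /= <-.
    by have := Eq i.+1; rewrite size_tuple => /(_ ip).
  pose r := [seq p : n.-tuple V <- index_enum (n.-tuple V) | has A (u :: p)].
  have -> : [set p : n.-tuple V | has A (u :: p)] = [set` r].
    apply/seteqP; split=> p; rewrite /r /= mem_filter mem_index_enum andbT //=.
  rewrite -fsbig_seq ?filter_uniq ?index_enum_uniq// /r big_filter.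
  rewrite /reach_within -sumEFin; apply: eq_bigr => p _; exact: PX.
have Fmem n w : X 0%N w = u -> (exists2 t, (t <= n)%N & A (X t w)) -> F n w.
  move=> X0 [t tn At].
  have [p pE] : exists p : n.-tuple V,
      forall i, (i <= n)%N -> nth u (u :: p) i = X i w.
    exists [tuple X i.+1 w | i < n] => i.
    case: i => [|i] //= ilt.
    have := tnth_mktuple (fun i : 'I_n => X i.+1 w) (Ordinal ilt).
    by rewrite (tnth_nth u).
  exists p; last by move=> i; rewrite size_tuple => /pE ->.
  apply/(has_nthP u); exists t; first by rewrite /= size_tuple ltnS.
  by rewrite pE.
have FX n w : F n w -> X 0%N w = u /\ exists2 t, (t <= n)%N & A (X t w).
  move=> [p hp Ep]; split; first exact: Ep.
  have /(has_nthP u)[t tp At] : has A (u :: p) by exact: hp.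
  move: tp; rewrite /= ltnS => tp; exists t; first by rewrite -(size_tuple p).
  by rewrite Ep.
have ndF : {homo F : n m / (n <= m)%N >-> (n <= m)%O}.
  move=> n m nm; apply/subsetPset => w /FX[X0 [t tn At]].
  by apply: Fmem => //; exists t => //; exact: leq_trans nm.
have mA : measurable [set w | exists t, A (X t w)].
  have -> : [set w | exists t, A (X t w)] =
      \bigcup_t \bigcup_(v in [set v | A v]) [set w | X t w = v].
    apply/seteqP; split=> w /=.
      by move=> [t At]; exists t => //; exists (X t w).
    by move=> [t _ [v /= Av Xt]]; exists t; rewrite Xt.
  apply: bigcup_measurable => t _; apply: fin_bigcup_measurable.
    exact: finite_finset.
  by move=> v _; exact: mX.
pose X0 := [set w | X 0%N w = u].
have PX0 : P X0 = 1%E.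
  rewrite -[RHS](PX [::]); congr (P _); apply/seteqP; split=> w /=.
    by move=> X0w [|].
  exact.
have -> : P [set w | exists t, A (X t w)] = P (\bigcup_n F n).
  have -> : \bigcup_n F n = [set w | exists t, A (X t w)] `&` X0.
    apply/seteqP; split=> w /=.
      by move=> [n _ /FX[? [t _ ?]]]; split=> //; exists t.
    by move=> [[t At] X0w]; exists t => //; apply: Fmem => //; exists t.
  rewrite (measureDI P mA (mX 0%N u)) [X in (X + _)%E](_ : _ = 0) ?add0e//.
  apply: (@subset_measure0 _ _ _ P _ (~` X0)).
  - by apply: measurableD => //; exact: mX.
  - by apply: measurableC; exact: mX.
  - by move=> w [].
  - have := probability_setC P (mX 0%N u).
    by rewrite -/X0 PX0 subee.
have cvgF := nondecreasing_cvg_mu (mu := P) mF (bigcupT_measurable F mF) ndF.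
have Pfin : P (\bigcup_n F n) \is a fin_num
  by apply: fin_num_measure; exact: bigcupT_measurable.
rewrite -(fineK Pfin); congr _%:E; apply: esym.
rewrite /reach_prob; apply: cvg_lim; first exact: norm_hausdorff.
move: cvgF; rewrite -[X in _ --> X](fineK Pfin) => /fine_cvg; apply: cvg_trans.
by apply: near_eq_cvg; near=> n; rewrite /= PF.
Unshelve. all: by end_near. Qed.

End MarkovChain.

Inductive player := Min | Max | Rand.

(* [win] and [lose] have out-degree one, hence are never owned by [Rand];
   whether they are owned by [Min] or by [Max] is immaterial. *)
Record ssg (V : finType) := SSG {
  owner : V -> player;
  edge : rel V;
  win : V;
  lose : V;
  ssg_out : forall v, exists w, edge v w;
  ssg_rand : forall v, owner v = Rand -> #|[set w | edge v w]%SET| = 2%N;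
  ssg_win_lose : win != lose;
  ssg_win : forall w, edge win w = (w == win);
  ssg_lose : forall w, edge lose w = (w == lose) }.

Section Game.
Variable R : realType.
Context {V : finType}.
Variable G : ssg V.
Implicit Types (sigma tau : V -> V) (u v w : V).

(* Policies are total functions on [V]; only their values at the vertices of
   the player concerned are constrained, and only those are ever used. *)
Definition min_policy sigma : Prop :=
  forall v, owner G v = Min -> edge G v (sigma v).
Definition max_policy tau : Prop :=
  forall v, owner G v = Max -> edge G v (tau v).

Definition trans_prob sigma tau v w : R :=
  match owner G v with
  | Min => (w == sigma v)%:R
  | Max => (w == tau v)%:R
  | Rand => if edge G v w then 2^-1 else 0
  end.

Definition reward sigma tau u : R :=
  reach_prob (trans_prob sigma tau) u (pred1 (win G)).

Definition is_value (chi : V -> R) : Prop :=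
  exists sigma' tau', [/\ min_policy sigma', max_policy tau' &
    forall u sigma tau, min_policy sigma -> max_policy tau ->
      reward sigma' tau u <= chi u <= reward sigma tau' u].

Definition stopping : Prop :=
  forall u sigma tau, min_policy sigma -> max_policy tau ->
    reach_prob (trans_prob sigma tau) u (pred2 (win G) (lose G)) = 1.

End Game.

Definition psdmx {R : realType} {m : nat} (S : 'M[R]_m) : Prop :=
  S^T = S /\ forall v : 'cV[R]_m, 0 <= (v^T *m S *m v) 0 0.

Record sdp := SDP {
  sdp_nvar : nat;
  sdp_dim : nat;
  sdp_A : 'I_sdp_nvar -> 'M[rat]_sdp_dim;
  sdp_B : 'M[rat]_sdp_dim;
  sdp_A_sym : forall i, (sdp_A i)^T = sdp_A i;
  sdp_B_sym : sdp_B^T = sdp_B }.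

Arguments sdp_A : clear implicits.

Definition sdp_feasible (R : realType) (I : sdp) : Prop :=
  exists x : 'I_(sdp_nvar I) -> R,
    psdmx (\sum_i x i *: map_mx ratr (sdp_A I i) - map_mx ratr (sdp_B I)).

Inductive move := Stay | Left | Right.

Section Tape.
Variable sym : Type.
Variable blank : sym.

(* A two-way infinite tape: [rtape] starts with the scanned cell and goes
   rightwards, [ltape] starts just left of the scanned cell and goes leftwards;
   all the cells beyond the two lists are blank. *)
Record tape := Tape { ltape : seq sym; rtape : seq sym }.

Definition tape_read (t : tape) : sym := head blank (rtape t).

Definition tape_act (t : tape) (a : sym * move) : tape :=
  let: Tape l r := t in
  match a.2 with
  | Stay => Tape l (a.1 :: behead r)
  | Right => Tape (a.1 :: l) (behead r)
  | Left => Tape (behead l) (head blank l :: a.1 :: behead r)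
  end.

End Tape.

(* The tape alphabet is [option (bool + tm_aux)]: the blank [None], the two
   input/output symbols and finitely many auxiliary symbols. There are
   [tm_ntapes.+1] tapes. *)
Record turing_machine := TM {
  tm_state : finType;
  tm_aux : finType;
  tm_ntapes : nat;
  tm_start : tm_state;
  tm_halt : pred tm_state;
  tm_trans : tm_state -> {ffun 'I_tm_ntapes.+1 -> option (bool + tm_aux)} ->
    tm_state * ('I_tm_ntapes.+1 -> option (bool + tm_aux) * move) }.

Section Run.
Variable M : turing_machine.

Definition tm_sym : Type := option (bool + tm_aux M).
Definition tm_bit (b : bool) : tm_sym := Some (inl b).

Definition tm_config : Type :=
  tm_state M * ('I_(tm_ntapes M).+1 -> tape tm_sym).

Definition tm_step (c : tm_config) : tm_config :=
  if tm_halt c.1 then c else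
  let: (q, act) := tm_trans c.1 [ffun i => tape_read None (c.2 i)] in
  (q, fun i => tape_act None (c.2 i) (act i)).

Definition tm_init (w : bitseq) : tm_config :=
  (tm_start M,
   fun i => Tape [::] (if i == ord0 then map tm_bit w else [::])).

(* The output word is read on the last tape, from the scanned cell up to the
   first blank. *)
Definition tm_output (c : tm_config) (w : bitseq) : Prop :=
  exists rest, rtape (c.2 ord_max) = map tm_bit w ++ rest /\
               head None rest = None.

Definition tm_computes_within (w w' : bitseq) (n : nat) : Prop :=
  exists2 t, (t <= n)%N &
    let c := iter t tm_step (tm_init w) in tm_halt c.1 /\ tm_output c w'.

End Run.

Record decision_problem := DecisionProblem {
  instance : Type;
  encode : instance -> bitseq;
  encode_inj : injective encode;
  yes_instance : instance -> Prop }.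

Definition polytime_computable (P Q : decision_problem)
    (f : instance P -> instance Q) : Prop :=
  exists (M : turing_machine) (p : {poly nat}), forall x : instance P,
    tm_computes_within M (encode x) (encode (f x)) p.[size (encode x)].

Definition polytime_reducible (P Q : decision_problem) : Prop :=
  exists f : instance P -> instance Q,
    polytime_computable f /\
    forall x, yes_instance x <-> yes_instance (f x).

(* Binary digits, least significant first; zero has no digits. *)
Fixpoint pos_bits (p : positive) : bitseq :=
  match p with
  | xH => [:: true]
  | xO p' => false :: pos_bits p'
  | xI p' => true :: pos_bits p'
  end.
Definition nat_bits (n : nat) : bitseq :=
  if bin_of_nat n is Npos p then pos_bits p else [::].

(* Self-delimiting: each digit is preceded by [true], the end is [false]. *)
Fixpoint enc_bits (s : bitseq) : bitseq :=
  if s is b :: s' then true :: b :: enc_bits s' else [:: false].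

Definition enc_rat (q : rat) : bitseq :=
  (q < 0) :: enc_bits (nat_bits `|numq q|) ++ enc_bits (nat_bits `|denq q|).

Definition enc_unary (n : nat) : bitseq := rcons (nseq n true) false.

Definition enc_ord {n} {T : Type} (e : T -> bitseq) (f : 'I_n -> T) : bitseq :=
  flatten [seq e (f i) | i <- enum 'I_n].

Definition enc_mx {m} (A : 'M[rat]_m) : bitseq :=
  enc_ord (enc_ord enc_rat) (fun i j => A i j).

Definition enc_sdp (I : sdp) : bitseq :=
  enc_unary (sdp_nvar I) ++ enc_unary (sdp_dim I) ++
  enc_mx (sdp_B I) ++ enc_ord enc_mx (sdp_A I).

Definition enc_player (o : player) : bitseq :=
  match o with
  | Min => [:: false; false]
  | Max => [:: false; true]
  | Rand => [:: true; true]
  end.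

(* Number of vertices, then for each vertex its owner, whether it is [win],
   [lose] and the distinguished state [k], and its row of the adjacency
   matrix. *)
Definition enc_ssg {n} (G : ssg 'I_n) (k : 'I_n) : bitseq :=
  enc_unary n ++
  enc_ord (fun v => enc_player (owner G v) ++
                    [:: v == win G; v == lose G; v == k] ++
                    enc_ord (fun b => [:: b]) (edge G v)) id.

Section SdpSize.
Local Open Scope nat_scope.

Definition rat_size (q : rat) : nat :=
  size (nat_bits `|numq q|) + size (nat_bits `|denq q|).

Definition sdp_size (I : sdp) : nat :=
  \sum_i \sum_j rat_size (sdp_B I i j) +
  \sum_k \sum_i \sum_j rat_size (sdp_A I k i j).

Lemma size_enc_bits s : size (enc_bits s) = (size s).*2.+1.
Proof. by elim: s => //= b s ->. Qed.

Lemma size_enc_rat q : rat_size q <= size (enc_rat q) <= 5 * rat_size q.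
Proof.
have bits_gt0 n : 0 < n -> 0 < size (nat_bits n).
  rewrite -{1}(bin_of_natK n) /nat_bits; case: (bin_of_nat n) => // p _.
  by case: p.
have : 0 < size (nat_bits `|denq q|) by rewrite bits_gt0// absz_gt0 denq_neq0.
rewrite /rat_size /enc_rat /= size_cat !size_enc_bits -!addnn.
lia.
Qed.

Lemma size_enc_ord n T (e : T -> bitseq) (f : 'I_n -> T) :
  size (enc_ord e f) = \sum_i size (e (f i)).
Proof.
by rewrite /enc_ord size_flatten /shape -map_comp sumnE big_map big_enum.
Qed.

Lemma size_enc_mx m (A : 'M[rat]_m) :
  let a := \sum_i \sum_j rat_size (A i j) in a <= size (enc_mx A) <= 5 * a.
Proof.
rewrite /enc_mx size_enc_ord big_distrr /=; apply/andP; split.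
  apply: leq_sum => i _; rewrite size_enc_ord; apply: leq_sum => j _.
  by case/andP: (size_enc_rat (A i j)).
apply: leq_sum => i _; rewrite size_enc_ord big_distrr /=.
by apply: leq_sum => j _; case/andP: (size_enc_rat (A i j)).
Qed.

(* Up to the two unary dimensions, the length of the encoding is the sum of the
   bit lengths of all the entries, within a constant factor. *)
Lemma size_enc_sdp I :
  sdp_size I <= size (enc_sdp I) <=
  5 * sdp_size I + (sdp_nvar I + sdp_dim I).+2.
Proof.
have /andP[B1 B2] := size_enc_mx (sdp_B I).
have A1 : \sum_k \sum_i \sum_j rat_size (sdp_A I k i j) <=
          size (enc_ord enc_mx (sdp_A I)).
  rewrite size_enc_ord; apply: leq_sum => k _.
  by case/andP: (size_enc_mx (sdp_A I k)).
have A2 : size (enc_ord enc_mx (sdp_A I)) <=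
          5 * \sum_k \sum_i \sum_j rat_size (sdp_A I k i j).
  rewrite size_enc_ord big_distrr /=; apply: leq_sum => k _.
  by case/andP: (size_enc_mx (sdp_A I k)).
rewrite /enc_sdp /sdp_size !size_cat /enc_unary !size_rcons !size_nseq.
move: A1 A2 B1 B2; lia.
Qed.

End SdpSize.

Definition prefix_code {T : Type} (e : T -> bitseq) : Prop :=
  forall x y s t, e x ++ s = e y ++ t -> x = y /\ s = t.

Lemma enc_bits_prefix : prefix_code enc_bits.
Proof.
elim=> [|a x IH] [|b y] s t //= => [[]//|[-> /IH[-> ->]]//].
Qed.

Lemma pos_bits_inj : injective pos_bits.
Proof.
have nz p : pos_bits p <> [::] by case: p.
elim=> [p IH|p IH|] [q|q|] //= [].
- by move/IH->.
- by move/nz.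
- by move/IH->.
- by move/esym/nz.
Qed.

Lemma nat_bits_inj : injective nat_bits.
Proof.
have nz p : pos_bits p <> [::] by case: p.
move=> m n; rewrite /nat_bits -{2}(bin_of_natK m) -{2}(bin_of_natK n).
case: (bin_of_nat m) => [|p]; case: (bin_of_nat n) => [|q] //=.
- by move/esym/nz.
- by move/nz.
- by move/pos_bits_inj->.
Qed.

Lemma enc_rat_prefix : prefix_code enc_rat.
Proof.
move=> x y s t; rewrite /enc_rat /= -!catA => -[sxy].
move=> /enc_bits_prefix[/nat_bits_inj nxy /enc_bits_prefix[/nat_bits_inj dxy ->]].
split=> //; rewrite -[x]divq_num_den -[y]divq_num_den.
have -> : denq x = denq y.
  by rewrite -[denq x]absz_denq -[denq y]absz_denq dxy.
suff -> : numq x = numq y by [].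
by rewrite [LHS]intEsign [RHS]intEsign nxy !numq_lt0 sxy.
Qed.

Lemma enc_unary_prefix : prefix_code enc_unary.
Proof.
rewrite /enc_unary; elim=> [|m IH] [|n] s t //= => [[]//|[/IH[-> ->]]//].
Qed.

Lemma enc_ord_prefix n T (e : T -> bitseq) (f g : 'I_n -> T) s t :
  prefix_code e -> enc_ord e f ++ s = enc_ord e g ++ t -> f =1 g /\ s = t.
Proof.
move=> he; rewrite /enc_ord => H.
suff [fg ->] : {in enum 'I_n, f =1 g} /\ s = t.
  by split=> // i; apply: fg; rewrite mem_enum.
elim: (enum 'I_n) H => [|i r IH] //=; rewrite -!catA => /he[fgi /IH[fg ->]].
by split=> // j; rewrite inE => /predU1P[->|/fg].
Qed.

Lemma enc_mx_prefix m : prefix_code (@enc_mx m).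
Proof.
move=> A B s t /enc_ord_prefix[|AB ->].
  by move=> f g s' t' /(enc_ord_prefix enc_rat_prefix)[/funext -> ->].
by split=> //; apply/matrixP => i j; exact: (congr1 (@^~ j) (AB i)).
Qed.

Lemma enc_sdp_inj : injective enc_sdp.
Proof.
case=> n m A B sA sB [n' m' A' B' sA' sB']; rewrite /enc_sdp /=.
move=> /enc_unary_prefix[en /enc_unary_prefix[em]].
move: A' B' sA' sB'; rewrite -en -em => A' B' sA' sB'.
move=> /enc_mx_prefix[eB]; rewrite -[enc_ord _ A]cats0 -[enc_ord _ A']cats0.
move=> /(enc_ord_prefix (@enc_mx_prefix _))[/funext eA _].
move: A' B' sA' sB' eA eB => A' B' sA' sB' eA eB; subst A' B'.
by congr SDP; exact: Prop_irrelevance.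
Qed.

Lemma enc_player_prefix : prefix_code enc_player.
Proof. by case=> -[] s t //= [->]. Qed.

Lemma enc_ssg_inj n (G G' : ssg 'I_n) k k' :
  enc_ssg G k = enc_ssg G' k' -> G = G' /\ k = k'.
Proof.
move=> /enc_unary_prefix[_].
pose e (x : player * (bool * bool * bool) * ('I_n -> bool)) : bitseq :=
  enc_player x.1.1 ++ [:: x.1.2.1.1; x.1.2.1.2; x.1.2.2] ++
  enc_ord (fun b => [:: b]) x.2.
have he : prefix_code e.
  move=> [[w [[b1 b2] b3]] f] [[w' [[b1' b2'] b3']] f'] s t; rewrite /e /= -!catA.
  move=> /enc_player_prefix[->] /= [-> -> ->].
  move=> /enc_ord_prefix[|/funext -> ->//].
  by move=> x y s' t' /= [-> ->].
pose row (H : ssg 'I_n) (l : 'I_n) v :=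
  (owner H v, (v == win H, v == lose H, v == l), fun w => edge H v w).
have rowE (H : ssg 'I_n) l : enc_ord (fun v => enc_player (owner H v) ++
    [:: v == win H; v == lose H; v == l] ++
    enc_ord (fun b => [:: b]) (edge H v)) id = enc_ord e (row H l).
  by [].
rewrite !rowE -[enc_ord e (row G k)]cats0 -[enc_ord e (row G' k')]cats0.
move=> /(enc_ord_prefix he)[rGG' _].
have eo : owner G = owner G' by apply/funext => v; case: (rGG' v).
have ee : edge G = edge G' by apply/funext => v; case: (rGG' v).
have ew : win G = win G'.
  by apply/eqP; case: (rGG' (win G)) => _ /esym; rewrite eqxx.
have el : lose G = lose G'.
  by apply/eqP; case: (rGG' (lose G)) => _ _ /esym; rewrite eqxx.
split; last by apply/eqP; case: (rGG' k) => _ _ _ /esym; rewrite eqxx.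
case: G G' {rGG' row rowE} eo ee ew el => o ed w l p1 p2 p3 p4 p5.
case=> o' ed' w' l' q1 q2 q3 q4 q5 /= eo ee ew el; subst o' ed' w' l'.
by congr SSG; exact: Prop_irrelevance.
Qed.

Record stopping_instance (R : realType) := StoppingInstance {
  inst_size : nat;
  inst_game : ssg 'I_inst_size;
  inst_state : 'I_inst_size;
  inst_stopping : stopping R inst_game }.

Definition enc_instance (R : realType) (x : stopping_instance R) : bitseq :=
  enc_ssg (inst_game x) (inst_state x).

Lemma enc_instance_inj (R : realType) : injective (@enc_instance R).
Proof.
move=> [n G k s] [n' G' k' s']; rewrite /enc_instance /= => H.
have [en _] := enc_unary_prefix H.
move: G' k' s' H; rewrite -en => G' k' s' /enc_ssg_inj[eG ek].
by subst G' k'; congr StoppingInstance; exact: Prop_irrelevance.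
Qed.

Definition stopping_ssg_problem (R : realType) : decision_problem :=
  @DecisionProblem (stopping_instance R) (@enc_instance R)
    (@enc_instance_inj R)
    (fun x => exists chi, is_value (inst_game x) chi /\
                          (2^-1 : R) <= chi (inst_state x)).

Definition sdp_feasibility_problem (R : realType) : decision_problem :=
  @DecisionProblem sdp enc_sdp enc_sdp_inj (sdp_feasible R).

(* Main.v *)
Require Import Defs.
From mathcomp Require Import all_boot all_order all_fingroup all_algebra.
From mathcomp Require Import all_classical all_reals all_analysis.
From mathcomp Require Import zify ring lra.
Set Implicit Arguments.
Unset Strict Implicit.
Unset Printing Implicit Defensive.
Import Order.TTheory GRing.Theory Num.Theory.
Import numFieldNormedType.Exports.
Local Open Scope ring_scope.

(** Why the values of a stopping game can be compared with 1/2 by a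
    semidefinite program of polynomial size.

    Give each vertex v an unknown x_v, to be thought of as t to the power of
    the value of v for some huge t.  The optimality equations then turn into
    convex conditions: x_v <= x_w for each successor w of a vertex of Min,
    x_v ^ 2 <= x_a x_b for a random vertex with successors a and b (a 2 x 2
    matrix is positive semidefinite), and x_v <= the sum of the x_w over the
    successors w of a vertex of Max.  The last one replaces a maximum by a
    sum, so in base-t logarithms it is wrong by at most log n / log t.  The
    value of k is at least 1/2 if and only if some solution has
    x_win <= t x_lose and x_k >= sqrt t x_lose, provided that t is so large
    that these errors, accumulated over a play, cannot bridge the gap between
    1/2 and the values below it.

    Such a t has exponentially many bits, but two chains of additional random
    nodes produce it from the coefficients 2 and 4.  Let M = 2 ^ N.  From
    x_win <= 4 a_0, a_i ^ 2 <= x_win a_(i+1) and a_N <= x_lose one gets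
    x_win <= 4 ^ M x_lose (win_le); from 2 x_lose <= b_0,
    b_i ^ 2 <= x_lose b_(i+1) and b_N <= x_k one gets x_k >= 2 ^ M x_lose
    (state_ge).  So t = 4 ^ M.

    How large N must be follows from Cramer's rule for the matrix 2 (I - P) of
    a pair of policies.  It is an integer matrix whose rows have absolute sum at
    most 4, so its determinant is at most 4 ^ n.  Hence a value below 1/2 is
    below it by at least a fixed multiple of 4 ^ -n (value_gap), and a play
    lasts at most 2 n 4 ^ n steps on average (hitting_time).  Since each step
    costs at most one error (approx_value), any N > 6 n + 1 will do, and the
    length of the encoded game exceeds that.  The value itself is the largest
    subsolution of the optimality equations (bellman_ex), and greedy policies
    attain it by the maximum principle for absorbed chains (stopping_le0).

    The reduction is computable in polynomial time because each coefficient of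
    the program is decided by a bounded number of comparisons of indices and of
    lookups in the input word, so that its encoding is printed by nested loops.
    The loops are programs for counter machines, which compose easily and which a
    Turing machine with one tape per register follows step by step
    (sim_tm_correct).  A judgement on programs (prints) records what they print
    together with a polynomial bound on their running time. *)

(** * Hitting probabilities of finite Markov chains *)

Section Chain.
Variables (R : realType) (V : finType) (T : V -> V -> R) (A : pred V).
Hypothesis T_ge0 : forall u v, 0 <= T u v.
Hypothesis T_sum1 : forall u, \sum_v T u v = 1.

Lemma sum_tupleS n (P : pred (seq V)) (F : seq V -> R) :
  \sum_(p : n.+1.-tuple V | P p) F p =
  \sum_v \sum_(p : n.-tuple V | P (v :: p)) F (v :: p).
Proof.
rewrite pair_big_dep /=.
rewrite (reindex (fun vp : V * n.-tuple V => [tuple of vp.1 :: vp.2])) //=.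
exists (fun p : n.+1.-tuple V => (thead p, [tuple of behead p] : n.-tuple V)) => [[v p] _|p _] /=.
  by rewrite theadE; congr (_, _); exact: val_inj.
by case/tupleP: p => v p; apply: val_inj.
Qed.

Lemma sum_tuple0 (F : seq V -> R) : \sum_(p : 0.-tuple V) F p = F [::].
Proof.
by rewrite (big_pred1 [tuple]) //= => p; rewrite [p]tuple0; apply/esym/eqP.
Qed.

Lemma path_prob_total u n : \sum_(p : n.-tuple V) path_prob T u p = 1.
Proof.
elim: n u => [|n IH] u; first by rewrite sum_tuple0.
rewrite (@sum_tupleS n predT) -(T_sum1 u); apply: eq_bigr => v _ /=.
by rewrite -big_distrr /= IH mulr1.
Qed.

Lemma reach_withinS u n : reach_within T u A n.+1 =
  if A u then 1 else \sum_v T u v * reach_within T v A n.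
Proof.
rewrite /reach_within /=; case: (boolP (A u)) => [Au|nAu].
  by rewrite (path_prob_total u n.+1).
rewrite (@sum_tupleS n (fun s => false || has A s)); apply: eq_bigr => v _ /=.
by rewrite big_distrr.
Qed.

Lemma reach_within0 u : reach_within T u A 0 = (A u)%:R.
Proof.
rewrite /reach_within big_mkcond.
rewrite (sum_tuple0 (fun p => if has A (u :: p) then path_prob T u p else 0)) /=.
by rewrite orbF; case: (A u).
Qed.

Lemma reach_within_bounds u n : 0 <= reach_within T u A n <= 1.
Proof.
elim: n u => [|n IH] u; first by rewrite reach_within0 ler0n lern1 leq_b1.
rewrite reach_withinS; case: ifP => _; first by rewrite ler01 lexx.
apply/andP; split.
  by apply: sumr_ge0 => v _; apply: mulr_ge0 => //; case/andP: (IH v).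
rewrite -(T_sum1 u); apply: ler_sum => v _.
by rewrite ler_piMr//; case/andP: (IH v).
Qed.

Lemma reach_within_leS u n : reach_within T u A n <= reach_within T u A n.+1.
Proof.
elim: n u => [|n IH] u.
  rewrite reach_within0 reach_withinS; case: ifP => //= _.
  apply: sumr_ge0 => v _; apply: mulr_ge0 => //.
  by case/andP: (reach_within_bounds v 0).
rewrite !(reach_withinS u); case: ifP => //= _; apply: ler_sum => v _.
exact: ler_wpM2l.
Qed.

Lemma reach_within_cvg u : cvgn (reach_within T u A).
Proof.
apply: nondecreasing_is_cvgn; first exact/nondecreasing_seqP/reach_within_leS.
by exists 1 => _ [n _ <-]; case/andP: (reach_within_bounds u n).
Qed.

Lemma reach_prob_cvg u : (reach_within T u A n @[n --> \oo] --> reach_prob T u A)%classic.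
Proof. exact: reach_within_cvg. Qed.

Lemma reach_prob_rec u : reach_prob T u A =
  if A u then 1 else \sum_v T u v * reach_prob T v A.
Proof.
have : (reach_within T u A n.+1 @[n --> \oo] --> reach_prob T u A)%classic.
  by have := @reach_prob_cvg u; rewrite -cvg_shiftS.
have -> : (fun n => reach_within T u A n.+1) = (fun n => if A u then 1 else
    \sum_v T u v * reach_within T v A n).
  by apply/funext => n; rewrite reach_withinS.
move=> H; apply: (cvg_unique (@norm_hausdorff _ _) H).
case: ifP => _; first exact: cvg_cst.
apply: cvg_big => [|v _]; [exact: add_continuous|]; apply: cvgM; first exact: cvg_cst.
exact: reach_prob_cvg.
Qed.

(** Unrolling the hypothesis n times bounds z u by a constant times the
    probability that the chain started at u is not yet absorbed after n steps,
    which tends to 0. *)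
Lemma subharmonic_le0 (z : V -> R) :
  (forall u, reach_prob T u A = 1) ->
  (forall u, A u -> z u <= 0) ->
  (forall u, ~~ A u -> z u <= \sum_v T u v * z v) ->
  forall u, z u <= 0.
Proof.
move=> stop zA zT u.
pose M := \sum_v `|z v|.
have zM v : z v <= M.
  rewrite (le_trans (ler_norm _))// /M (bigD1 v)//= lerDl.
  by apply: sumr_ge0 => w _.
have M0 : 0 <= M by apply: sumr_ge0 => w _.
have zn n v : z v <= M * (1 - reach_within T v A n).
  elim: n v => [|n IH] v.
    rewrite reach_within0; case: (boolP (A v)) => Av.
      by rewrite subrr mulr0 zA.
    by rewrite subr0 mulr1.
  rewrite reach_withinS; case: (boolP (A v)) => Av.
    by rewrite subrr mulr0 zA.
  apply: le_trans (zT v Av) _.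
  rewrite -(T_sum1 v) -sumrB mulr_sumr; apply: ler_sum => w _.
  apply: le_trans (ler_wpM2l (T_ge0 v w) (IH w)) _.
  by rewrite le_eqVlt; apply/orP; left; apply/eqP; ring.
have cv : (M * (1 - reach_within T u A n) @[n --> \oo] --> M * (1 - 1))%classic.
  apply: cvgM; first exact: cvg_cst.
  apply: cvgB; first exact: cvg_cst.
  by have := @reach_prob_cvg u; rewrite stop.
move: cv; rewrite subrr mulr0 => cv.
rewrite -(cvg_lim (@norm_hausdorff _ _) cv).
by apply: limr_ge; [apply/cvg_ex; eexists; exact: cv|apply: nearW => n; exact: zn].
Qed.

End Chain.

(** * Values of stopping games *)

Section Absorbing.
Variables (R : realType) (V : finType) (T : V -> V -> R) (A : pred V).
Lemma reach_prob_absorbing u :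
  (forall v, T u v = (v == u)%:R) -> ~~ A u -> reach_prob T u A = 0.
Proof.
move=> Tu nAu; rewrite /reach_prob.
have H n : forall p : n.-tuple V, has A (u :: p) -> path_prob T u p = 0.
  elim: n => [|n IH] p; first by rewrite tuple0 /= (negbTE nAu).
  case/tupleP: p => v p /=; rewrite Tu (negbTE nAu) /=.
  by case: eqP => [->|_] hp; rewrite ?mul0r // mul1r IH //= hp orbT.
have -> : reach_within T u A = fun=> 0.
  by apply/funext => n; rewrite /reach_within big1 // => p; exact: H.
exact: lim_cst.
Qed.
End Absorbing.

Section Game.
Variables (R : realType) (V : finType) (G : ssg V).
Implicit Types (sigma tau : V -> V) (u v w : V) (z chi : V -> R).

Notation P := (trans_prob R G).
Notation rwd := (@reward R V G).

Lemma trans_ge0 sigma tau v w : 0 <= P sigma tau v w.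
Proof. by rewrite /trans_prob; case: (owner G v) => //; case: ifP => // _; rewrite invr_ge0. Qed.

Definition rand_mean z v : R := (\sum_(w | edge G v w) z w) / 2.

Lemma trans_sum sigma tau v z : \sum_w P sigma tau v w * z w =
  match owner G v with
  | Min => z (sigma v) | Max => z (tau v) | Rand => rand_mean z v end.
Proof.
rewrite /trans_prob /rand_mean; case: (owner G v).
- rewrite (bigD1 (sigma v)) //= eqxx mul1r big1 ?addr0 // => w /negbTE ->.
  by rewrite mul0r.
- rewrite (bigD1 (tau v)) //= eqxx mul1r big1 ?addr0 // => w /negbTE ->.
  by rewrite mul0r.
rewrite mulr_suml [RHS]big_mkcond; apply: eq_bigr => w _.
by case: ifP; rewrite ?mul0r // mulrC.
Qed.

Lemma trans_sum1 sigma tau v : \sum_w P sigma tau v w = 1.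
Proof.
have := trans_sum sigma tau v (fun=> 1).
under eq_bigr do rewrite mulr1.
move=> ->; rewrite /rand_mean; case E: (owner G v) => //.
have := ssg_rand E; rewrite cardsE => c2.
by rewrite sumr_const c2 divff.
Qed.

Lemma terminal_edges v : v \in pred2 (win G) (lose G) ->
  owner G v <> Rand /\ forall w, edge G v w = (w == v).
Proof.
move=> vt; have e w : edge G v w = (w == v).
  by case/pred2P: vt => ->; rewrite ?ssg_win ?ssg_lose.
split=> // /ssg_rand; rewrite (_ : [set w | _]%SET = [set v]%SET) ?cards1 //.
by apply/setP => w; rewrite !inE e.
Qed.

Lemma owner_win : owner G (win G) <> Rand.
Proof. by case: (@terminal_edges (win G)); rewrite // !inE eqxx. Qed.

Lemma owner_lose : owner G (lose G) <> Rand.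
Proof. by case: (@terminal_edges (lose G)); rewrite // !inE eqxx orbT. Qed.

Lemma trans_absorbing sigma tau v w : min_policy G sigma -> max_policy G tau ->
  v \in pred2 (win G) (lose G) -> P sigma tau v w = (w == v)%:R.
Proof.
move=> ps pt /terminal_edges [nr e]; rewrite /trans_prob.
case E: (owner G v) => //.
  by have := ps _ E; rewrite e => /eqP ->.
by have := pt _ E; rewrite e => /eqP ->.
Qed.

Lemma reward_win sigma tau : rwd sigma tau (win G) = 1.
Proof.
rewrite /reward reach_prob_rec /= ?eqxx //; [exact: trans_ge0|exact: trans_sum1].
Qed.

Lemma reward_lose sigma tau : min_policy G sigma -> max_policy G tau ->
  rwd sigma tau (lose G) = 0.
Proof.
move=> ps pt; apply: reach_prob_absorbing => [v|].
  by rewrite trans_absorbing //= !inE eqxx orbT.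
by rewrite /= eq_sym ssg_win_lose.
Qed.

Lemma reward_rec sigma tau v : v != win G ->
  rwd sigma tau v = \sum_w P sigma tau v w * rwd sigma tau w.
Proof.
move=> nw; rewrite {1}/reward reach_prob_rec /= ?(negbTE nw) //.
  exact: trans_ge0.
exact: trans_sum1.
Qed.

Lemma stopping_le0 sigma tau z : stopping R G ->
  min_policy G sigma -> max_policy G tau ->
  z (win G) <= 0 -> z (lose G) <= 0 ->
  (forall v, v != win G -> v != lose G -> z v <= \sum_w P sigma tau v w * z w) ->
  forall v, z v <= 0.
Proof.
move=> stop ps pt zw zl zP.
apply: (@subharmonic_le0 _ _ (P sigma tau) (pred2 (win G) (lose G))).
- exact: trans_ge0.
- exact: trans_sum1.
- by move=> u; exact: stop.
- by move=> u /pred2P [->|->].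
- by move=> u; rewrite /= negb_or => /andP [? ?]; exact: zP.
Qed.

(** The optimality equations.  Minima and maxima over the successors are split
    into a bound and a successor attaining it, so that no default value for an
    empty set of successors is involved. *)
Definition bellman chi : Prop :=
  [/\ chi (win G) = 1, chi (lose G) = 0 & forall v,
  match owner G v with
  | Min => (forall w, edge G v w -> chi v <= chi w) /\
           (exists2 w, edge G v w & chi w <= chi v)
  | Max => (forall w, edge G v w -> chi w <= chi v) /\
           (exists2 w, edge G v w & chi v <= chi w)
  | Rand => chi v = rand_mean chi v
  end].

Lemma rand_mean_le z z' v : (forall w, z w <= z' w) -> rand_mean z v <= rand_mean z' v.
Proof. by move=> zz; rewrite /rand_mean ler_pM2r ?invr_gt0 //; apply: ler_sum. Qed.

Lemma rand_mean_cst c v : owner G v = Rand -> rand_mean (fun=> c) v = c.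
Proof.
by move=> /ssg_rand; rewrite cardsE /rand_mean sumr_const => ->;
rewrite -[c *+ 2]mulr_natr mulfK ?pnatr_eq0.
Qed.

(** That c is at most what the optimality equations compute at v from the values
    z, without minima or maxima.  The condition is monotone in z, so the pointwise
    supremum of subsolutions is again a subsolution. *)
Definition below z v c : Prop :=
  if v == win G then is_true (c <= 1) else if v == lose G then is_true (c <= 0) else
  match owner G v with
  | Min => forall w, edge G v w -> c <= z w
  | Max => exists2 w, edge G v w & c <= z w
  | Rand => is_true (c <= rand_mean z v)
  end.

Lemma below_le z z' v c : (forall w, z w <= z' w) -> below z v c -> below z' v c.
Proof.
move=> zz; rewrite /below; case: ifP => // _; case: ifP => // _.
case: (owner G v) => [H w /H h|[w e h]|h].
- exact: le_trans (zz w).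
- by exists w => //; exact: le_trans (zz w).
- exact: le_trans h (rand_mean_le _ zz).
Qed.

(** As in the Knaster-Tarski theorem, the supremum chi of all subsolutions is a
    subsolution, and it is the largest one; if its value at some vertex could be
    raised, the raised vector would be a larger subsolution. *)
Lemma bellman_ex : exists chi, bellman chi.
Proof.
pose S := [set z : V -> R | forall v, z v <= 1 /\ below z v (z v)]%classic.
pose chi v := sup [set z v | z in S]%classic.
have S0 : S (fun=> 0).
  move=> v; split => //; rewrite /below; case: ifP => // _; case: ifP => // _.
  case E: (owner G v) => //; last by rewrite rand_mean_cst.
  by have [w] := ssg_out G v; exists w.
have ub v z : S z -> z v <= chi v.
  move=> Sz; apply: ub_le_sup; last by exists z.
  by exists 1 => _ [z' Sz' <-]; case: (Sz' v).
have lub v c : (forall z, S z -> z v <= c) -> chi v <= c.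
  move=> H; apply: ge_sup; first by exists 0; exists (fun=> 0).
  by move=> _ [z' Sz' <-]; exact: H.
have chiS : S chi.
  move=> v; split; first by apply: lub => z /(_ v) [].
  have H z : S z -> below chi v (z v).
    by move=> Sz; apply: (@below_le z) => [w|]; [exact: ub|case: (Sz v)].
  rewrite /below in H *; case: ifP H => [_ H|_]; first exact: lub.
  case: ifP => [_ H|_]; first exact: lub.
  case E: (owner G v) => H; last exact: lub.
    by move=> w e; apply: lub => z /H; apply.
  have [w0 e0] := ssg_out G v.
  have [w ew mw] := @arg_maxP _ _ V w0 (edge G v) chi e0.
  by exists w => //; apply: lub => z /H [w' e' h]; apply: le_trans h (mw _ e').
have improve v c : c <= 1 -> below chi v c -> c <= chi v.
  move=> c1 bc; case: (leP c (chi v)) => // lt.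
  pose z u := if u == v then c else chi u.
  have zz u : chi u <= z u by rewrite /z; case: eqP => [->|//]; exact: ltW.
  have : S z.
    move=> u; split.
      by rewrite /z; case: ifP => // _; case: (chiS u).
    apply: (@below_le chi) => //; rewrite /z; case: eqP => [->//|_].
    by case: (chiS u).
  by move=> /(ub v); rewrite /z eqxx leNgt lt.
have c1 v : chi v <= 1 by case: (chiS v).
have cb v : below chi v (chi v) by case: (chiS v).
have wl := ssg_win_lose G.
have chiw : chi (win G) = 1.
  by apply/eqP; rewrite eq_le c1 improve // /below eqxx.
have chil : chi (lose G) = 0.
  apply/eqP; rewrite eq_le improve ?andbT //.
    by have := cb (lose G); rewrite /below eq_sym (negbTE wl) eqxx.
  by rewrite /below eq_sym (negbTE wl) eqxx.
exists chi; split => // v.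
case: (boolP (v \in pred2 (win G) (lose G))) => [/terminal_edges [nr e]|].
  have ev : edge G v v by rewrite e.
  have eq w : edge G v w -> w = v by rewrite e => /eqP.
  by case E: (owner G v) nr => // _; split=> [w /eq ->|] //; exists v.
rewrite !inE negb_or => /andP [nw nl].
have := cb v; have := improve v; rewrite /below (negbTE nw) (negbTE nl).
case E: (owner G v) => imp H.
- split => //; have [w0 e0] := ssg_out G v.
  have [w ew mw] := @arg_minP _ _ V w0 (edge G v) chi e0.
  by exists w => //; apply: imp.
- by split => // w e; apply: imp => //; exists w.
- apply/eqP; rewrite eq_le H imp //.
  by rewrite -[leRHS](rand_mean_cst 1 E) rand_mean_le.
Qed.

Lemma min_policy_ex (Q : V -> V -> Prop) :
  (forall v, owner G v = Min -> exists2 w, edge G v w & Q v w) ->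
  exists2 sigma, min_policy G sigma & forall v, owner G v = Min -> Q v (sigma v).
Proof.
move=> H; have /choice [s Hs] : forall v, exists w, owner G v = Min -> edge G v w /\ Q v w.
  move=> v; case E: (owner G v); try by exists v.
  by have [w ? ?] := H v E; exists w.
by exists s => v /Hs [].
Qed.

Lemma max_policy_ex (Q : V -> V -> Prop) :
  (forall v, owner G v = Max -> exists2 w, edge G v w & Q v w) ->
  exists2 tau, max_policy G tau & forall v, owner G v = Max -> Q v (tau v).
Proof.
move=> H; have /choice [s Hs] : forall v, exists w, owner G v = Max -> edge G v w /\ Q v w.
  move=> v; case E: (owner G v); try by exists v.
  by have [w ? ?] := H v E; exists w.
by exists s => v /Hs [].
Qed.

Section Values.
Variables (chi : V -> R).
Hypotheses (stop : stopping R G) (chiB : bellman chi).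

Lemma bellman_min_policy : exists2 sigma, min_policy G sigma &
  forall tau v, max_policy G tau -> \sum_w P sigma tau v w * chi w <= chi v.
Proof.
have [_ _ B] := chiB.
have [v E|s ps Hs] := @min_policy_ex (fun v w => chi w <= chi v).
  by have := B v; rewrite E => -[_].
exists s => // tau v pt; rewrite trans_sum; have := B v.
case E: (owner G v) => B'; [exact: Hs| |by rewrite -B'].
by case: B' => h _; apply: h; exact: pt.
Qed.

Lemma bellman_max_policy : exists2 tau, max_policy G tau &
  forall sigma v, min_policy G sigma -> chi v <= \sum_w P sigma tau v w * chi w.
Proof.
have [_ _ B] := chiB.
have [v E|s ps Hs] := @max_policy_ex (fun v w => chi v <= chi w).
  by have := B v; rewrite E => -[_].
exists s => // tau v pt; rewrite trans_sum; have := B v.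
case E: (owner G v) => B'; [ |exact: Hs|by rewrite -B'].
by case: B' => h _; apply: h; exact: pt.
Qed.

(** Let one player be greedy with respect to chi.  Whatever the opponent does,
    the difference between chi and the reward is subharmonic up to sign and
    vanishes at both terminal states, so the maximum principle compares the
    two. *)
Lemma bellman_is_value : is_value G chi.
Proof.
have [s ps Hs] := bellman_min_policy; have [t pt Ht] := bellman_max_policy.
have [cw cl _] := chiB.
exists s, t; split => // u sigma tau psi pta; apply/andP; split.
  rewrite -subr_le0; move: u; apply: (stopping_le0 (sigma := s) (tau := tau)) => //.
  - by rewrite reward_win cw subrr.
  - by rewrite reward_lose // cl subrr.
  move=> v nw nl; rewrite (reward_rec _ _ nw).
  under [leRHS]eq_bigr do rewrite mulrBr.
  by rewrite sumrB lerB // Hs.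
rewrite -subr_le0; move: u; apply: (stopping_le0 (sigma := sigma) (tau := t)) => //.
- by rewrite reward_win cw subrr.
- by rewrite reward_lose // cl subrr.
move=> v nw nl; rewrite (reward_rec _ _ nw).
under [leRHS]eq_bigr do rewrite mulrBr.
by rewrite sumrB lerB // Ht.
Qed.

(** Play the optimal policy of one saddle point against that of the other. *)
Lemma is_value_uniq chi' : is_value G chi' -> chi' = chi.
Proof.
have [s [t [ps pt H]]] := bellman_is_value.
move=> [s' [t' [ps' pt' H']]]; apply/funext => u; apply/eqP; rewrite eq_le.
have /andP [a _] := H u s' t' ps' pt'; have /andP [_ b] := H u s' t' ps' pt'.
have /andP [a' _] := H' u s t ps pt; have /andP [_ b'] := H' u s t ps pt.
by rewrite (le_trans b' a) (le_trans b a').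
Qed.

End Values.
End Game.

(** * Separation of values and expected duration *)

(** The product of the row sums expands over all functions from rows to columns,
    and the permutations are some of them. *)
Lemma det_norm_le (D : numDomainType) m (A : 'M[D]_m) :
  `|\det A| <= \prod_i \sum_j `|A i j|.
Proof.
rewrite bigA_distr_bigA /= /determinant.
apply: (le_trans (ler_norm_sum _ _ _)).
rewrite (eq_bigr (fun s : 'S_m =>
    (fun f : {ffun 'I_m -> 'I_m} => \prod_i `|A i (f i)|) (pval s))); last first.
  move=> s _; rewrite normrM normrX normrN1 expr1n mul1r normr_prod.
  by apply: eq_bigr => i _; rewrite pvalE.
pose S := [set pval s | s : 'S_m]%SET.
rewrite [leRHS](bigID (mem S)) /= -[leLHS]addr0 lerD //.
  rewrite /S big_imset /=; last by move=> s t _ _; exact: val_inj.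
  by rewrite le_eqVlt; apply/orP; left; apply/eqP; apply: eq_bigl => s; rewrite inE.
by apply: sumr_ge0 => f _; apply: prodr_ge0.
Qed.

Lemma det_norm_le_rows m c (A : 'M[int]_m) :
  (forall i, \sum_j `|A i j| <= c%:Z) -> `|\det A| <= (c ^ m)%:Z.
Proof.
move=> H; apply: le_trans (det_norm_le A) _.
rewrite (_ : (c ^ m)%:Z = \prod_(i < m) c%:Z); last first.
  by rewrite prodr_const card_ord -!natz natrX.
apply: ler_prod => i _; rewrite H andbT; exact: sumr_ge0.
Qed.

Lemma adj_norm_le m c (A : 'M[int]_m) i j : (0 < c)%N ->
  (forall i, \sum_j `|A i j| <= c%:Z) -> `|(\adj A) i j| <= (c ^ m)%:Z.
Proof.
move=> c0 H; rewrite mxE /cofactor normrM normrX normrN1 expr1n mul1r.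
apply: le_trans (det_norm_le_rows (c := c) _) _ => [k|].
  apply: le_trans (H (lift j k)).
  under eq_bigr do rewrite !mxE.
  case: m A i j k {H} => [|m] A i j k; first by case: i.
  by rewrite [leRHS](bigD1_ord i) //= lerDr.
by rewrite lez_nat leq_pexp2l // leq_pred.
Qed.

Section GameMatrix.
Variables (R : realType) (n : nat) (G : ssg 'I_n).
Hypothesis stop : stopping R G.
Variables (sigma tau : 'I_n -> 'I_n).
Hypotheses (ps : min_policy G sigma) (pt : max_policy G tau).
Implicit Types (z : 'I_n -> R).

Notation terminal v := ((v == win G) || (v == lose G)).

(** Doubled, because transition probabilities are multiples of 1/2. *)
Definition twice_trans v w : int :=
  match owner G v with
  | Min => ((w == sigma v)%:R) *+ 2
  | Max => ((w == tau v)%:R) *+ 2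
  | Rand => (edge G v w)%:R
  end.

Lemma twice_transE v w : (twice_trans v w)%:~R = 2 * trans_prob R G sigma tau v w.
Proof.
rewrite /twice_trans /trans_prob; case: (owner G v).
- by case: eqP => _; rewrite ?mulr1 ?mulr0.
- by case: eqP => _; rewrite ?mulr1 ?mulr0.
- by case: ifP => _; rewrite ?mulr0 // divff.
Qed.

(** Twice I - P, with P replaced by 0 in the rows of the two terminal states, as
    otherwise these rows would vanish.  The reward vector is the solution for the
    right-hand side that is 2 at win and 0 elsewhere. *)
Definition game_mx : 'M[int]_n := \matrix_(v, w)
  ((v == w)%:R *+ 2 - (if terminal v then 0 else twice_trans v w)).

Definition real_game_mx : 'M[R]_n := map_mx intr game_mx.

Lemma real_game_mx_mul z v : \sum_w real_game_mx v w * z w =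
  2 * (z v - if terminal v then 0 else \sum_w trans_prob R G sigma tau v w * z w).
Proof.
transitivity (\sum_w (2 * ((v == w)%:R * z w) -
    2 * (if terminal v then 0 else trans_prob R G sigma tau v w * z w))).
  apply: eq_bigr => w _; rewrite !mxE rmorphB /= rmorphMn /= rmorph_nat.
  by case: ifP => _; rewrite ?rmorph0 ?twice_transE; ring.
rewrite sumrB -!mulr_sumr mulrBr; congr (_ - 2 * _).
  congr (2 * _); rewrite (bigD1 v) //= eqxx mul1r big1 ?addr0 // => w /negbTE.
  by rewrite eq_sym => ->; rewrite mul0r.
by case: ifP => //; rewrite big1.
Qed.

Lemma game_mx_row v : \sum_w `|game_mx v w| <= 4%:Z.
Proof.
have H w : 0 <= (if terminal v then 0 else twice_trans v w).
  case: ifP => // _; rewrite /twice_trans; by case: (owner G v) => //; case: (w == _).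
apply: (@le_trans _ _ (\sum_w ((v == w)%:R *+ 2 + (if terminal v then 0 else twice_trans v w)))).
  apply: ler_sum => w _; rewrite mxE.
  apply: le_trans (ler_normB _ _) _; rewrite (ger0_norm (H w)) ger0_norm //.
suff : ((\sum_w ((v == w)%:R *+ 2 + (if terminal v then 0 else twice_trans v w)))%:~R : R) <= 4%:~R.
  by rewrite ler_int.
rewrite rmorph_sum /=.
have -> : 4%:~R = 2 * (1 + 1) :> R by ring.
rewrite (eq_bigr (fun w => 2 * ((v == w)%:R +
    if terminal v then 0 else trans_prob R G sigma tau v w))); last first.
  move=> w _; rewrite rmorphD /= rmorphMn /= rmorph_nat.
  by case: ifP => _; rewrite ?rmorph0 ?twice_transE; ring.
rewrite -mulr_sumr ler_pM2l // big_split /= lerD //.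
  rewrite (bigD1 v) //= eqxx big1 ?addr0 // => w /negbTE.
  by rewrite eq_sym => ->.
case: (terminal v); last by rewrite trans_sum1.
by rewrite big1.
Qed.

Lemma det_real_game_mx : \det real_game_mx = (\det game_mx)%:~R.
Proof. exact: det_map_mx. Qed.

(** A vector of the kernel vanishes at the terminal states and is harmonic
    elsewhere, so the maximum principle applies to it and to its opposite. *)
Lemma det_game_mx_neq0 : \det game_mx != 0.
Proof.
have -> : (\det game_mx != 0) = (\det real_game_mx^T != 0)
  by rewrite det_tr det_real_game_mx intr_eq0.
apply/negP => /det0P [x x0 xA].
pose z v := x 0 v.
have zA v : \sum_w real_game_mx v w * z w = 0.
  have := congr1 (fun M : 'rV_n => M 0 v) xA; rewrite mxE [RHS]mxE => H; rewrite -[RHS]H.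
  by apply: eq_bigr => w _; rewrite [(_^T) _ _]mxE mulrC.
have zE v : z v = if terminal v then 0 else \sum_w trans_prob R G sigma tau v w * z w.
  have /eqP := zA v; rewrite real_game_mx_mul mulf_eq0 pnatr_eq0 /= subr_eq0 => /eqP //.
have zw : z (win G) = 0 by rewrite zE eqxx.
have zl : z (lose G) = 0 by rewrite zE eqxx orbT.
have z0 : forall v, z v <= 0.
  apply: (stopping_le0 stop ps pt); rewrite ?zw ?zl // => v nw nl.
  by rewrite {1}zE (negbTE nw) (negbTE nl).
have z1 : forall v, - z v <= 0.
  apply: (stopping_le0 stop ps pt); rewrite ?zw ?zl ?oppr0 // => v nw nl.
  rewrite {1}zE (negbTE nw) (negbTE nl) /= -sumrN le_eqVlt; apply/orP; left.
  by apply/eqP; apply: eq_bigr => w _; rewrite mulrN.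
move/eqP: x0; apply; apply/rowP => v; rewrite mxE; apply/eqP.
by rewrite eq_le z0 -oppr_le0 z1.
Qed.

Lemma real_game_mx_solve z b : (forall v, \sum_w real_game_mx v w * z w = b v) ->
  forall v, \det real_game_mx * z v = \sum_w (\adj game_mx v w)%:~R * b w.
Proof.
move=> H v; pose x : 'cV[R]_n := \col_w z w.
have : \adj real_game_mx *m (real_game_mx *m x) = (\det real_game_mx)%:M *m x
  by rewrite mulmxA mul_adj_mx.
move/(congr1 (fun M : 'cV_n => M v 0)); rewrite mul_scalar_mx !mxE => <-.
apply: eq_bigr => w _; rewrite /real_game_mx -map_mx_adj mxE; congr (_ * _).
by rewrite mxE -H; apply: eq_bigr => u _; rewrite [x _ _]mxE.
Qed.

Lemma det_real_game_mx_ge1 : 1 <= `|\det real_game_mx|.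
Proof.
rewrite det_real_game_mx -intr_norm -[1]/(1%:~R) ler_int -gtz0_ge1 normr_gt0.
exact: det_game_mx_neq0.
Qed.

Lemma det_real_game_mx_le : `|\det real_game_mx| <= (4 ^ n)%:R.
Proof.
rewrite det_real_game_mx -intr_norm pmulrn ler_int.
exact: det_norm_le_rows game_mx_row.
Qed.

(** The solution h is the expected number of steps before absorption.  In
    Cramer's rule the denominator is a nonzero integer, and each of the n minors
    in the numerator is at most 4 ^ n. *)
Lemma hitting_time : exists h : 'I_n -> R,
  [/\ h (win G) = 0, h (lose G) = 0,
     forall v, ~~ terminal v -> h v = 1 + \sum_w trans_prob R G sigma tau v w * h w
   & forall v, h v <= (n * 4 ^ n)%:R *+ 2].
Proof.
pose b : 'cV[R]_n := \col_v (if terminal v then 0 else 2).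
have du : real_game_mx \in unitmx.
  by rewrite unitmxE unitfE -normr_gt0; apply: lt_le_trans det_real_game_mx_ge1.
pose x := invmx real_game_mx *m b; pose h v := x v 0.
have hA v : \sum_w real_game_mx v w * h w = b v 0.
  have : real_game_mx *m x = b by rewrite mulmxA mulmxV // mul1mx.
  by move/(congr1 (fun M : 'cV_n => M v 0)); rewrite mxE.
have hE v : 2 * (h v - if terminal v then 0 else
      \sum_w trans_prob R G sigma tau v w * h w) =
      if terminal v then 0 else 2.
  by rewrite -real_game_mx_mul hA mxE.
exists h; split.
- by have := hE (win G); rewrite eqxx subr0 => /eqP; rewrite mulf_eq0 pnatr_eq0 /= => /eqP.
- by have := hE (lose G); rewrite eqxx orbT subr0 => /eqP; rewrite mulf_eq0 pnatr_eq0 /= => /eqP.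
- move=> v nt; have := hE v; rewrite (negbTE nt); lra.
- move=> v; apply: le_trans (ler_norm _) _.
  have d1 := det_real_game_mx_ge1.
  have : `|h v| <= `|\det real_game_mx| * `|h v| by rewrite ler_peMl.
  move=> /le_trans; apply; rewrite -normrM (real_game_mx_solve hA).
  apply: (le_trans (ler_norm_sum _ _ _)).
  apply: (@le_trans _ _ (\sum_(w < n) (4 ^ n)%:R *+ 2)); last first.
    by rewrite sumr_const card_ord natrM -[leLHS]mulr_natl mulrnAr.
  apply: ler_sum => w _; rewrite normrM -mulr_natr; apply: ler_pM => //.
    rewrite -intr_norm pmulrn ler_int; apply: adj_norm_le => //.
    exact: game_mx_row.
  by rewrite mxE; case: ifP => _; rewrite ?normr0 ?ler0n // ger0_norm.
Qed.

End GameMatrix.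

Section ValueGap.
Variables (R : realType) (n : nat) (G : ssg 'I_n) (chi : 'I_n -> R).
Hypotheses (stop : stopping R G) (chiB : bellman G chi).

(** By Cramer's rule 1 - 2 chi k is an integer multiple of the inverse of a
    determinant that is at most 4 ^ n in absolute value. *)
Lemma value_gap k : chi k < 2^-1 -> 1 <= (4 ^ n)%:R * (1 - 2 * chi k).
Proof.
move=> lt.
have [s ps Hs] := bellman_min_policy chiB.
have [t pt Ht] := bellman_max_policy chiB.
have [cw cl _] := chiB.
have chiP v : chi v = \sum_w trans_prob R G s t v w * chi w.
  by apply/eqP; rewrite eq_le Hs // Ht.
pose b (v : 'I_n) : R := if v == win G then 2 else 0.
have H v : \sum_w real_game_mx R G s t v w * chi w = b v.
  rewrite real_game_mx_mul -chiP /b.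
  case: (eqVneq v (win G)) => [->|nw] /=; first by rewrite cw subr0 mulr1.
  by case: eqP => [->|_]; rewrite ?cl ?subrr ?subr0 mulr0.
have := real_game_mx_solve H k; rewrite (bigD1 (win G)) //= big1 => [|w /negbTE nw]; last first.
  by rewrite /b nw mulr0.
rewrite addr0 /b eqxx => E.
pose m : int := \det (game_mx G s t) - (\adj (game_mx G s t) k (win G)) *+ 4.
have mE : m%:~R = \det (real_game_mx R G s t) * (1 - 2 * chi k).
  rewrite /m rmorphB /= rmorphMn /= -det_real_game_mx mulrBr mulr1 mulrCA E; ring.
have p : 0 < 1 - 2 * chi k by lra.
have d0 : \det (real_game_mx R G s t) != 0.
  by rewrite -normr_gt0; apply: lt_le_trans (det_real_game_mx_ge1 stop ps pt).
have : 1 <= `|m%:~R : R|.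
  rewrite -intr_norm -[1]/(1%:~R) ler_int -gtz0_ge1 normr_gt0.
  by rewrite -(intr_eq0 R) mE mulf_neq0 // gt_eqF.
rewrite mE normrM (gtr0_norm p) => /le_trans; apply.
by rewrite ler_pM2r // det_real_game_mx_le.
Qed.

(** Let Min follow an optimal policy for chi, and Max move where z drops by
    at most eps.  Along this chain z - c chi decreases by at most eps per
    step on average, and it ends nonpositive, so it is initially at most eps times
    the expected duration. *)
Lemma approx_value z (eps c : R) : 0 <= eps -> 0 <= c ->
  z (lose G) <= 0 -> z (win G) <= c ->
  (forall v w, v != win G -> v != lose G -> owner G v = Min -> edge G v w -> z v <= z w) ->
  (forall v, v != win G -> v != lose G -> owner G v = Max ->
     exists2 w, edge G v w & z v <= z w + eps) ->
  (forall v, v != win G -> v != lose G -> owner G v = Rand -> z v <= rand_mean G z v) ->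
  forall v, z v <= c * chi v + eps * ((n * 4 ^ n)%:R *+ 2).
Proof.
move=> e0 c0 zl zw zmin zmax zrand v.
have [s ps Hs] := bellman_min_policy chiB.
have [cw cl _] := chiB.
pose Q v w := v != win G -> v != lose G -> z v <= z w + eps.
have [u E|t pt Ht] := @max_policy_ex _ G Q.
  case: (boolP (u == win G)) => [/eqP uw|uw].
    by exists (win G); rewrite uw ?ssg_win // /Q eqxx.
  case: (boolP (u == lose G)) => [/eqP ul|ul].
    by exists (lose G); rewrite ul ?ssg_lose // /Q eqxx.
  by have [w ew zw'] := zmax u uw ul E; exists w.
have [h [hw hl hP hb]] := hitting_time stop ps pt.
suff : z v - c * chi v - eps * h v <= 0.
  have := ler_wpM2l e0 (hb v); lra.
move: v; apply: (stopping_le0 stop ps pt).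
- rewrite hw cw; lra.
- rewrite hl cl; lra.
move=> v nw nl; rewrite hP ?negb_or ?nw //.
have zP : z v <= \sum_w trans_prob R G s t v w * z w + eps.
  rewrite trans_sum; case E: (owner G v).
  - by rewrite -[leLHS]addr0 lerD // zmin // ps.
  - exact: Ht.
  - by rewrite -[leLHS]addr0 lerD // zrand.
have cP := ler_wpM2l c0 (Hs t v pt).
rewrite [leRHS](eq_bigr (fun w => trans_prob R G s t v w * z w
  - c * (trans_prob R G s t v w * chi w)
  - eps * (trans_prob R G s t v w * h w))); last by move=> w _; ring.
rewrite !sumrB -!mulr_sumr; lra.
Qed.
End ValueGap.

(** * A semidefinite program for a network of min, max and mean inequalities *)

Section PsdMinors.
Variables (R : realType) (m : nat) (S : 'M[R]_m).
Hypothesis psdS : psdmx S.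

Lemma psd_form2 i j (a b : R) :
  0 <= a ^+ 2 * S i i + 2 * a * b * S i j + b ^+ 2 * S j j.
Proof.
have [sS pS] := psdS.
have Sji : S j i = S i j by rewrite -[in LHS]sS mxE.
have := pS (a *: delta_mx i 0 + b *: delta_mx j 0).
have -> : (a *: delta_mx i 0 + b *: delta_mx j 0 : 'cV_m)^T =
    a *: delta_mx 0 i + b *: delta_mx 0 j.
  by apply/matrixP => x y; rewrite !mxE !(andbC (y == _)).
rewrite !mulmxDl !mulmxDr -!scalemxAl -!scalemxAr -!rowE.
have E k l : (row k S *m (delta_mx l 0 : 'cV_m)) 0 0 = S k l by rewrite -colE !mxE.
have addE (A B : 'M[R]_1) : (A + B) 0 0 = A 0 0 + B 0 0 by rewrite mxE.
have sclE c (A : 'M[R]_1) : (c *: A) 0 0 = c * A 0 0 by rewrite mxE.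
rewrite !(addE, sclE, E).
by rewrite Sji => /le_trans; apply; rewrite le_eqVlt; apply/orP; left; apply/eqP; ring.
Qed.

Lemma psd_diag_ge0 i : 0 <= S i i.
Proof.
by have := psd_form2 i i 1 0; rewrite expr1n mul1r !mulr0 mul0r !addr0 expr0n mul0r addr0.
Qed.

Lemma psd_minor2 i j : S i j ^+ 2 <= S i i * S j j.
Proof.
have dj := psd_diag_ge0 j.
case: (ltrgtP (S j j) 0) dj => // [dj|dj] _.
  have := psd_form2 i j (S j j) (- S i j).
  have -> : S j j ^+ 2 * S i i + 2 * S j j * - S i j * S i j +
    (- S i j) ^+ 2 * S j j = S j j * (S i i * S j j - S i j ^+ 2) by ring.
  by rewrite pmulr_rge0 // subr_ge0.
rewrite dj mulr0; case: (eqVneq (S i j) 0) => [->|nz]; first by rewrite expr0n.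
(* The form is affine in the second coordinate; this one gives it the value -1. *)
have := psd_form2 i j 1 (- (S i i + 1) / (2 * S i j)).
rewrite dj mulr0 addr0 expr1n mul1r mulr1.
have -> : S i i + 2 * (- (S i i + 1) / (2 * S i j)) * S i j = -1 by field.
by rewrite oppr_ge0 ler10.
Qed.

End PsdMinors.

Section PairIndex.
Variable m : nat.

Lemma pair_index_lt (p q : 'I_m) : (p * m + q < m * m)%N.
Proof.
apply: (@leq_trans (p * m + m)); first by rewrite ltn_add2l.
by rewrite -mulSnr leq_mul2r ltn_ord orbT.
Qed.

Definition pair_index (pq : 'I_m * 'I_m) : 'I_(m * m) :=
  Ordinal (pair_index_lt pq.1 pq.2).

Lemma pair_index_div pq : (pair_index pq %/ m)%N = pq.1.
Proof.
have m0 : (0 < m)%N by apply: leq_ltn_trans (ltn_ord pq.1).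
by rewrite /= divnMDl // divn_small ?addn0.
Qed.

Lemma pair_index_mod pq : (pair_index pq %% m)%N = pq.2.
Proof. by rewrite /= modnMDl modn_small. Qed.

Lemma sum_pair_index (R : nmodType) (F : 'I_(m * m) -> R) :
  \sum_i F i = \sum_p \sum_q F (pair_index (p, q)).
Proof.
rewrite pair_big /= (reindex pair_index); last first.
  have dm (i : 'I_(m * m)) : (0 < m)%N by case: (m) i => // -[].
  have dP (i : 'I_(m * m)) : (i %/ m < m)%N by rewrite ltn_divLR // dm.
  have mP (i : 'I_(m * m)) : (i %% m < m)%N by rewrite ltn_mod dm.
  exists (fun i => (Ordinal (dP i), Ordinal (mP i))) => [[p q] _|i _].
    congr (_, _); apply: val_inj => /=.
      exact: (pair_index_div (p, q)).
    exact: (pair_index_mod (p, q)).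
  by apply: val_inj; rewrite /= -divn_eq.
by apply: eq_bigr => -[].
Qed.

End PairIndex.

Section GameSdp.
Variables (m : nat) (isMax isRand los : pred nat) (E : rel nat) (c d : nat -> nat).

(** Rows and columns are indexed by pairs of nodes, and blocks with different
    first components p are independent.  The block of a Max node uses the entry
    (p, p) only, that of a Min node one diagonal entry for each successor q.  The
    block of a Rand node has x_q at the diagonal entry of each successor q and
    x_p elsewhere: as there are two successors, its nonzero part is the 2 x 2
    matrix whose positivity means x_p ^ 2 <= x_q x_q'.  A node of los also uses
    its entry (p, p), for the normalisation x_p >= 1. *)
Definition lmi_coef (u p q p' q' : nat) : int :=
  if p != p' then 0
  else if isMax p then
    if (q == p) && (q' == p) then (E p u)%:R - (u == p)%:R else 0
  else if isRand p then
    if E p q && E p q' then if q == q' then (u == q)%:R else (u == p)%:R else 0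
  else if q != q' then 0
  else if E p q then (u == q)%:R *+ c p - (u == p)%:R *+ d p
  else if los p && (q == p) then (u == p)%:R else 0.

Definition lmi_const (p q p' q' : nat) : int :=
  [&& p == p', q == q', q == p & los p]%:R.

Lemma lmi_coef_sym u p q p' q' : lmi_coef u p q p' q' = lmi_coef u p' q' p q.
Proof.
rewrite /lmi_coef (eq_sym p'); case: eqVneq => //= ->; case: ifP => _; first by rewrite andbC.
case: ifP => _.
  rewrite andbC; case: ifP => // _; rewrite (eq_sym q'); by case: eqVneq => [->|].
by rewrite (eq_sym q'); case: eqVneq => //= ->.
Qed.

Lemma lmi_const_sym p q p' q' : lmi_const p q p' q' = lmi_const p' q' p q.
Proof.
rewrite /lmi_const (eq_sym p') (eq_sym q'); case: eqVneq => //= ->.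
by case: eqVneq => //= ->.
Qed.

Definition sdpA (u : 'I_m) : 'M[rat]_(m * m) := \matrix_(i, j)
  (lmi_coef u (i %/ m) (i %% m) (j %/ m) (j %% m))%:~R.
Definition sdpB : 'M[rat]_(m * m) := \matrix_(i, j)
  (lmi_const (i %/ m) (i %% m) (j %/ m) (j %% m))%:~R.

Lemma sdpA_sym u : (sdpA u)^T = sdpA u.
Proof. by apply/matrixP => i j; rewrite !mxE lmi_coef_sym. Qed.
Lemma sdpB_sym : sdpB^T = sdpB.
Proof. by apply/matrixP => i j; rewrite !mxE lmi_const_sym. Qed.

Definition game_sdp : sdp := SDP sdpA_sym sdpB_sym.

Variable R : realType.
Implicit Type x : nat -> R.

Definition node_ineqs x : Prop :=
  [/\ forall p, (p < m)%N -> isMax p -> x p <= \sum_(u < m | E p u) x u,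
      forall p q, (p < m)%N -> (q < m)%N -> ~~ isMax p -> isRand p -> E p q -> 0 <= x q,
      forall p q q', (p < m)%N -> (q < m)%N -> (q' < m)%N -> ~~ isMax p -> isRand p ->
        E p q -> E p q' -> q != q' -> x p ^+ 2 <= x q * x q',
      forall p q, (p < m)%N -> (q < m)%N -> ~~ isMax p -> ~~ isRand p -> E p q ->
        x p *+ d p <= x q *+ c p
    & forall p, (p < m)%N -> los p -> 1 <= x p].

(* The entry (p, p) must be free for the normalisation. *)
Hypothesis los_kind : forall p, los p -> [/\ ~~ isMax p, ~~ isRand p & ~~ E p p].

Definition slack x (p q p' q' : nat) : R :=
  if p != p' then 0
  else if isMax p then
    if (q == p) && (q' == p) then \sum_(u < m | E p u) x u - x p else 0
  else if isRand p then
    if E p q && E p q' then if q == q' then x q else x p else 0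
  else if q != q' then 0
  else if E p q then x q *+ c p - x p *+ d p
  else if los p && (q == p) then x p - 1 else 0.

Lemma slackE x p q p' q' : (p < m)%N -> (q < m)%N ->
  \sum_(u < m) x u * (lmi_coef u p q p' q')%:~R - (lmi_const p q p' q')%:~R =
  slack x p q p' q'.
Proof.
move=> pL qL; rewrite /lmi_coef /lmi_const /slack.
have pick r : (r < m)%N -> \sum_(u < m) x u * ((u == r :> nat)%:R : int)%:~R = x r.
  move=> rL; rewrite (bigD1 (Ordinal rL)) //= eqxx mulr1 big1 ?addr0 // => u.
  by rewrite -val_eqE /= => /negbTE ->; rewrite mulr0.
have pickn r k : (r < m)%N ->
    \sum_(u < m) x u * (((u == r :> nat)%:R : int) *+ k)%:~R = x r *+ k.
  move=> rL; rewrite -(pick r rL) -sumrMnl; apply: eq_bigr => u _.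
  by rewrite -mulrnAr; congr (_ * _); exact: rmorphMn.
have z0 : \sum_(u < m) x u * (0 : int)%:~R = 0 by rewrite big1 // => u _; rewrite mulr0.
case: (eqVneq p p') => /= [_|_]; last by rewrite z0 subr0.
case: (boolP (los p)) => [lp|nlp].
  have [/negbTE -> /negbTE -> /negbTE nE] := los_kind lp.
  case: (eqVneq q q') => /= _; last by rewrite z0 subr0.
  case: (eqVneq q p) => [->|_] /=.
    by rewrite nE pick.
  rewrite subr0; case: ifP => _; last by rewrite z0.
  under eq_bigr do rewrite rmorphB /= mulrBr.
  by rewrite sumrB !pickn.
rewrite !andbF subr0.
case: ifP => _.
  case: ifP => _; last exact: z0.
  under eq_bigr do rewrite rmorphB /= mulrBr.
  rewrite sumrB pick //; congr (_ - _); rewrite [RHS]big_mkcond.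
  by apply: eq_bigr => u _; case: (E p u); rewrite ?mulr1 ?mulr0.
case: ifP => _.
  by case: ifP => _; [case: ifP => _; rewrite pick|exact: z0].
case: ifP => _; first exact: z0.
case: ifP => _; last by rewrite z0.
under eq_bigr do rewrite rmorphB /= mulrBr.
by rewrite sumrB !pickn.
Qed.

Definition slack_mx x : 'M[R]_(m * m) := \matrix_(i, j)
  slack x (i %/ m) (i %% m) (j %/ m) (j %% m).

Lemma slack_mxE (x : nat -> R) :
  \sum_(u < m) x u *: map_mx ratr (sdpA u) - map_mx ratr sdpB = slack_mx x.
Proof.
apply/matrixP => i j; rewrite !mxE summxE.
have L0 : (0 < m)%N by case: (m) i => // -[].
rewrite -slackE ?ltn_divLR ?ltn_mod // ratr_int; congr (_ - _).
by apply: eq_bigr => u _; rewrite !mxE ratr_int.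
Qed.

Lemma slack_mx_pair x (p q p' q' : 'I_m) :
  slack_mx x (pair_index (p, q)) (pair_index (p', q')) = slack x p q p' q'.
Proof. by rewrite mxE !pair_index_div !pair_index_mod. Qed.

(** Diagonal entries and 2 x 2 minors of a positive semidefinite matrix are
    nonnegative; these are the inequalities. *)
Lemma feasible_node_ineqs : sdp_feasible R game_sdp -> exists x, node_ineqs x.
Proof.
move=> [x0 /= psd].
pose x (i : nat) : R := if insub i is Some u then x0 u else 0.
have xE : x0 = (fun u : 'I_m => x u).
  by apply/funext => u; rewrite /x valK.
move: psd; rewrite xE slack_mxE => psd; exists x.
have D p q : (p < m)%N -> (q < m)%N -> 0 <= slack x p q p q.
  move=> pL qL; have := psd_diag_ge0 psd (pair_index (Ordinal pL, Ordinal qL)).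
  by rewrite slack_mx_pair.
split.
- move=> p pL mp; have := D p p pL pL.
  by rewrite /slack eqxx /= mp /= subr_ge0.
- move=> p q pL qL /negbTE nm rp e; have := D p q pL qL.
  by rewrite /slack eqxx /= nm rp e eqxx.
- move=> p q q' pL qL qL' /negbTE nm rp e e' /negbTE qq'.
  have := psd_minor2 psd (pair_index (Ordinal pL, Ordinal qL))
    (pair_index (Ordinal pL, Ordinal qL')).
  by rewrite !slack_mx_pair /= /slack !eqxx /= nm rp e e' qq'.
- move=> p q pL qL /negbTE nm /negbTE nr e; have := D p q pL qL.
  by rewrite /slack eqxx /= nm nr e eqxx /= subr_ge0.
- move=> p pL lp; have [/negbTE nm /negbTE nr /negbTE nE] := los_kind lp.
  have := D p p pL pL.
  by rewrite /slack eqxx /= nm nr nE lp /= subr_ge0.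
Qed.

(** The quadratic form is a sum over the nodes p.  The summand of a Rand node
    involves the coordinates of its two successors only, and multiplying it by
    the diagonal entry x_q1 completes the square. *)
Lemma node_ineqs_feasible x :
  (forall p, (p < m)%N -> ~~ isMax p -> isRand p -> exists q1 q2, [/\ (q1 < m)%N, (q2 < m)%N,
     q1 != q2 & forall q, (q < m)%N -> E p q = (q == q1) || (q == q2)]) ->
  node_ineqs x -> sdp_feasible R game_sdp.
Proof.
move=> rand2 [cmax crand1 crand2 cmin clos].
exists (fun u : 'I_m => x u) => /=; rewrite slack_mxE; split.
  apply/matrixP => i j; rewrite !mxE.
  have L0 : (0 < m)%N by case: (m) i => // -[].
  by rewrite -!slackE ?ltn_divLR ?ltn_mod // lmi_const_sym;
     congr (_ - _); apply: eq_bigr => u _; rewrite lmi_coef_sym.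
move=> v.
pose V p q := v (pair_index (p, q)) 0.
have -> : (v^T *m slack_mx x *m v) 0 0 =
   \sum_(p < m) \sum_(q < m) \sum_(q' < m) slack x p q p q' * (V p q * V p q').
  rewrite mxE; under eq_bigr => j _ do rewrite mxE mulr_suml.
  rewrite exchange_big /= sum_pair_index; apply: eq_bigr => p _; apply: eq_bigr => q _.
  rewrite sum_pair_index (bigD1 p) //= [X in _ + X]big1 ?addr0; last first.
    move=> p' pp'; rewrite big1 // => q' _.
    by rewrite slack_mx_pair /slack /= val_eqE [p == p']eq_sym (negbTE pp') mulr0 mul0r.
  by apply: eq_bigr => q' _; rewrite slack_mx_pair mxE mulrC mulrA mulrC (mulrC (V _ _)).
apply: sumr_ge0 => p _.
have pL := ltn_ord p.
case: (boolP (~~ isMax p && isRand p)) => [/andP [nm rp]|nk].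
  have [q1 [q2 [L1 L2 n12 EE]]] := rand2 p pL nm rp.
  pose o1 := Ordinal L1; pose o2 := Ordinal L2.
  have n12' : (o2 == o1) = false by rewrite -val_eqE /= eq_sym (negbTE n12).
  have z (q q' : 'I_m) : ~~ (E p q && E p q') -> slack x p q p q' = 0.
    by rewrite /slack eqxx /= (negbTE nm) rp => /negbTE ->.
  have sum2 (F : 'I_m -> R) : (forall q : 'I_m, ~~ E p q -> F q = 0) ->
      \sum_q F q = F o1 + F o2.
    move=> F0; rewrite (bigD1 o1) //= (bigD1 o2) /= ?n12' //.
    rewrite [X in _ + (_ + X)]big1 ?addr0 // => q /andP [a b].
    by apply: F0; rewrite EE // negb_or; rewrite -!val_eqE in a b; rewrite a b.
  rewrite sum2 => [|q nq]; last first.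
    by rewrite big1 // => q' _; rewrite z ?mul0r // (negbTE nq).
  rewrite !sum2; try by move=> q nq; rewrite z ?mul0r // (negbTE nq) andbF.
  have e1 : E p q1 by rewrite EE // eqxx.
  have e2 : E p q2 by rewrite EE // eqxx orbT.
  rewrite /slack eqxx /= (negbTE nm) rp e1 e2 !eqxx /= (negbTE n12) eq_sym (negbTE n12).
  have x1 := crand1 p q1 pL L1 nm rp e1; have x2 := crand1 p q2 pL L2 nm rp e2.
  have x12 := crand2 p q1 q2 pL L1 L2 nm rp e1 e2 n12.
  set a := V p o1; set b := V p o2.
  have [x10|x10] := eqVneq (x q1) 0.
    have xp : x p = 0.
      apply/eqP; rewrite -sqrf_eq0 eq_le sqr_ge0 andbT.
      by move: x12; rewrite x10 mul0r.
    rewrite x10 xp !mul0r !add0r; apply: mulr_ge0 => //; exact: sqr_ge0.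
  have p1 : 0 < x q1 by rewrite lt_def x10.
  rewrite -(pmulr_rge0 _ p1).
  have -> : x q1 * (x q1 * (a * a) + x p * (a * b) + (x p * (b * a) + x q2 * (b * b))) =
    (x q1 * a + x p * b) ^+ 2 + (x q1 * x q2 - x p ^+ 2) * b ^+ 2 by ring.
  by rewrite addr_ge0 ?sqr_ge0 // mulr_ge0 ?sqr_ge0 // subr_ge0.
have z (q q' : 'I_m) : q != q' -> slack x p q p q' = 0.
  rewrite -val_eqE /slack eqxx /= => /negbTE qq'.
  move: nk; rewrite negb_and negbK; case: ifP => _ /=.
    by case: eqVneq => //= <-; rewrite eq_sym qq'.
  by move=> /negbTE ->; rewrite qq'.
apply: sumr_ge0 => q _; rewrite (bigD1 q) //= big1 ?addr0 => [|q' nq]; last first.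
  by rewrite z ?mul0r // eq_sym.
apply: mulr_ge0; last exact: sqr_ge0.
have qL := ltn_ord q.
rewrite /slack eqxx /=; move: nk; rewrite negb_and negbK; case: ifP => [mp _|/negbT nm /= nr].
  by case: ifP => // _; rewrite subr_ge0 cmax.
rewrite (negbTE nr) eqxx /=; case: ifP => [e|_]; first by rewrite subr_ge0 cmin.
by case: ifP => // /andP [lp _]; rewrite subr_ge0 clos.
Qed.

End GameSdp.

(** * The network of an encoded game *)

Section WordTables.
Local Open Scope nat_scope.
Variables (n : nat) (w : bitseq).
Implicit Types p q : nat.

(** Bit j of the record of vertex p: the unary size takes n.+1 bits and each
    record n + 5.  The records of p >= n would start after the end of the word,
    so that all these bits are false for the additional nodes. *)
Definition flag j p : bool := nth false w (n.+1 + p * (n + 5) + j).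
Definition adj p q : bool := (q < n) && flag (5 + q) p.
Definition wrand p := flag 0 p.
Definition wnot_min p := flag 1 p.
Definition wwin p := flag 2 p.
Definition wlose p := flag 3 p.
Definition wstate p := flag 4 p.
Definition word_mid := n + size w.
Definition word_tot := word_mid + size w.

(** The nodes are the n vertices followed by two chains of size w nodes.  The
    nodes from n up to word_mid relate win to lose, those from word_mid up to
    word_tot square their way from lose to the distinguished state.  The last
    node of each chain and the terminal states are Min nodes. *)
Definition node_max p : bool := [&& ~~ wrand p, wnot_min p, ~~ wwin p & ~~ wlose p].
Definition node_rand p : bool :=
  wrand p || [&& ~~ (p < n), p.+1 != word_mid & p.+1 != word_tot].
Definition node_edge p q : bool :=
  if wwin p then q == n
  else if wlose p then q == word_mid
  else if p < n then adj p q
  else if p.+1 == word_mid then wlose q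
  else if p.+1 == word_tot then wstate q
  else (q == p.+1) || (if p < word_mid then wwin q else wlose q).
Definition wt_up p : nat := if wwin p then 4 else 1.
Definition wt_dn p : nat := if wlose p then 2 else 1.

Definition word_sdp : sdp :=
  game_sdp word_tot node_max node_rand wlose node_edge wt_up wt_dn.
End WordTables.

Lemma nth_flatten_uniform (T : Type) (x0 : T) (ss : seq (seq T)) s i j :
  all (fun r => size r == s) ss -> (i < size ss)%N -> (j < s)%N ->
  nth x0 (flatten ss) (i * s + j) = nth x0 (nth [::] ss i) j.
Proof.
elim: ss i => //= r ss IH [|i] /andP [/eqP rs al] il jl.
  by rewrite mul0n add0n nth_cat rs jl.
rewrite nth_cat rs mulSn -addnA ltnNge leq_addr /= addKn.
exact: IH.
Qed.

Section EncodedGame.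
Variables (n : nat) (G : ssg 'I_n) (k : 'I_n).
Let w := enc_ssg G k.
Local Open Scope nat_scope.

Let record (v : 'I_n) := enc_player (owner G v) ++ [:: v == win G; v == lose G; v == k] ++
                    enc_ord (fun b => [:: b]) (edge G v).

Lemma size_record v : size (record v) = n + 5.
Proof.
rewrite !size_cat size_enc_ord /= sum1_card card_ord addnC.
by case: (owner G v) => /=; lia.
Qed.

Lemma size_enc_ssg : size w = n.+1 + n * (n + 5).
Proof.
rewrite /w /enc_ssg size_cat size_enc_ord /enc_unary size_rcons size_nseq.
congr (_ + _); rewrite (eq_bigr (fun=> n + 5)) => [|v _]; last exact: size_record.
by rewrite sum_nat_const card_ord.
Qed.

Lemma flagE j (v : 'I_n) : j < n + 5 -> flag n w j v = nth false (record v) j.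
Proof.
move=> jl; rewrite /flag /w /enc_ssg nth_cat /enc_unary size_rcons size_nseq.
rewrite -addnA ltnNge leq_addr /= addKn /enc_ord nth_flatten_uniform //.
- by rewrite (nth_map v) ?size_enum_ord // nth_ord_enum.
- by apply/allP => r /mapP [u _ ->]; rewrite -/(record u) size_record.
- by rewrite size_map size_enum_ord.
Qed.

Lemma flag_out j p : n <= p -> flag n w j p = false.
Proof.
move=> np; rewrite /flag nth_default // size_enc_ssg.
by rewrite -addnA leq_add2l (leq_trans _ (leq_addr _ _)) // leq_mul2r np orbT.
Qed.

Lemma wwinE p : wwin n w p = (p == win G).
Proof.
rewrite /wwin; case: (ltnP p n) => pn; last first.
  by rewrite flag_out //; apply/esym/eqP; have := ltn_ord (win G); lia.
rewrite (@flagE _ (Ordinal pn)); last by lia.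
by rewrite /record -val_eqE; case: (owner G _).
Qed.

Lemma wloseE p : wlose n w p = (p == lose G).
Proof.
rewrite /wlose; case: (ltnP p n) => pn; last first.
  by rewrite flag_out //; apply/esym/eqP; have := ltn_ord (lose G); lia.
rewrite (@flagE _ (Ordinal pn)); last by lia.
by rewrite /record -val_eqE; case: (owner G _).
Qed.

Lemma wstateE p : wstate n w p = (p == k).
Proof.
rewrite /wstate; case: (ltnP p n) => pn; last first.
  by rewrite flag_out //; apply/esym/eqP; have := ltn_ord k; lia.
rewrite (@flagE _ (Ordinal pn)); last by lia.
by rewrite /record -val_eqE; case: (owner G _).
Qed.

Lemma wrandE (v : 'I_n) : wrand n w v = if owner G v is Rand then true else false.
Proof. by rewrite /wrand flagE /record; [case: (owner G v)|lia]. Qed.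

Lemma wnot_minE (v : 'I_n) : wnot_min n w v = if owner G v is Min then false else true.
Proof. by rewrite /wnot_min flagE /record; [case: (owner G v)|lia]. Qed.

Lemma adjE (u v : 'I_n) : adj n w u v = edge G u v.
Proof.
rewrite /adj ltn_ord flagE /record; last by rewrite addnC ltn_add2r.
rewrite catA nth_cat size_cat /=.
have -> : size (enc_player (owner G u)) + 3 = 5 by case: (owner G u).
rewrite ltnNge leq_addr /= addKn /enc_ord -[val v]addn0 -[val v]muln1.
rewrite (@nth_flatten_uniform _ _ _ 1) //=.
- by rewrite (nth_map u) ?size_enum_ord // nth_ord_enum.
- by apply/allP => r /mapP [x _ ->].
- by rewrite size_map size_enum_ord.
Qed.

Notation mid := (word_mid n w).
Notation tot := (word_tot n w).
Notation wn := (val (win G)).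
Notation ln := (val (lose G)).

Lemma wordL_gt : (6 * n + 4 < size w) && (1 < n).
Proof.
have wl := ssg_win_lose G.
have n1 : 1 < n.
  have := ltn_ord (win G); have := ltn_ord (lose G).
  by move: wl; rewrite -val_eqE /= => /eqP; lia.
by rewrite size_enc_ssg n1; nia.
Qed.

Lemma wn_ln : (wn == ln) = false.
Proof. by rewrite val_eqE (negbTE (ssg_win_lose G)). Qed.

Lemma node_edge_win q : node_edge n w wn q = (q == n).
Proof. by rewrite /node_edge wwinE eqxx. Qed.
Lemma node_edge_lose q : node_edge n w ln q = (q == mid).
Proof. by rewrite /node_edge wwinE wloseE eq_sym wn_ln eqxx. Qed.
Lemma node_edge_game (v : 'I_n) q : v != win G -> v != lose G ->
  node_edge n w v q = adj n w v q.
Proof. by move=> /negbTE nw /negbTE nl; rewrite /node_edge wwinE wloseE !val_eqE nw nl ltn_ord. Qed.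
Lemma wwin_out p : n <= p -> wwin n w p = false.
Proof. exact: flag_out. Qed.
Lemma wlose_out p : n <= p -> wlose n w p = false.
Proof. exact: flag_out. Qed.
Lemma node_out p : n <= p ->
  [/\ wwin n w p = false, wlose n w p = false & (p < n) = false].
Proof. by move=> np; rewrite wwin_out // wlose_out // ltnNge np. Qed.
Lemma node_edge_mid p q : n <= p -> p.+1 = mid -> node_edge n w p q = (q == ln).
Proof.
by move=> /node_out [e1 e2 e3] pm; rewrite /node_edge e1 e2 e3 pm eqxx wloseE.
Qed.
Lemma node_edge_tot p q : mid <= p -> p.+1 = tot -> node_edge n w p q = (q == k).
Proof.
move=> mp pt; have /andP [L0 _] := wordL_gt.
have np : n <= p by rewrite (leq_trans _ mp) // leq_addr.
have [e1 e2 e3] := node_out np.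
rewrite /node_edge e1 e2 e3 pt eqxx wstateE.
by case: eqP => // E; move: mp; rewrite -ltnS pt E ltnn.
Qed.
Lemma node_edge_chainA p q : n <= p -> p.+1 < mid ->
  node_edge n w p q = (q == p.+1) || (q == wn).
Proof.
move=> /node_out [e1 e2 e3] pm; rewrite /node_edge e1 e2 e3 wwinE.
have pt : p.+1 < tot by rewrite (leq_trans pm) // leq_addr.
by rewrite (ltn_eqF pm) (ltn_eqF pt) (ltnW pm).
Qed.
Lemma node_edge_chainB p q : mid <= p -> p.+1 < tot ->
  node_edge n w p q = (q == p.+1) || (q == ln).
Proof.
move=> mp pt; have np : n <= p by rewrite (leq_trans _ mp) // leq_addr.
have [e1 e2 e3] := node_out np.
rewrite /node_edge e1 e2 e3 wloseE.
by rewrite (ltn_eqF pt) gtn_eqF ?ltnS // ltnNge mp.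
Qed.
Lemma node_max_game (v : 'I_n) : node_max n w v =
  [&& v != win G, v != lose G & if owner G v is Max then true else false].
Proof.
rewrite /node_max wwinE wloseE !val_eqE wrandE wnot_minE.
by case: (owner G v); rewrite ?andbF ?andbT.
Qed.
Lemma node_max_out p : n <= p -> node_max n w p = false.
Proof. by move=> np; rewrite /node_max /wnot_min flag_out // andbF. Qed.
Lemma node_rand_game (v : 'I_n) : node_rand n w v = if owner G v is Rand then true else false.
Proof. by rewrite /node_rand wrandE ltn_ord /= orbF. Qed.
Lemma node_rand_out p : n <= p -> node_rand n w p = (p.+1 != mid) && (p.+1 != tot).
Proof. by move=> np; rewrite /node_rand /wrand flag_out //= ltnNge np. Qed.
Lemma wlose_kind p : wlose n w p ->
  [/\ ~~ node_max n w p, ~~ node_rand n w p & ~~ node_edge n w p p].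
Proof.
rewrite wloseE => /eqP ->; split.
- by rewrite node_max_game eqxx andbF.
- rewrite node_rand_game; have := @owner_lose _ G.
  by case: (owner G (lose G)).
- rewrite node_edge_lose neq_ltn (leq_trans (ltn_ord _)) // leq_addr.
by [].
Qed.

End EncodedGame.

(** * The semidefinite program is feasible exactly when the value is at least 1/2 *)

Section Reduction.
Variables (R : realType) (n : nat) (G : ssg 'I_n) (k : 'I_n).
Hypothesis stop : stopping R G.
Let w := enc_ssg G k.
Let N := (size w).-1.
Let M := (2 ^ N)%N.
Notation mid := (word_mid n w).
Notation tot := (word_tot n w).
Notation wn := (val (win G)).
Notation ln := (val (lose G)).
Notation ineqs := (@node_ineqs tot (node_max n w) (node_rand n w) (wlose n w)
  (node_edge n w) (wt_up n w) (wt_dn n w) R).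

Lemma size_w_gt : (6 * n + 4 < size w)%N && (1 < n)%N.
Proof. exact: wordL_gt. Qed.
Lemma midE : mid = (n + N).+1.
Proof. by rewrite /word_mid -addnS prednK //; move: size_w_gt; lia. Qed.
Lemma totE : tot = (mid + N).+1.
Proof. by rewrite /word_tot -addnS prednK //; move: size_w_gt; lia. Qed.

Variant node_spec : nat -> Type :=
| NodeWin : node_spec wn
| NodeLose : node_spec ln
| NodeGame (v : 'I_n) of v != win G & v != lose G : node_spec v
| NodeA i of (i < N)%N : node_spec (n + i)
| NodeMid : node_spec (n + N)
| NodeB i of (i < N)%N : node_spec (mid + i)
| NodeTot : node_spec (mid + N).

Lemma nodeP p : (p < tot)%N -> node_spec p.
Proof.
have mE := midE; have tE := totE => pt.
case: (ltnP p n) => pn.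
  pose v := Ordinal pn; rewrite -[p]/(val v).
  case: (eqVneq v (win G)) => [->|nw]; first exact: NodeWin.
  by case: (eqVneq v (lose G)) => [->|nl]; [exact: NodeLose|exact: NodeGame].
case: (ltnP p mid) => pm.
  rewrite -(subnKC pn); case: (ltnP (p - n) N) => h; first exact: NodeA.
  by rewrite (_ : p - n = N)%N; [exact: NodeMid|lia].
rewrite -(subnKC pm); case: (ltnP (p - mid) N) => h; first exact: NodeB.
by rewrite (_ : p - mid = N)%N; [exact: NodeTot|lia].
Qed.

Lemma lt_tot p : (p <= mid + N)%N -> (p < tot)%N.
Proof. by rewrite totE ltnS. Qed.
Lemma ord_lt_tot (v : 'I_n) : (v < tot)%N.
Proof. by rewrite lt_tot // midE; have := ltn_ord v; lia. Qed.

Lemma edgeA i q : (i < N)%N -> node_edge n w (n + i) q = (q == (n + i).+1) || (q == wn).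
Proof. by move=> iN; rewrite node_edge_chainA ?leq_addr // midE; lia. Qed.
Lemma edgeMid q : node_edge n w (n + N) q = (q == ln).
Proof. by rewrite node_edge_mid ?leq_addr // midE. Qed.
Lemma edgeB i q : (i < N)%N -> node_edge n w (mid + i) q = (q == (mid + i).+1) || (q == ln).
Proof. by move=> iN; rewrite node_edge_chainB ?leq_addr // totE; lia. Qed.
Lemma edgeTot q : node_edge n w (mid + N) q = (q == k).
Proof. by rewrite node_edge_tot ?leq_addr // totE. Qed.

Lemma kindA i : (i < N)%N -> node_max n w (n + i) = false /\ node_rand n w (n + i) = true.
Proof.
move=> iN; rewrite node_max_out ?node_rand_out ?leq_addr //; split => //.
rewrite totE midE; lia.
Qed.
Lemma kindMid : node_max n w (n + N) = false /\ node_rand n w (n + N) = false.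
Proof. by rewrite node_max_out ?node_rand_out ?leq_addr // midE eqxx. Qed.
Lemma kindB i : (i < N)%N -> node_max n w (mid + i) = false /\ node_rand n w (mid + i) = true.
Proof.
move=> iN; rewrite node_max_out ?node_rand_out ?(leq_trans _ (leq_addr _ _)) ?leq_addr //;
  try by rewrite midE; lia.
by split => //; rewrite totE midE; lia.
Qed.
Lemma kindTot : node_max n w (mid + N) = false /\ node_rand n w (mid + N) = false.
Proof.
by rewrite node_max_out ?node_rand_out ?totE ?eqxx ?andbF // midE; lia.
Qed.
Lemma kind_win : node_max n w wn = false /\ node_rand n w wn = false.
Proof.
rewrite node_max_game node_rand_game eqxx; have := @owner_win _ G.
by case: (owner G (win G)).
Qed.
Lemma kind_lose : node_max n w ln = false /\ node_rand n w ln = false.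
Proof.
rewrite node_max_game node_rand_game eqxx andbF; have := @owner_lose _ G.
by case: (owner G (lose G)).
Qed.
Lemma kind_game v : v != win G -> v != lose G ->
  node_max n w v = (if owner G v is Max then true else false) /\
  node_rand n w v = (if owner G v is Rand then true else false).
Proof. by move=> nw nl; rewrite node_max_game node_rand_game nw nl. Qed.

Lemma wt_up_win : wt_up n w wn = 4%N. Proof. by rewrite /wt_up wwinE eqxx. Qed.
Lemma wt_dn_win : wt_dn n w wn = 1%N. Proof. by rewrite /wt_dn wloseE wn_ln. Qed.
Lemma wt_up_lose : wt_up n w ln = 1%N. Proof. by rewrite /wt_up wwinE eq_sym wn_ln. Qed.
Lemma wt_dn_lose : wt_dn n w ln = 2%N. Proof. by rewrite /wt_dn wloseE eqxx. Qed.
Lemma wt_game (v : 'I_n) : v != win G -> v != lose G -> wt_up n w v = 1%N /\ wt_dn n w v = 1%N.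
Proof. by move=> /negbTE nw /negbTE nl; rewrite /wt_up /wt_dn wwinE wloseE !val_eqE nw nl. Qed.
Lemma wt_out p : (n <= p)%N -> wt_up n w p = 1%N /\ wt_dn n w p = 1%N.
Proof. by move=> np; rewrite /wt_up /wt_dn wwin_out ?wlose_out. Qed.

Lemma rand_edges v : owner G v = Rand -> exists a b, [/\ a != b,
  forall u, edge G v u = (u == a) || (u == b) &
  forall z : 'I_n -> R, rand_mean G z v = (z a + z b) / 2].
Proof.
move=> /ssg_rand /eqP /cards2P [a [b [ab E]]].
have e u : edge G v u = (u == a) || (u == b).
  by move/setP: E => /(_ u); rewrite !inE.
exists a, b; split => // z; rewrite /rand_mean; congr (_ / 2).
rewrite (eq_bigl _ _ e) (bigD1 a) ?eqxx //= (bigD1 b) /=; last by rewrite eqxx orbT eq_sym ab.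
rewrite big1 ?addr0 // => u /andP [/andP [/orP [/eqP ->|/eqP ->]]]; by rewrite eqxx.
Qed.

Lemma rand_two p : (p < tot)%N -> ~~ node_max n w p -> node_rand n w p ->
  exists q1 q2, [/\ (q1 < tot)%N, (q2 < tot)%N, q1 != q2 &
    forall q, (q < tot)%N -> node_edge n w p q = (q == q1) || (q == q2)].
Proof.
move=> pt _; case: (nodeP pt).
- by case: kind_win => _ ->.
- by case: kind_lose => _ ->.
- move=> v nw nl; have [_ ->] := kind_game nw nl; case E: (owner G v) => // _.
  have [a [b [ab e _]]] := rand_edges E.
  exists (val a), (val b); rewrite !ord_lt_tot; split => // q _.
  rewrite node_edge_game //; case: (ltnP q n) => qn.
    by rewrite (adjE G k v (Ordinal qn)) e.
  rewrite /adj ltnNge qn /=; apply/esym/negbTE; rewrite negb_or.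
  by have := ltn_ord a; have := ltn_ord b; lia.
- move=> i iN _; exists (n + i).+1, wn; split; [| |  |by move=> q _; rewrite edgeA].
  + by rewrite totE midE; lia.
  + exact: ord_lt_tot.
  + by have := ltn_ord (win G); rewrite /=; lia.
- by case: kindMid => _ ->.
- move=> i iN _; exists (mid + i).+1, ln; split; [| |  |by move=> q _; rewrite edgeB].
  + by rewrite totE midE; lia.
  + exact: ord_lt_tot.
  + by have := ltn_ord (lose G); rewrite midE /=; lia.
- by case: kindTot => _ ->.
Qed.

(** Both chains of nodes are used through this lemma: consecutive ratios at
    least square, so after m steps the initial ratio is raised to the power
    2 ^ m. *)
Lemma squaring_chain (r : nat -> R) (c : R) m : 0 < c -> c <= r 0 ->
  (forall i, (i < m)%N -> r i ^+ 2 <= r i.+1) -> c ^+ (2 ^ m) <= r m.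
Proof.
move=> c0 cr H; elim: m H => [|m IH] H; first by rewrite expr1.
apply: le_trans (H m (ltnSn m)); rewrite expnSr exprM lerXn2r ?nnegrE //.
- exact/exprn_ge0/ltW.
- apply: le_trans (IH _); first exact/exprn_ge0/ltW.
  by move=> i im; apply: H; exact: ltnW.
- by apply: IH => i im; apply: H; exact: ltnW.
Qed.

Section Complete.
Variable chi : 'I_n -> R.
Hypotheses (chiB : bellman G chi) (chik : 2^-1 <= chi k).

(** On the vertices this is 4 ^ M to the power of the value; on the two chains it
    makes every inequality but the last one of the second chain an equality. *)
Definition power_point (p : nat) : R :=
  if insub p is Some v then 2 `^ ((2 * M)%:R * chi v)
  else if (p < mid)%N then 4 ^+ (M - 2 ^ (p - n)) else 2 ^+ (2 ^ (p - mid)).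

Lemma power_game (v : 'I_n) : power_point v = 2 `^ ((2 * M)%:R * chi v).
Proof. by rewrite /power_point valK. Qed.
Lemma power_win : power_point wn = 4 ^+ M.
Proof.
have [cw _ _] := chiB.
by rewrite power_game cw mulr1 powR_mulrn // exprM -natrX.
Qed.
Lemma power_lose : power_point ln = 1.
Proof. by have [_ cl _] := chiB; rewrite power_game cl mulr0 powRr0. Qed.
Lemma power_A i : (i <= N)%N -> power_point (n + i) = 4 ^+ (M - 2 ^ i).
Proof.
move=> iN; rewrite /power_point insubF; last by rewrite ltnNge leq_addr.
by rewrite midE ltnS leq_add2l iN addKn.
Qed.
Lemma power_B i : power_point (mid + i) = 2 ^+ (2 ^ i).
Proof.
rewrite /power_point insubF; last by rewrite midE; apply/negbTE; lia.
by rewrite ltnNge leq_addr /= addKn.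
Qed.
Lemma power_gt0 p : 0 < power_point p.
Proof.
rewrite /power_point; case: insub => [v|]; first exact: powR_gt0.
by case: ifP => _; rewrite exprn_gt0.
Qed.
Lemma power_le u v : chi u <= chi v -> power_point u <= power_point v.
Proof.
move=> uv; rewrite !power_game; apply: ler_powR; first by rewrite ler1n.
by rewrite ler_wpM2l.
Qed.

Lemma power_ineqs : ineqs power_point.
Proof.
have [_ _ B] := chiB.
split.
- move=> p pt; case: (nodeP pt).
  + by case: kind_win => ->.
  + by case: kind_lose => ->.
  + move=> v nw nl; have [-> _] := kind_game nw nl; case E: (owner G v) => // _.
    have := B v; rewrite E => -[_ [u e uv]].
    rewrite (bigD1 (Ordinal (ord_lt_tot u))) /=; last by rewrite node_edge_game // adjE.
    apply: le_trans (power_le uv) _; rewrite lerDl.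
    by apply: sumr_ge0 => q _; apply/ltW/power_gt0.
  + by move=> i iN; case: (kindA iN) => ->.
  + by case: kindMid => ->.
  + by move=> i iN; case: (kindB iN) => ->.
  + by case: kindTot => ->.
- by move=> p q _ _ _ _ _; apply/ltW/power_gt0.
- move=> p q q' pt qt qt' _.
  have two a b q1 q2 (x : R) : q1 != q2 -> (q1 == a) || (q1 == b) -> (q2 == a) || (q2 == b) ->
      x <= power_point a * power_point b -> x <= power_point q1 * power_point q2.
    move=> n12 /orP [/eqP e1|/eqP e1] /orP [/eqP e2|/eqP e2] //.
    * by rewrite e1 e2 eqxx in n12.
    * by rewrite e1 e2.
    * by rewrite e1 e2 mulrC.
    * by rewrite e1 e2 eqxx in n12.
  case: (nodeP pt).
  + by case: kind_win => _ ->.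
  + by case: kind_lose => _ ->.
  + move=> v nw nl; have [_ ->] := kind_game nw nl; case E: (owner G v) => // _.
    have := B v; rewrite E; have [a [b [ab e ->]]] := rand_edges E => cv.
    rewrite !node_edge_game // => /andP [qn a1] /andP [qn' a2] qq'.
    apply: (@two a b) => //.
    * by have := adjE G k v (Ordinal qn); rewrite /adj qn a1 e => /esym.
    * by have := adjE G k v (Ordinal qn'); rewrite /adj qn' a2 e => /esym.
    rewrite !power_game -powR_mulrn ?powR_ge0 // -powRrM -powRD; last by rewrite pnatr_eq0 implybT.
    by rewrite cv le_eqVlt; apply/orP; left; apply/eqP; congr (_ `^ _); field.
  + move=> i iN _; rewrite !edgeA // => e1 e2 qq'; apply: two qq' e1 e2 _.
    rewrite -addnS power_win !power_A ?(ltnW iN) // -exprM -exprD.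
    have h : (2 ^ i.+1 <= M)%N by rewrite leq_exp2l.
    rewrite expnS in h *.
    by rewrite (_ : (M - 2 ^ i) * 2 = M - 2 * 2 ^ i + M)%N //; lia.
  + by case: kindMid => _ ->.
  + move=> i iN _; rewrite !edgeB // => e1 e2 qq'; apply: two qq' e1 e2 _.
    by rewrite -addnS power_lose mulr1 !power_B -exprM -expnSr.
  + by case: kindTot => _ ->.
- move=> p q pt qt; case: (nodeP pt).
  + rewrite node_edge_win => _ _ /eqP ->; rewrite wt_up_win wt_dn_win power_win.
    rewrite -[X in power_point X]addn0 power_A // subn1 mulr1n -[leRHS]mulr_natl -exprS prednK //.
    by rewrite expn_gt0.
  + rewrite node_edge_lose => _ _ /eqP ->; rewrite wt_up_lose wt_dn_lose power_lose.
    by rewrite -[X in power_point X]addn0 power_B.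
  + move=> v nw nl; have [-> ->] := kind_game nw nl; have [-> ->] := wt_game nw nl.
    rewrite node_edge_game // !mulr1n => nm nr /andP [qn a1].
    have e : edge G v (Ordinal qn) by rewrite -(adjE G k) /adj qn.
    have := B v; case: (owner G v) nm nr => // _ _ [h _]; exact: (power_le (h _ e)).
  + by move=> i iN; case: (kindA iN) => _ ->.
  + move=> _ _; rewrite edgeMid => /eqP ->; have [-> ->] := wt_out (leq_addr N n).
    by rewrite power_A // subnn power_lose.
  + by move=> i iN; case: (kindB iN) => _ ->.
  + move=> _ _; rewrite edgeTot => /eqP ->.
    have [-> ->] : wt_up n w (mid + N) = 1%N /\ wt_dn n w (mid + N) = 1%N.
      by apply: wt_out; rewrite midE; lia.
    rewrite power_B power_game -powR_mulrn // !mulr1n; apply: ler_powR; first by rewrite ler1n.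
    by rewrite natrM -/M; have := ler_wpM2l (ler0n R M) chik; lra.
- by move=> p _; rewrite wloseE => /eqP ->; rewrite power_lose.
Qed.

Lemma value_feasible : sdp_feasible R (word_sdp n w).
Proof.
apply: (node_ineqs_feasible _ rand_two power_ineqs).
exact: wlose_kind.
Qed.
End Complete.

Section Sound.
Variables (x : nat -> R) (chi : 'I_n -> R).
Hypotheses (xI : ineqs x) (chiB : bellman G chi).

Let xl := x ln.
Let xl_ge1 : 1 <= xl.
Proof. by case: xI => _ _ _ _; apply; rewrite ?ord_lt_tot // wloseE. Qed.
Let xl_gt0 : 0 < xl.
Proof. exact: lt_le_trans xl_ge1. Qed.

(** Along the first chain the ratios to x_win are at least 1/4 at the start and
    at most x_lose / x_win at the end. *)
Lemma win_le : x wn <= 4 ^+ M * xl.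
Proof.
have [_ _ crand cmin _] := xI.
case: (leP (x wn) xl) => [h|h].
  by apply: le_trans h _; rewrite ler_peMl ?(ltW xl_gt0) // exprn_ege1 // ler1n.
have w0 : 0 < x wn by apply: lt_trans h.
pose r i := x (n + i)%N / x wn.
have r0 : 4^-1 <= r 0.
  have := cmin wn n (ord_lt_tot _); case: kind_win => -> ->.
  rewrite node_edge_win eqxx wt_up_win wt_dn_win mulr1n => H.
  rewrite /r addn0 ler_pdivlMr // mulrC ler_pdivrMr // mulr_natr.
  by apply: H => //; apply: lt_tot; rewrite midE; lia.
have : (4^-1) ^+ M <= r N.
  apply: squaring_chain => // i iN.
  have [k1 k2] := kindA iN.
  have := crand (n + i)%N (n + i).+1 wn; rewrite k1 k2 !edgeA // !eqxx orbT => H.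
  rewrite /r addnS expr_div_n ler_pdivrMr ?exprn_gt0 //.
  have -> : forall a, a / x wn * x wn ^+ 2 = a * x wn by move=> a; field; rewrite gt_eqF.
  apply: H => //.
  - by apply: lt_tot; rewrite midE; lia.
  - by apply: lt_tot; rewrite midE; lia.
  - exact: ord_lt_tot.
  - by have := ltn_ord (win G); rewrite /=; lia.
have e : x (n + N)%N <= xl.
  have [k1 k2] := kindMid; have := cmin (n + N)%N ln.
  rewrite k1 k2 edgeMid eqxx; have [-> ->] := wt_out (leq_addr N n).
  by rewrite !mulr1n; apply => //; [apply: lt_tot; rewrite midE; lia|exact: ord_lt_tot].
rewrite /r exprVn ler_pdivlMr // mulrC ler_pdivrMr ?exprn_gt0 // => /le_trans; apply.
by rewrite mulrC ler_pM2l ?exprn_gt0.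
Qed.

(** Along the second chain the ratios to x_lose are at least 2 at the start and
    at most x_k / x_lose at the end. *)
Lemma state_ge : 2 ^+ M * xl <= x k.
Proof.
have [_ _ crand cmin _] := xI.
pose r i := x (mid + i)%N / xl.
have r0 : 2 <= r 0.
  have [k1 k2] := kind_lose; have := cmin ln mid.
  rewrite k1 k2 node_edge_lose eqxx wt_up_lose wt_dn_lose mulr1n => H.
  rewrite /r addn0 ler_pdivlMr // mulr_natl; apply: H => //; first exact: ord_lt_tot.
  by apply: lt_tot; rewrite leq_addr.
have : 2 ^+ M <= r N.
  apply: squaring_chain => // i iN.
  have [k1 k2] := kindB iN.
  have := crand (mid + i)%N (mid + i).+1 ln; rewrite k1 k2 !edgeB // !eqxx orbT => H.
  rewrite /r addnS expr_div_n ler_pdivrMr ?exprn_gt0 //.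
  have -> : forall a, a / xl * xl ^+ 2 = a * xl by move=> a; field; rewrite gt_eqF.
  apply: H => //.
  - by apply: lt_tot; lia.
  - by apply: lt_tot; lia.
  - exact: ord_lt_tot.
  - by have := ltn_ord (lose G); rewrite midE /=; lia.
rewrite /r ler_pdivlMr // => /le_trans; apply.
have [k1 k2] := kindTot; have := cmin (mid + N)%N k.
rewrite k1 k2 edgeTot eqxx.
have [-> ->] : wt_up n w (mid + N) = 1%N /\ wt_dn n w (mid + N) = 1%N.
  by apply: wt_out; rewrite midE; lia.
by rewrite !mulr1n; apply => //; [exact: lt_tot|exact: ord_lt_tot].
Qed.

(* A solution may have entries that are tiny or negative.  Raising them to x_lose
   preserves the inequalities of the game and makes all logarithms nonnegative. *)
Let y (v : 'I_n) : R := Order.max (x v) xl / xl.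
Let z (v : 'I_n) : R := exp.ln (y v).

Let y_ge1 v : 1 <= y v.
Proof. by rewrite /y ler_pdivlMr // mul1r le_max lexx orbT. Qed.
Let y_gt0 v : 0 < y v.
Proof. exact: lt_le_trans (y_ge1 v). Qed.
Let le_y (a : R) (v : 'I_n) : 0 <= a -> x v <= a * xl -> 1 <= a -> y v <= a.
Proof.
by move=> a0 h a1; rewrite /y ler_pdivrMr // ge_max h /= ler_peMl // ltW.
Qed.
Let x_le_y (v : 'I_n) : x v <= y v * xl.
Proof. by rewrite /y divfK ?gt_eqF // le_max lexx. Qed.

(** Logarithms turn the inequalities into those of a subsolution whose only
    errors, at the Max vertices, come from bounding a sum of at most n terms by n
    times the largest. *)
Lemma log_value (v : 'I_n) : z v <= (2 * M)%:R * exp.ln 2 * chi v +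
   exp.ln n%:R * ((n * 4 ^ n)%:R *+ 2).
Proof.
have /andP [_ n1] := size_w_gt.
have [cmax crand1 crand2 cmin _] := xI.
have ln2 : 0 <= exp.ln 2 :> R by apply: ln_ge0; rewrite ler1n.
move: v; apply: (approx_value stop chiB).
- by apply: ln_ge0; rewrite ler1n ltnW.
- by rewrite mulr_ge0.
- by rewrite /z /y maxxx divff ?ln1 // gt_eqF.
- have -> : (2 * M)%:R * exp.ln 2 = exp.ln (4 ^+ M) :> R.
    have -> : 4 ^+ M = 2 ^+ (2 * M) :> R by rewrite exprM -[2 ^+ 2]natrX.
    by rewrite lnXn // mulr_natl.
  rewrite ler_ln ?posrE ?exprn_gt0 //.
  by apply: le_y; [exact: exprn_ge0|exact: win_le|rewrite exprn_ege1 // ler1n].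
- move=> v u nw nl E e; rewrite ler_ln ?posrE //.
  apply: le_y (y_ge1 _) => //; first exact: ltW.
  apply: le_trans (x_le_y u).
  have := cmin v u; have [-> ->] := kind_game nw nl; rewrite E.
  have [-> ->] := wt_game nw nl; rewrite !mulr1n node_edge_game // adjE e.
  by apply; rewrite ?ord_lt_tot.
- move=> v nw nl E; have [u0 e0] := ssg_out G v.
  have [u eu mu] := @arg_maxP _ _ 'I_n u0 (edge G v) y e0.
  exists u => //; rewrite -lnM ?posrE ?ltr0n ?(ltnW n1) //.
  have yn : 1 <= y u * n%:R.
    apply: mulr_ege1; [exact: y_ge1|]. rewrite ler1n. exact: ltnW.
  rewrite ler_ln ?posrE; [|exact: y_gt0|exact: lt_le_trans yn].
  apply: le_y yn => //; first by rewrite mulr_ge0 // ltW.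
  have := cmax v; have [-> _] := kind_game nw nl; rewrite E => /(_ (ord_lt_tot _) isT).
  move=> /le_trans; apply.
  apply: (@le_trans _ _ (\sum_(q < n) y u * xl)); last first.
    by rewrite sumr_const card_ord -[leLHS]mulr_natr mulrAC.
  pose F q : R := if node_edge n w v q then x q else 0.
  rewrite big_mkcond /= -/(\sum_(q < tot) F q) -(big_mkord predT F).
  rewrite (@big_cat_nat _ _ _ n) //=; last by rewrite totE midE; lia.
  rewrite [X in _ + X]big_nat_cond [X in _ + X]big1 ?addr0; last first.
    move=> q /andP [/andP [nq _] _]; rewrite /F node_edge_game // /adj.
    by rewrite ltnNge nq.
  rewrite big_mkord; apply: ler_sum => q _.
  rewrite /F node_edge_game // adjE; case: ifP => e.
    by apply: le_trans (x_le_y q) _; rewrite ler_pM2r //; exact: mu.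
  by apply: mulr_ge0; apply/ltW; [exact: y_gt0|exact: xl_gt0].
- move=> v nw nl E; have [a [b [ab e ->]]] := rand_edges E.
  have ea : edge G v a by rewrite e eqxx.
  have eb : edge G v b by rewrite e eqxx orbT.
  have yy : y v ^+ 2 <= y a * y b.
    have [h|h] := leP (x v) xl.
      have -> : y v = 1 by rewrite /y max_r // divff // gt_eqF.
      by rewrite expr1n; exact: mulr_ege1 (y_ge1 a) (y_ge1 b).
    have -> : y v = x v / xl by rewrite /y max_l // ltW.
    rewrite expr_div_n ler_pdivrMr ?exprn_gt0 //.
    have k1 := kind_game nw nl; rewrite E in k1; case: k1 => k1 k2.
    have L := ord_lt_tot.
    have xa : 0 <= x a by apply: (crand1 v) => //; rewrite ?k1 ?k2 // node_edge_game // adjE.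
    have xb : 0 <= x b by apply: (crand1 v) => //; rewrite ?k1 ?k2 // node_edge_game // adjE.
    apply: le_trans (_ : x a * x b <= _).
      by apply: crand2; rewrite ?k1 ?k2 ?node_edge_game ?adjE.
    have -> : y a * y b * xl ^+ 2 = (y a * xl) * (y b * xl) by ring.
    by apply: ler_pM => //; exact: x_le_y.
  rewrite ler_pdivlMr // mulr_natr -lnXn // -lnM ?posrE //.
  by rewrite ler_ln ?posrE // ?exprn_gt0 // mulr_gt0 // y_gt0.
Qed.

(** By the gap, a value below 1/2 would make 2 M ln 2 chi k fall short of M ln 2 by
    more than the accumulated errors of log_value, because M = 2 ^ N exceeds
    2 n ^ 2 16 ^ n. *)
Lemma value_ge_half : 2^-1 <= chi k.
Proof.
case: (leP 2^-1 (chi k)) => // lt.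
have gap := value_gap stop chiB lt.
have /andP [nL n1] := size_w_gt.
have ln2 : 0 < exp.ln 2 :> R by apply: ln_gt0; rewrite ltr1n.
have zk : M%:R * exp.ln 2 <= z k.
  rewrite mulr_natl -lnXn // ler_ln ?posrE ?exprn_gt0 //.
  rewrite /y ler_pdivlMr // le_max; apply/orP; left; exact: state_ge.
have := le_trans zk (log_value k).
have lnn : exp.ln n%:R <= n%:R * exp.ln 2 :> R.
  rewrite mulr_natl -lnXn // ler_ln ?posrE ?exprn_gt0 ?ltr0n ?(ltnW n1) //.
  by rewrite -natrX ler_nat ltnW // ltn_expl.
set l2 := exp.ln 2 in ln2 lnn zk *; set lnn' := exp.ln n%:R in lnn *.
set D : R := (4 ^ n)%:R in gap *.
have D0 : 0 < D by rewrite ltr0n expn_gt0.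
have big : (2 * n * n * 4 ^ n * 4 ^ n)%:R < M%:R :> R.
  rewrite ltr_nat.
  have n4 : (n * n < 4 ^ n)%N.
    by rewrite -[4%N]/(2 * 2)%N expnMn ltn_mul // ltn_expl.
  apply: (@leq_trans (2 * 4 ^ n * 4 ^ n * 4 ^ n)).
    by rewrite !ltn_pmul2r ?expn_gt0 // -mulnA ltn_pmul2l.
  have -> : (4 ^ n = 2 ^ (2 * n))%N by rewrite expnM.
  rewrite -!mulnA -!expnD -expnS leq_exp2l //.
  by rewrite /N; lia.
move: big; rewrite !natrM -/D => big H.
have p : 0 <= 1 - 2 * chi k by lra.
have H1 : M%:R * l2 * (1 - 2 * chi k) <= n%:R * l2 * (n%:R * D *+ 2).
  apply: le_trans (_ : lnn' * (n%:R * D *+ 2) <= _); last first.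
    by rewrite ler_wpM2r // mulrn_wge0 // mulr_ge0 // ltW.
  by move: H; lra.
have H2 : M%:R * l2 <= D * (n%:R * l2 * (n%:R * D *+ 2)).
  apply: le_trans (_ : D * (M%:R * l2 * (1 - 2 * chi k)) <= _); last by rewrite ler_pM2l.
  by rewrite mulrCA ler_peMr // mulr_ge0 // ltW.
have : M%:R * l2 <= (2 * n%:R * n%:R * D * D) * l2.
  by apply: le_trans H2 _; rewrite le_eqVlt; apply/orP; left; apply/eqP; ring.
by rewrite ler_pM2r // leNgt big.
Qed.

End Sound.

Theorem word_sdp_correct :
  (exists chi, is_value G chi /\ (2^-1 : R) <= chi k) <-> sdp_feasible R (word_sdp n w).
Proof.
have [chi chiB] := bellman_ex R G; split=> [[chi' [val' half]]|feas].
  apply: (value_feasible chiB).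
  by rewrite -(is_value_uniq stop chiB val').
have [x xI] := feasible_node_ineqs (@wlose_kind _ _ _) feas.
exists chi; split; first exact: bellman_is_value.
exact: value_ge_half xI chiB.
Qed.

End Reduction.

(** * Counter machines *)

Local Open Scope nat_scope.

Definition upd (A : eqType) (B : Type) (f : A -> B) (x : A) (y : B) : A -> B :=
  fun z => if z == x then y else f z.

Section CounterMachines.
Variables (Reg : finType) (pos : Reg).

Definition env := Reg -> nat.
Definition store : Type := env * bitseq.

Inductive action := Nop | Inc of Reg | Dec of Reg | Out of bool.

(** A machine sees of its registers only whether they are zero, and of the input
    word only the bit at the position held by the register pos.  It exits by
    moving to no state, which leaves the continuation open for composition. *)
Record machine := Machine {
  mstate : finType;
  mstart : mstate;
  mtrans : mstate -> (Reg -> bool) -> option bool -> option mstate * action }.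

(** The output is kept in reverse order. *)
Definition act (a : action) (s : store) : store :=
  match a with
  | Nop => s
  | Inc r => (upd s.1 r (s.1 r).+1, s.2)
  | Dec r => (upd s.1 r (s.1 r).-1, s.2)
  | Out b => (s.1, b :: s.2)
  end.

Variable w : bitseq.

Definition zeros (e : env) : Reg -> bool := fun r => e r == 0.
Definition scan (e : env) : option bool := onth w (e pos).

Section Exits.
Variable M : machine.

Definition mstep (q : mstate M) (s : store) : option (mstate M) * store :=
  let: (q', a) := mtrans q (zeros s.1) (scan s.1) in (q', act a s).

Inductive exits : mstate M -> store -> store -> nat -> Prop :=
| ExitNow q s s' : mstep q s = (None, s') -> exits q s s' 1
| ExitLater q s q1 s1 s' t :
    mstep q s = (Some q1, s1) -> exits q1 s1 s' t -> exits q s s' t.+1.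

Definition runs_in (s s' : store) (T : nat) : Prop :=
  exists2 t, t <= T & exits (mstart M) s s' t.

Lemma runs_leq s s' T T' : T <= T' -> runs_in s s' T -> runs_in s s' T'.
Proof. by move=> le [t tT e]; exists t => //; apply: leq_trans le. Qed.

Lemma exits_size q s s' t : exits q s s' t -> size s'.2 <= size s.2 + t.
Proof.
have H a x : size (act a x).2 <= (size x.2).+1 by case: a => //=.
elim=> {q s s' t} [q s s'|q s q1 s1 s' t]; rewrite /mstep; case: mtrans => q' a [_ <-].
  by rewrite addn1.
by move=> _ /leq_trans; apply; rewrite addnS -addSn leq_add2r.
Qed.

End Exits.

Definition mact (a : action) : machine :=
  @Machine unit tt (fun _ _ _ => (None, a)).

Lemma runs_act a s : runs_in (mact a) s (act a s) 1.
Proof. by exists 1 => //; apply: ExitNow. Qed.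

Definition mseq (M1 M2 : machine) : machine :=
  @Machine (mstate M1 + mstate M2)%type (inl (mstart M1))
    (fun q z b => match q with
     | inl q1 => let: (q', a) := mtrans q1 z b in
         (Some (if q' is Some q1' then inl q1' else inr (mstart M2)), a)
     | inr q2 => let: (q', a) := mtrans q2 z b in (omap inr q', a)
     end).

Lemma exits_seq2 M1 M2 q s s' t :
  exits (M := M2) q s s' t -> exits (M := mseq M1 M2) (inr q) s s' t.
Proof.
elim=> {q s s' t} [q s s'|q s q1 s1 s' t]; rewrite /mstep => E.
  by apply: ExitNow; move: E; rewrite /mstep /=; case: mtrans => q' a /= [-> ->].
move=> _ IH; apply: (ExitLater _ IH).
by move: E; rewrite /mstep /=; case: mtrans => q' a /= [-> ->].
Qed.

Lemma runs_seq M1 M2 s s1 s2 T1 T2 :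
  runs_in M1 s s1 T1 -> runs_in M2 s1 s2 T2 -> runs_in (mseq M1 M2) s s2 (T1 + T2).
Proof.
move=> [t1 tT1 e1] [t2 tT2 e2]; exists (t1 + t2); first exact: leq_add.
rewrite /=; elim: e1 e2 => {s s1 t1 tT1} [q s s'|q s q1 s1 s' t]; rewrite /mstep => E.
  move=> /(@exits_seq2 M1) e2; apply: (ExitLater _ e2).
  by move: E; rewrite /mstep /=; case: mtrans => q' a /= [-> ->].
move=> _ IH /IH e2; apply: (ExitLater _ e2).
by move: E; rewrite /mstep /=; case: mtrans => q' a /= [-> ->].
Qed.

Definition test := (Reg -> bool) -> option bool -> bool.

Definition mif (c : test) (M1 M2 : machine) : machine :=
  @Machine (option (mstate M1 + mstate M2))%type None
    (fun q z b => match q with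
     | None => (Some (Some (if c z b then inl (mstart M1) else inr (mstart M2))), Nop)
     | Some (inl q1) => let: (q', a) := mtrans q1 z b in (omap (Some \o inl) q', a)
     | Some (inr q2) => let: (q', a) := mtrans q2 z b in (omap (Some \o inr) q', a)
     end).

Lemma runs_if c M1 M2 s s' T :
  runs_in (if c (zeros s.1) (scan s.1) then M1 else M2) s s' T ->
  runs_in (mif c M1 M2) s s' T.+1.
Proof.
move=> [t tT e]; exists t.+1 => //.
case E: (c (zeros s.1) (scan s.1)) e => e.
  apply: (@ExitLater (mif c M1 M2) _ _ (Some (inl (mstart M1))) s); first by rewrite /mstep /= E.
  elim: e => {s s' t tT E} [q s s'|q s q1 s1 s' t]; rewrite /mstep => E.
    by apply: ExitNow; move: E; rewrite /mstep /=; case: mtrans => q' a /= [-> ->].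
  move=> _ IH; apply: (ExitLater _ IH).
  by move: E; rewrite /mstep /=; case: mtrans => q' a /= [-> ->].
apply: (@ExitLater (mif c M1 M2) _ _ (Some (inr (mstart M2))) s); first by rewrite /mstep /= E.
elim: e => {s s' t tT E} [q s s'|q s q1 s1 s' t]; rewrite /mstep => E.
  by apply: ExitNow; move: E; rewrite /mstep /=; case: mtrans => q' a /= [-> ->].
move=> _ IH; apply: (ExitLater _ IH).
by move: E; rewrite /mstep /=; case: mtrans => q' a /= [-> ->].
Qed.

Definition mwhile (c : test) (M : machine) : machine :=
  @Machine (option (mstate M)) None
    (fun q z b => match q with
     | None => (if c z b then Some (Some (mstart M)) else None, Nop)
     | Some q1 => let: (q', a) := mtrans q1 z b in (Some q', a)
     end).

Lemma runs_while_exit c M s : ~~ c (zeros s.1) (scan s.1) -> runs_in (mwhile c M) s s 1.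
Proof.
by move=> /negbTE nc; exists 1 => //; apply: ExitNow; rewrite /mstep /= nc.
Qed.

Lemma runs_while_step (c : test) M s s1 s2 T1 T2 : c (zeros s.1) (scan s.1) ->
  runs_in M s s1 T1 -> runs_in (mwhile c M) s1 s2 T2 -> runs_in (mwhile c M) s s2 (T1 + T2).+1.
Proof.
move=> cs [t1 tT1 e1] [t2 tT2 e2]; exists (t1 + t2).+1; first by rewrite ltnS leq_add.
apply: (@ExitLater (mwhile c M) _ _ (Some (mstart M)) s); first by rewrite /mstep /= cs.
elim: e1 e2 => {s s1 t1 tT1 cs} [q s s'|q s q1 s1 s' t]; rewrite /mstep => E.
  move=> e2; apply: (ExitLater _ e2).
  by move: E; rewrite /mstep /=; case: mtrans => q' a /= [-> ->].
move=> _ IH /IH e2; apply: (ExitLater _ e2).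
by move: E; rewrite /mstep /=; case: mtrans => q' a /= [-> ->].
Qed.

(** The states S i after i rounds play the role of the loop invariant. *)
Lemma runs_while (c : test) M (S : nat -> store) m T :
  (forall i, i < m -> c (zeros (S i).1) (scan (S i).1)) ->
  (forall i, i < m -> runs_in M (S i) (S i.+1) T) ->
  ~~ c (zeros (S m).1) (scan (S m).1) ->
  runs_in (mwhile c M) (S 0) (S m) (m * T.+1).+1.
Proof.
elim: m S => [|m IH] S cS rS nc; first exact: runs_while_exit.
rewrite mulSn addSn -addnS; apply: runs_while_step (cS 0 isT) (rS 0 isT) _.
by apply: (IH (fun i => S i.+1)) => // i im; [apply: cS|apply: rS].
Qed.

End CounterMachines.

(** * Simulation of counter machines by Turing machines *)

Section Tapes.
Variable sym : Type.
Implicit Types (t : tape (option sym)) (c : nat -> option sym) (p : nat).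

(** The lists of a tape do not determine how many blanks they end with, so the
    contents are described by a function c on cells and the head position p.
    The cells to the left of cell 0 are left unspecified. *)
Definition holds_at t c p : Prop :=
  (forall i, nth None (rtape t) i = c (p + i)) /\
  (forall i, i < p -> nth None (ltape t) i = c (p.-1 - i)).

Lemma holds_at_read t c p : holds_at t c p -> tape_read None t = c p.
Proof. by move=> [r _]; rewrite /tape_read -nth0 r addn0. Qed.

Lemma holds_at_ext t c c' p : c =1 c' -> holds_at t c p -> holds_at t c' p.
Proof. by move=> cc [r l]; split=> i *; rewrite -cc; auto. Qed.

Lemma holds_at_stay t c p a : holds_at t c p ->
  holds_at (tape_act None t (a, Stay)) (upd c p a) p.
Proof.
case: t => l r [/= hr hl]; split=> [[|i]|i ip] /=.
- by rewrite addn0 /upd eqxx.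
- by rewrite nth_behead hr /upd; case: eqP => //; lia.
- by rewrite hl // /upd; case: eqP => //; lia.
Qed.

Lemma holds_at_right t c p a : holds_at t c p ->
  holds_at (tape_act None t (a, Right)) (upd c p a) p.+1.
Proof.
case: t => l r [/= hr hl]; split=> [i|[|i] ip] /=.
- by rewrite nth_behead hr /upd addSnnS; case: eqP => //; lia.
- by rewrite subn0 /upd eqxx.
- rewrite hl // /upd; case: eqP => [|_]; first by lia.
  by congr c; lia.
Qed.

Lemma holds_at_left t c p a : holds_at t c p.+1 ->
  holds_at (tape_act None t (a, Left)) (upd c p.+1 a) p.
Proof.
case: t => l r [/= hr hl]; split=> [[|[|i]]|i ip] /=.
- rewrite -nth0 hl // subn0 addn0 /upd; case: eqP => //; lia.
- by rewrite addn1 /upd eqxx.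
- by rewrite nth_behead hr /upd; case: eqP => [|_]; [lia|congr c; lia].
- by rewrite nth_behead hl // /upd; case: eqP => [|_]; [lia|congr c; lia].
Qed.

Lemma upd_id c p : upd c p (c p) =1 c.
Proof. by move=> i; rewrite /upd; case: eqP => [->|]. Qed.

End Tapes.

Section Simulation.
Variables (Reg : finType) (pos : Reg) (M : machine Reg).

Definition sym := (bool + unit)%type.
Definition mark : option sym := Some (inr tt).
Definition bit (b : bool) : option sym := Some (inl b).

Variant tape_role := InputTape | OutputTape | CounterTape of Reg.

Definition role (i : 'I_(#|Reg|.+2)) : tape_role :=
  if unlift ord0 i is Some j then
    if unlift ord_max j is Some l then CounterTape (enum_val l) else OutputTape
  else InputTape.

Definition counter_tape (r : Reg) : 'I_(#|Reg|.+2) :=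
  lift ord0 (lift ord_max (enum_rank r)).

Lemma role_counter r : role (counter_tape r) = CounterTape r.
Proof. by rewrite /role /counter_tape !liftK enum_rankK. Qed.
Lemma role_input : role ord0 = InputTape.
Proof. by rewrite /role unlift_none. Qed.
Lemma role_output : role ord_max = OutputTape.
Proof.
rewrite /role (_ : ord_max = lift ord0 ord_max) ?liftK ?unlift_none //.
exact: val_inj.
Qed.

(** A register is the head position on its own tape, whose cell 0 is marked.
    The head of the input tape moves together with that of the register pos. *)
Definition counter_move (a : action Reg) (r : Reg) (zero : bool) : move :=
  match a with
  | Inc r' => if r' == r then Right else Stay
  | Dec r' => if (r' == r) && ~~ zero then Left else Stay
  | _ => Stay
  end.

(** Besides the states of the machine there are an initial state, in which the
    marks are written, a state in which the output tape is rewound to its mark,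
    and a halting state. *)
Definition sim_state : finType := (option bool + mstate M)%type.

Definition sim_trans (q : sim_state) (x : {ffun 'I_(#|Reg|.+2) -> option sym}) :
    sim_state * ('I_(#|Reg|.+2) -> option sym * move) :=
  match q with
  | inl None => (inr (mstart M), fun i => match role i with
      | InputTape => (x i, Stay) | OutputTape => (mark, Right) | CounterTape _ => (mark, Stay) end)
  | inl (Some true) => (q, fun i => (x i, Stay))
  | inl (Some false) =>
      let: back := x ord_max == mark in
      (inl (Some back), fun i => (x i,
         if role i is OutputTape then if back then Right else Left else Stay))
  | inr q' =>
      let z := fun r => x (counter_tape r) == mark in
      let: (q1, a) := mtrans q' z (if x ord0 is Some (inl b) then Some b else None) in
      (if q1 is Some q2 then inr q2 else inl (Some false), fun i => match role i with
        | InputTape => (x i, counter_move a pos (z pos))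
        | OutputTape => if a is Out b then (bit b, Right) else (x i, Stay)
        | CounterTape r => (x i, counter_move a r (z r)) end)
  end.

Definition sim_halt : pred sim_state := fun q => q == inl (Some true).

Definition sim_tm : turing_machine :=
  @TM sim_state unit #|Reg|.+1 (inl None) sim_halt sim_trans.

Variable w : bitseq.

Definition input_cells (i : nat) : option sym := if onth w i is Some b then bit b else None.
Definition counter_cells (i : nat) : option sym := if i == 0 then mark else None.
Definition output_cells (o : bitseq) (i : nat) : option sym :=
  if i is i'.+1 then nth None (map bit (rev o)) i' else mark.

Definition simulates (s : store Reg) (tp : 'I_(#|Reg|.+2) -> tape (option sym)) : Prop :=
  [/\ holds_at (tp ord0) input_cells (s.1 pos),
      forall r, holds_at (tp (counter_tape r)) counter_cells (s.1 r) &
      holds_at (tp ord_max) (output_cells s.2) (size s.2).+1].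

Lemma holds_at_counter_move a r (t : tape (option sym)) c x (s : store Reg) :
  holds_at t c (s.1 r) -> x = c (s.1 r) ->
  holds_at (tape_act None t (x, counter_move a r (zeros s.1 r))) c ((act a s).1 r).
Proof.
move=> rp ->; apply: (holds_at_ext (upd_id c (s.1 r))); rewrite /zeros.
case: a => [|r'|r'|b] /=; [exact: holds_at_stay| | |exact: holds_at_stay];
  rewrite /upd (eq_sym r); case: eqP => [->|_] /=; try exact: holds_at_stay.
  exact: holds_at_right.
by case: (s.1 r) rp => [|p] rp; [exact: holds_at_stay|exact: holds_at_left].
Qed.

Lemma simulates_step q s tp q1 s1 : simulates s tp ->
  mstep (M := M) pos w q s = (q1, s1) ->
  exists2 tp', tm_step (M := sim_tm) (inr q, tp) =
    (if q1 is Some q2 then inr q2 else inl (Some false), tp') & simulates s1 tp'.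
Proof.
move=> [ri rc ro]; rewrite /mstep /tm_step /=.
set x := [ffun i => _].
have xE i : x i = tape_read None (tp i) by rewrite ffunE.
have xi : x ord0 = input_cells (s.1 pos) by rewrite xE; exact: holds_at_read ri.
have xc r : x (counter_tape r) = counter_cells (s.1 r) by rewrite xE; exact: holds_at_read (rc r).
have xo : x ord_max = output_cells s.2 (size s.2).+1 by rewrite xE; exact: holds_at_read ro.
have zE r : (x (counter_tape r) == mark) = zeros s.1 r.
  by rewrite xc /counter_cells /zeros; case: (s.1 r == 0).
have -> : (fun r => x (counter_tape r) == mark) = zeros s.1 by apply/funext => r.
have -> : (if x ord0 is Some (inl b) then Some b else None) = scan pos w s.1.
  by rewrite xi /input_cells /scan; case: onth.
case: mtrans => q' a [<- <-]; eexists; first by [].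
split.
- by rewrite role_input zE; apply: holds_at_counter_move.
- by move=> r; rewrite role_counter zE; apply: holds_at_counter_move.
rewrite role_output; case: a => [|r|r|b]; rewrite ?xo;
  try exact: (holds_at_ext (upd_id _ _) (holds_at_stay _ ro)).
apply: (holds_at_ext _ (holds_at_right _ ro)) => /= -[|i]; rewrite /upd //= eqSS.
rewrite rev_cons map_rcons nth_rcons size_map size_rev.
case: ltngtP => // il; by rewrite nth_default // size_map size_rev ltnW.
Qed.

Lemma simulates_exits q s s' t tp : exits (M := M) pos w q s s' t -> simulates s tp ->
  exists2 tp', iter t (tm_step (M := sim_tm)) (inr q, tp) = (inl (Some false), tp')
    & simulates s' tp'.
Proof.
move=> e; elim: e tp => {q s s' t} [q s s'|q s q1 s1 s' t] E.
  by move=> tp S; have [tp' E' S'] := simulates_step S E; exists tp'.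
move=> _ IH tp S; have [tp' E' S'] := simulates_step S E.
have [tp2 E2 S2] := IH _ S'; exists tp2 => //.
by rewrite iterSr E'.
Qed.

Lemma simulates_start : exists2 tp,
  tm_step (tm_init sim_tm w) = (inr (mstart M), tp) & simulates (fun=> 0, [::]) tp.
Proof.
rewrite /tm_step /tm_init /=; eexists; first by [].
split => /=.
- have ri : holds_at (Tape [::] (map bit w)) input_cells 0.
    split=> // i /=; rewrite add0n /input_cells.
    by elim: (w) i => [|b v IH] [|i] //=; exact: IH.
  rewrite role_input ffunE /= (holds_at_read ri).
  exact: (holds_at_ext (upd_id _ _) (holds_at_stay _ ri)).
- by move=> r; rewrite role_counter; split=> [[|i]|//] //=; rewrite nth_nil.
- by rewrite role_output; split=> [i|[|]//] //=; rewrite !nth_nil.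
Qed.

Lemma rewind_output o p tp : p <= size o ->
  holds_at (tp ord_max) (output_cells o) p ->
  exists2 tp', iter p.+1 (tm_step (M := sim_tm)) (inl (Some false), tp) = (inl (Some true), tp')
    & holds_at (tp' ord_max) (output_cells o) 1.
Proof.
elim: p tp => [|p IH] tp po rp.
  rewrite /= /tm_step /= ffunE (holds_at_read rp) /=; eexists; first by [].
  by rewrite /= role_output ffunE (holds_at_read rp);
     exact: (holds_at_ext (upd_id _ _) (holds_at_right _ rp)).
rewrite iterSr /tm_step /= ffunE (holds_at_read rp) /=.
have -> : (nth None [seq bit i | i <- rev o] p == mark) = false.
  by rewrite (nth_map false) ?size_rev.
apply: IH; first exact: ltnW.
rewrite /= role_output ffunE (holds_at_read rp).
exact: (holds_at_ext (upd_id _ _) (holds_at_left _ rp)).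
Qed.

Lemma holds_at_output (c : tm_config sim_tm) (o : bitseq) :
  holds_at (c.2 ord_max) (output_cells o) 1 -> tm_output c (rev o).
Proof.
move=> [hr _]; exists (drop (size o) (rtape (c.2 ord_max))).
set r := rtape _ in hr *.
have sz : size o <= size r.
  case: (leqP (size o) (size r)) => // lt.
  have := hr (size r); rewrite nth_default //= (nth_map false) // size_rev //.
split; last by rewrite -nth0 nth_drop hr /= nth_default // size_map size_rev addn0.
rewrite -[LHS](cat_take_drop (size o)); congr (_ ++ _).
apply: (@eq_from_nth _ None); first by rewrite size_takel // size_map size_rev.
move=> i; rewrite size_takel // => il; rewrite nth_take // hr //.
Qed.

(** One initial step, t simulated steps, and a rewinding that takes two more
    steps than the length of the output, which is at most t. *)
Theorem sim_tm_correct s t :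
  exits (M := M) pos w (mstart M) (fun=> 0, [::]) s t ->
  tm_computes_within sim_tm w (rev s.2) (t + t + 3).
Proof.
move=> e; have := exits_size e; rewrite /= add0n => so.
have [tp0 E0 S0] := simulates_start.
have [tp1 E1 S1] := simulates_exits e S0; case: S1 => _ _ ro.
have rb : exists2 tp', iter (size s.2).+2 (tm_step (M := sim_tm)) (inl (Some false), tp1) =
      (inl (Some true), tp')
    & holds_at (tp' ord_max) (output_cells s.2) 1.
  rewrite iterSr /tm_step /= ffunE (holds_at_read ro) /=.
  have -> : (nth None [seq bit i | i <- rev s.2] (size s.2) == mark) = false.
    by rewrite nth_default // size_map size_rev.
  apply: rewind_output => //.
  rewrite /= role_output ffunE (holds_at_read ro).
  exact: (holds_at_ext (upd_id _ _) (holds_at_left _ ro)).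
have [tp2 E2 r2] := rb.
exists ((size s.2).+2 + (t + 1)); first by lia.
rewrite iterD (iterD t 1) [iter 1 _ _]/= E0 E1 E2.
split=> //; exact: holds_at_output.
Qed.

End Simulation.

(** * Elementary counter programs *)

Section Macros.
Variables (Reg : finType) (pos : Reg) (w : bitseq).
Implicit Types (e : env Reg) (o : bitseq) (r t : Reg) (M : machine Reg).
Notation runs := (runs_in pos w).

Definition nonzero r : test Reg := fun z _ => ~~ z r.

Lemma upd_same (f : Reg -> nat) r x : f r = x -> upd f r x = f.
Proof. by move=> fx; apply/funext => i; rewrite /upd; case: eqP => [->|]. Qed.

Lemma runs_eq M s s1 s2 T : s1 = s2 -> runs M s s1 T -> runs M s s2 T.
Proof. by move=> ->. Qed.

Lemma runs_act_eq (a : action Reg) s s' : act a s = s' -> runs (mact a) s s' 1.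
Proof. by move=> <-; exact: runs_act. Qed.

Fixpoint mincs (s : seq Reg) : machine Reg :=
  if s is r :: s' then mseq (mact (Inc r)) (mincs s') else mact (Nop Reg).

Lemma runs_incs s e o : runs (mincs s) (e, o) (fun r => e r + count_mem r s, o) (size s).+1.
Proof.
elim: s e => [|r s IH] e /=.
  by apply: runs_act_eq; congr (_, _); apply/funext => r; rewrite addn0.
rewrite -add1n; apply: (runs_seq (runs_act _ _ _ _)).
apply: runs_eq (IH _); congr (_, _); apply/funext => r'.
by rewrite /upd /= (eq_sym r); case: eqP => [->|_] /=; lia.
Qed.

Definition mrewind r : machine Reg := mwhile (nonzero r) (mact (Dec r)).

Lemma runs_rewind r e o : runs (mrewind r) (e, o) (upd e r 0, o) (e r * 2).+1.
Proof.
pose S i := (upd e r (e r - i), o).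
have -> : (e, o) = S 0 by rewrite /S subn0 upd_same.
have -> : upd e r 0 = upd e r (e r - e r) by rewrite subnn.
apply: (runs_while (S := S)) => [i im|i im|].
- by rewrite /nonzero /zeros /S /= /upd eqxx; lia.
- apply: runs_act_eq; congr (_, _); apply/funext => r'.
  by rewrite /S /upd /= eqxx; case: eqP => // _; lia.
- by rewrite /nonzero /zeros /S /= /upd eqxx subnn.
Qed.

(** The register t takes over what r loses, so that r can be restored. *)
Definition mfor r t M : machine Reg :=
  mseq (mwhile (nonzero r) (mseq (mact (Dec r)) (mseq (mact (Inc t)) M)))
       (mwhile (nonzero t) (mseq (mact (Dec t)) (mact (Inc r)))).

Lemma runs_for r t M (E : nat -> env Reg) m o T : r != t ->
  (forall i, E i r = m) -> (forall i, E i t = 0) ->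
  (forall i, i < m -> runs M (upd (upd (E i) r (m - i.+1)) t i.+1, o)
    (upd (upd (E i.+1) r (m - i.+1)) t i.+1, o) T) ->
  runs (mfor r t M) (E 0, o) (E m, o) (m * (T + 6) + 2).
Proof.
move=> /negbTE rt Er Et H; have tr := rt; rewrite eq_sym in tr.
have -> : m * (T + 6) + 2 = (m * (1 + (1 + T)).+1).+1 + (m * (1 + 1).+1).+1 by lia.
pose S i := (upd (upd (E i) r (m - i)) t i, o).
pose S' i := (upd (upd (E m) r i) t (m - i), o).
have -> : (E 0, o) = S 0 by rewrite /S subn0 (upd_same (Er 0)) upd_same.
have -> : (E m, o) = S' m.
  by rewrite /S' subnn [in RHS](upd_same (Er m)) upd_same.
apply: (@runs_seq _ _ _ _ _ _ (S m)).
  apply: (runs_while (S := S)) => [i im|i im|].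
  - by rewrite /nonzero /zeros /S /= /upd rt eqxx; lia.
  - apply: (runs_seq (runs_act _ _ _ _)); apply: (runs_seq (runs_act _ _ _ _)).
    rewrite /S /=.
    have -> : upd (upd (upd (upd (E i) r (m - i)) t i) r (upd (upd (E i) r (m - i)) t i r).-1) t
      (upd (upd (upd (E i) r (m - i)) t i) r (upd (upd (E i) r (m - i)) t i r).-1 t).+1 =
      upd (upd (E i) r (m - i.+1)) t i.+1.
      apply/funext => x; rewrite /upd rt tr !eqxx; case: eqP => // _; case: eqP => // _; lia.
    exact: H.
  - by rewrite /nonzero /zeros /S /= /upd rt eqxx subnn.
have -> : S m = S' 0 by rewrite /S /S' subnn subn0.
apply: (runs_while (S := S')) => [i im|i im|].
- by rewrite /nonzero /zeros /S' /= /upd eqxx; lia.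
- apply: (runs_seq (runs_act _ _ _ _)); apply: runs_act_eq; congr (_, _).
  apply/funext => x; rewrite /S' /= /upd ?(rt, tr, eqxx).
  case: (eqVneq x t) => [xE|_]; rewrite ?xE ?(rt, tr, eqxx); first by lia.
  by case: (eqVneq x r) => [xE|_]; rewrite ?xE ?(rt, tr, eqxx).
- by rewrite /nonzero /zeros /S' /= /upd eqxx subnn.
Qed.

(** Decrementing r and r' together until one of them vanishes, the test v of
    which of them did decides on a comparison; t restores both. *)
Definition mcmp t (v : bool -> bool -> bool) r r' (M M' : machine Reg) : machine Reg :=
  let restore := mwhile (nonzero t) (mseq (mact (Dec t)) (mseq (mact (Inc r)) (mact (Inc r')))) in
  mseq (mwhile (fun z _ => ~~ z r && ~~ z r')
          (mseq (mact (Dec r)) (mseq (mact (Dec r')) (mact (Inc t)))))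
       (mif (fun z _ => v (z r) (z r')) (mseq restore M) (mseq restore M')).

Lemma runs_cmp t v r r' M M' e o s T : r != r' -> r != t -> r' != t -> e t = 0 ->
  runs (if v (e r <= e r') (e r' <= e r) then M else M') (e, o) s T ->
  runs (mcmp t v r r' M M') (e, o) s (e r * 8 + 3 + T).
Proof.
move=> /negbTE rr' /negbTE rt /negbTE r't et H.
have r'r := rr'; rewrite eq_sym in r'r; have tr := rt; rewrite eq_sym in tr.
have tr' := r't; rewrite eq_sym in tr'.
pose m := minn (e r) (e r').
pose S i := (upd (upd (upd e r (e r - i)) r' (e r' - i)) t i, o).
have S0 : (e, o) = S 0 by rewrite /S !subn0 (upd_same (r := r)) // (upd_same (r := r')) // upd_same.
apply: (@runs_leq _ _ _ _ _ _ ((m * 4).+1 + (((m * 4).+1) + T).+1)).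
  by have := geq_minl (e r) (e r'); rewrite -/m; lia.
rewrite {1}S0; apply: (@runs_seq _ _ _ _ _ _ (S m)).
  apply: (runs_while (S := S)) => [i im|i im|].
  - by rewrite /zeros /S /= /upd rt rr' r't !eqxx; move: im; rewrite /m; lia.
  - apply: (@runs_seq _ _ _ _ _ _ _ _ 1 2 (runs_act _ _ _ _)).
    apply: (@runs_seq _ _ _ _ _ _ _ _ 1 1 (runs_act _ _ _ _)).
    apply: runs_act_eq; congr (_, _); apply/funext => x.
    rewrite /S /= /upd ?(rr', r'r, rt, tr, r't, tr', eqxx).
    case: (eqVneq x t) => [xE|_]; first by rewrite ?xE ?(tr, tr').
    case: (eqVneq x r') => [xE|_]; first by rewrite ?xE ?(rr', r'r, rt, tr, r't, tr', eqxx); lia.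
    by case: (eqVneq x r) => [xE|_]; rewrite ?xE ?(rr', r'r, rt, tr, r't, tr', eqxx); lia.
  - by rewrite /zeros /S /= /upd rt rr' r't !eqxx /m; lia.
have back : runs (mwhile (nonzero t) (mseq (mact (Dec t)) (mseq (mact (Inc r)) (mact (Inc r')))))
   (S m) (e, o) (m * 4).+1.
  rewrite S0; pose S' i := S (m - i).
  have -> : S m = S' 0 by rewrite /S' subn0.
  have -> : S 0 = S' m by rewrite /S' subnn.
  have mr : m <= e r by rewrite geq_minl.
  have mr' : m <= e r' by rewrite geq_minr.
  apply: (runs_while (S := S')) => [i im|i im|].
  - by rewrite /nonzero /zeros /S' /S /= /upd eqxx; lia.
  - apply: (@runs_seq _ _ _ _ _ _ _ _ 1 2 (runs_act _ _ _ _)).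
    apply: (@runs_seq _ _ _ _ _ _ _ _ 1 1 (runs_act _ _ _ _)).
    apply: runs_act_eq; congr (_, _); apply/funext => x.
    rewrite /S /= /upd ?(rr', r'r, rt, tr, r't, tr', eqxx).
    case: (eqVneq x r') => [xE|_]; first by rewrite ?xE r't; lia.
    case: (eqVneq x r) => [xE|_]; first by rewrite ?xE rt; lia.
    by case: (eqVneq x t) => [xE|_]; rewrite ?xE ?(rr', r'r, rt, tr, r't, tr', eqxx); lia.
  - by rewrite /nonzero /zeros /S' /S /= /upd eqxx; lia.
apply: runs_if.
have -> : zeros (S m).1 r = (e r <= e r').
  by rewrite /zeros /S /= /upd rt rr' eqxx /m; lia.
have -> : zeros (S m).1 r' = (e r' <= e r).
  by rewrite /zeros /S /= /upd r't eqxx /m; lia.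
by case: (v _ _) H => H; apply: runs_seq back H.
Qed.

Fixpoint mprint (s : bitseq) : machine Reg :=
  if s is b :: s' then mseq (mact (Out Reg b)) (mprint s') else mact (Nop Reg).

Lemma runs_print s e o : runs (mprint s) (e, o) (e, rev s ++ o) (size s).+1.
Proof.
elim: s o => [|b s IH] o; first exact: runs_act_eq.
rewrite -add1n; apply: (runs_seq (runs_act _ _ _ _)).
by apply: runs_eq (IH _); rewrite /= rev_cons cat_rcons.
Qed.

Definition madd r t : machine Reg := mfor r t (mact (Inc pos)).

Lemma runs_add r t e o : r != t -> r != pos -> t != pos -> e t = 0 ->
  runs (madd r t) (e, o) (upd e pos (e pos + e r), o) (e r * 7 + 2).
Proof.
move=> rt /negbTE rp /negbTE tp et.
have pr := rp; rewrite eq_sym in pr; have pt := tp; rewrite eq_sym in pt.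
pose E i := upd e pos (e pos + i).
have -> : (e, o) = (E 0, o) by rewrite /E addn0 upd_same.
have -> : e r * 7 = e r * (1 + 6) by [].
apply: (runs_for (E := E)) => // [i|i|i im].
- by rewrite /E /upd rp.
- by rewrite /E /upd tp.
- apply: runs_act_eq; congr (_, _); apply/funext => x.
  rewrite /E /upd /= pr pt eqxx; case: (eqVneq x pos) => // ->.
  by rewrite pr pt; lia.
Qed.

(** The position must be reset in both branches, since the outcome of the test is
    kept only in the control state. *)
Definition mprobe (Go M M' : machine Reg) : machine Reg :=
  mseq Go (mif (fun _ b => b == Some true) (mseq (mrewind pos) M) (mseq (mrewind pos) M')).

Lemma runs_probe Go M M' e o v s T1 T : e pos = 0 ->
  runs Go (e, o) (upd e pos v, o) T1 ->
  runs (if nth false w v then M else M') (e, o) s T ->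
  runs (mprobe Go M M') (e, o) s (T1 + ((v * 2).+1 + T).+1).
Proof.
move=> ep go H; apply: (runs_seq go); apply: runs_if.
have -> : (scan pos w (upd e pos v, o).1 == Some true) = nth false w v.
  rewrite /scan /= /upd eqxx; elim: (w) (v) => [|b w1 IH] [|v1] //=; by case: b.
have back : runs (mrewind pos) (upd e pos v, o) (e, o) (v * 2).+1.
  have vE : upd e pos v pos = v by rewrite /upd eqxx.
  have := runs_rewind pos (upd e pos v) o; rewrite vE.
  apply: runs_eq; congr (_, _); apply/funext => x.
  by rewrite /upd; case: eqP => // ->.
by case: nth H => H; apply: runs_seq back H.
Qed.

End Macros.

(** * Tests and printing programs *)

Definition poly_bounded (T : nat -> nat) : Prop :=
  exists c d, forall x, T x <= c * x.+1 ^ d.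

Lemma poly_bounded_cst k : poly_bounded (fun=> k).
Proof. by exists k, 0 => x; rewrite muln1. Qed.
Lemma poly_bounded_id : poly_bounded id.
Proof. by exists 1, 1 => x; rewrite mul1n expn1. Qed.
Lemma poly_bounded_add T1 T2 : poly_bounded T1 -> poly_bounded T2 ->
  poly_bounded (fun x => T1 x + T2 x).
Proof.
move=> [c1 [d1 h1]] [c2 [d2 h2]]; exists (c1 + c2), (d1 + d2) => x.
rewrite mulnDl; apply: leq_add.
  by apply: leq_trans (h1 x) _; rewrite leq_mul2l leq_pexp2l ?leq_addr ?orbT.
by apply: leq_trans (h2 x) _; rewrite leq_mul2l leq_pexp2l ?leq_addl ?orbT.
Qed.
Lemma poly_bounded_mul T1 T2 : poly_bounded T1 -> poly_bounded T2 ->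
  poly_bounded (fun x => T1 x * T2 x).
Proof.
move=> [c1 [d1 h1]] [c2 [d2 h2]]; exists (c1 * c2), (d1 + d2) => x.
by rewrite expnD mulnACA; apply: leq_mul.
Qed.

Lemma poly_bounded_S T : poly_bounded T -> poly_bounded (fun x => (T x).+1).
Proof.
move=> h; have [c [d H]] := poly_bounded_add h (poly_bounded_cst 1).
by exists c, d => x; rewrite -addn1.
Qed.

Lemma poly_bounded_exp T d : poly_bounded T -> poly_bounded (fun x => T x ^ d).
Proof.
move=> h; elim: d => [|d IH]; first exact: (poly_bounded_cst 1).
by have [c [k H]] := poly_bounded_mul h IH; exists c, k => x; rewrite expnS.
Qed.

Ltac poly_bound := do ?[assumption | exact: poly_bounded_cst | exact: poly_bounded_id
  | apply: poly_bounded_add | apply: poly_bounded_mul | apply: poly_bounded_S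
  | apply: poly_bounded_exp].

(** The scalar registers hold the input position, the number of vertices, the two
    bounds of the chains and two temporaries.  A loop index i is stored in
    the register Dig i, and the number of remaining rounds in Bar i. *)
Definition reg : finType := ('I_6 + ('I_5 + 'I_5))%type.
Definition scalar k (h : k < 6) : reg := inl (Ordinal h).
Definition Pos : reg := @scalar 0 isT.
Definition NumV : reg := @scalar 1 isT.
Definition Mid : reg := @scalar 2 isT.
Definition Tot : reg := @scalar 3 isT.
Definition Tmp1 : reg := @scalar 4 isT.
Definition Tmp2 : reg := @scalar 5 isT.
Definition Dig (i : 'I_5) : reg := inr (inl i).
Definition Bar (i : 'I_5) : reg := inr (inr i).

Definition regs (n : nat) (w : bitseq) (d : 'I_5 -> nat) : env reg := fun r =>
  match r with
  | inl k => nth 0 [:: 0; n; word_mid n w; word_tot n w; 0; 0] k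
  | inr (inl i) => d i
  | inr (inr i) => word_tot n w - d i
  end.

Local Notation runs w := (runs_in Pos w).
Local Notation prog := (machine reg).
Local Notation digits := ('I_5 -> nat).

Definition in_range n w (d : digits) := forall i, d i <= word_tot n w.

Lemma regs_le n w d r : in_range n w d -> regs n w d r <= word_tot n w.
Proof.
move=> dt; case: r => [[k kl]|[i|i]] /=; [|exact: dt|exact: leq_subr].
by do 6?[case: k kl => [|k] kl /=; rewrite /word_tot /word_mid; try lia].
Qed.

(** A test is a program with two continuations.  It spends its time, restores the
    registers and goes on with the continuation selected by val; Boolean
    connectives are then compositions of tests. *)
Definition decides (Tst : prog -> prog -> prog) (val : nat -> bitseq -> digits -> bool) : Prop :=
  exists2 T, poly_bounded T & forall n w d o M M' s t, in_range n w d ->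
    runs w (if val n w d then M else M') (regs n w d, o) s t ->
    runs w (Tst M M') (regs n w d, o) s (T (word_tot n w) + t).

Definition tif (T1 T2 T3 : prog -> prog -> prog) : prog -> prog -> prog :=
  fun M M' => T1 (T2 M M') (T3 M M').

Lemma decides_if T1 T2 T3 v1 v2 v3 : decides T1 v1 -> decides T2 v2 -> decides T3 v3 ->
  decides (tif T1 T2 T3) (fun n w d => if v1 n w d then v2 n w d else v3 n w d).
Proof.
move=> [t1 p1 h1] [t2 p2 h2] [t3 p3 h3].
exists (fun x => t1 x + (t2 x + t3 x)); first by do ?apply: poly_bounded_add.
move=> n w d o M M' s t dr H; rewrite -addnA; apply: h1 => //.
case: (v1 n w d) H => H.
  by apply: (@runs_leq _ _ _ _ _ _ (t2 (word_tot n w) + t)); [lia|exact: h2].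
by apply: (@runs_leq _ _ _ _ _ _ (t3 (word_tot n w) + t)); [lia|exact: h3].
Qed.

Definition tconst (b : bool) : prog -> prog -> prog := fun M M' => if b then M else M'.
Lemma decides_const b : decides (tconst b) (fun _ _ _ => b).
Proof. by exists (fun=> 0); [exact: poly_bounded_cst|move=> n w d o M M' s t _; rewrite add0n]. Qed.

Definition tnot T := tif T (tconst false) (tconst true).
Definition tand T1 T2 := tif T1 T2 (tconst false).
Definition tor T1 T2 := tif T1 (tconst true) T2.

Lemma decides_and T1 T2 v1 v2 : decides T1 v1 -> decides T2 v2 ->
  decides (tand T1 T2) (fun n w d => v1 n w d && v2 n w d).
Proof. by move=> h1 h2; exact: decides_if h1 h2 (decides_const false). Qed.

Lemma decides_or T1 T2 v1 v2 : decides T1 v1 -> decides T2 v2 ->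
  decides (tor T1 T2) (fun n w d => v1 n w d || v2 n w d).
Proof. by move=> h1 h2; exact: decides_if h1 (decides_const true) h2. Qed.

Lemma decides_not T1 v1 : decides T1 v1 ->
  decides (tnot T1) (fun n w d => ~~ v1 n w d).
Proof. by move=> h1; exact: decides_if h1 (decides_const false) (decides_const true). Qed.

Lemma decides_cmp v r r' : r != r' -> r != Tmp1 -> r' != Tmp1 ->
  decides (mcmp Tmp1 v r r') (fun n w d =>
     v (regs n w d r <= regs n w d r') (regs n w d r' <= regs n w d r)).
Proof.
move=> rr' rt r't; exists (fun x => x * 8 + 3).
  by poly_bound.
move=> n w d o M M' s t dr H.
apply: runs_leq (runs_cmp rr' rt r't _ H) => //.
by rewrite leq_add2r leq_add2r leq_mul2r regs_le.
Qed.

Definition teq := mcmp Tmp1 andb.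
Definition tlt := mcmp Tmp1 (fun _ b => ~~ b).

Lemma decides_eq r r' : r != r' -> r != Tmp1 -> r' != Tmp1 ->
  decides (teq r r') (fun n w d => regs n w d r == regs n w d r').
Proof.
move=> h1 h2 h3; have [T p h] := decides_cmp andb h1 h2 h3; exists T => //.
by move=> n w d o M M' s t; rewrite eqn_leq; exact: h.
Qed.

Lemma decides_lt r r' : r != r' -> r != Tmp1 -> r' != Tmp1 ->
  decides (tlt r r') (fun n w d => regs n w d r < regs n w d r').
Proof.
move=> h1 h2 h3; have [T p h] := decides_cmp (fun _ b => ~~ b) h1 h2 h3; exists T => //.
by move=> n w d o M M' s t; rewrite ltnNge; exact: h.
Qed.

(** The incremented register may exceed the range of loop indices, therefore the
    comparison is not an instance of decides_eq. *)
Definition tsucc r r' : prog -> prog -> prog := fun M M' =>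
  mseq (mact (Inc r)) (teq r r' (mseq (mact (Dec r)) M) (mseq (mact (Dec r)) M')).

Lemma decides_succ r r' : r != r' -> r != Tmp1 -> r' != Tmp1 ->
  decides (tsucc r r') (fun n w d => (regs n w d r).+1 == regs n w d r').
Proof.
move=> rr' rt r't; exists (fun x => x * 8 + 13).
  by poly_bound.
move=> n w d o M M' s t dr H.
set e := regs n w d in H *.
have eb : e r <= word_tot n w by exact: regs_le.
pose e1 := upd e r (e r).+1.
apply: (@runs_leq _ _ _ _ _ _ (1 + ((e1 r) * 8 + 3 + (1 + t)))).
  by rewrite /e1 /upd eqxx; lia.
apply: (runs_seq (s1 := (e1, o))); first exact: runs_act_eq.
apply: runs_cmp => //; first by rewrite /e1 /upd eq_sym (negbTE rt).
have -> : e1 r' = e r' by rewrite /e1 /upd eq_sym (negbTE rr').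
have -> : e1 r = (e r).+1 by rewrite /e1 /upd eqxx.
have back : runs w (mact (Dec r)) (e1, o) (e, o) 1.
  apply: runs_act_eq; congr (_, _); apply/funext => x.
  by rewrite /e1 /upd /= eqxx; case: eqP => // ->.
by rewrite -eqn_leq; case: eqP H => _ H; exact: runs_seq back H.
Qed.

Definition goto_row (r : reg) (j : nat) : prog :=
  mseq (madd Pos NumV Tmp1)
   (mseq (mfor r Tmp1 (mseq (madd Pos NumV Tmp2) (mincs (nseq 5 Pos)))) (mincs (nseq j.+1 Pos))).

Lemma runs_goto_row n w d o i j : in_range n w d ->
  let x := word_tot n w in
  runs w (goto_row (Dig i) j) (regs n w d, o)
   (upd (regs n w d) Pos (n.+1 + d i * (n + 5) + j), o)
   ((x * 7 + 2) + (x * (x * 7 + 2 + 6 + 6) + 2 + j.+2)).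
Proof.
move=> dr x; set e := regs n w d.
have nx : n <= x by rewrite /x /word_tot /word_mid -addnA leq_addr.
have eN : e NumV = n by [].
have ud v u : upd (upd e Pos v) Pos u = upd e Pos u.
  by apply/funext => y; rewrite /upd; case: eqP.
apply: (runs_seq (s1 := (upd e Pos n, o))).
  apply: (@runs_leq _ _ _ _ _ _ (e NumV * 7 + 2)); first by rewrite eN; lia.
  by have := @runs_add _ Pos w NumV Tmp1 e o isT isT isT (erefl 0).
pose E a := upd e Pos (n + a * (n + 5)).
apply: (runs_seq (s1 := (E (d i), o))).
  have -> : (upd e Pos n, o) = (E 0, o) by rewrite /E addn0.
  apply: (@runs_leq _ _ _ _ _ _ (d i * (x * 7 + 2 + 6 + 6) + 2)).
    by rewrite leq_add2r leq_mul2r dr orbT.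
  apply: (runs_for (E := E)) => // a ad.
  set e1 := upd (upd (E a) (Dig i) _) Tmp1 _.
  have e1N : e1 NumV = n by [].
  have e1P : e1 Pos = n + a * (n + 5) by [].
  apply: (runs_seq (s1 := (upd e1 Pos (e1 Pos + n), o))).
    apply: (@runs_leq _ _ _ _ _ _ (e1 NumV * 7 + 2)); first by rewrite e1N; lia.
    by have := @runs_add _ Pos w NumV Tmp2 e1 o isT isT isT (erefl 0).
  apply: runs_eq (runs_incs _ _ _ _ _); congr (_, _); apply/funext => y.
  rewrite count_nseq /=; rewrite e1P /upd.
  case: (eqVneq y Pos) => [->|yP] /=; first by rewrite /E /upd eqxx; lia.
  by rewrite addn0 /e1 /E /upd (negbTE yP).
have -> : j.+2 = (size (nseq j.+1 Pos)).+1 by rewrite size_nseq.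
apply: runs_eq (runs_incs _ _ _ _ _); congr (_, _); apply/funext => y.
rewrite count_nseq /= /E /upd.
by case: (eqVneq y Pos) => [_|yP] /=; lia.
Qed.

Definition tflag (j : nat) (i : 'I_5) : prog -> prog -> prog := mprobe Pos (goto_row (Dig i) j).

Lemma word_addr_le n w d i j : in_range n w d ->
  n.+1 + d i * (n + 5) + j <= (word_tot n w).+1 + word_tot n w * (word_tot n w + 5) + j.
Proof.
move=> dr; rewrite leq_add2r;
have nx : n <= word_tot n w by rewrite /word_tot /word_mid -addnA leq_addr.
by apply: leq_add => //; apply: leq_mul => //; rewrite leq_add2r.
Qed.

Lemma decides_flag j i : decides (tflag j i) (fun n w d => flag n w j (d i)).
Proof.
exists (fun x => ((x * 7 + 2) + (x * (x * 7 + 2 + 6 + 6) + 2 + j.+2)) +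
    (((x.+1 + x * (x + 5) + j) * 2) + 2)).
  by poly_bound.
move=> n w d o M M' s t dr H.
have R := runs_probe (erefl 0) (runs_goto_row o i j dr) H.
apply: runs_leq R; have := word_addr_le i j dr; lia.
Qed.

Definition goto_edge (i i' : 'I_5) : prog := mseq (goto_row (Dig i) 5) (madd Pos (Dig i') Tmp1).

Lemma runs_goto_edge n w d o i i' : in_range n w d ->
  let x := word_tot n w in
  runs w (goto_edge i i') (regs n w d, o)
   (upd (regs n w d) Pos (n.+1 + d i * (n + 5) + (5 + d i')), o)
   ((x * 7 + 2) + (x * (x * 7 + 2 + 6 + 6) + 2 + 7) + (x * 7 + 2)).
Proof.
move=> dr x; apply: (runs_seq (runs_goto_row o i 5 dr)).
set e := upd _ _ _.
apply: (@runs_leq _ _ _ _ _ _ (e (Dig i') * 7 + 2)).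
  by rewrite leq_add2r leq_mul2r dr orbT.
have := @runs_add _ Pos w (Dig i') Tmp1 e o isT isT isT (erefl 0).
apply: runs_eq; congr (_, _); apply/funext => y.
by rewrite /e /upd /= ; case: eqP => // _; rewrite -!addnA.
Qed.

Definition tedge i i' : prog -> prog -> prog := mprobe Pos (goto_edge i i').

Lemma decides_edge i i' : decides (tedge i i') (fun n w d => flag n w (5 + d i') (d i)).
Proof.
exists (fun x => ((x * 7 + 2) + (x * (x * 7 + 2 + 6 + 6) + 2 + 7) + (x * 7 + 2)) +
    (((x.+1 + x * (x + 5) + (5 + x)) * 2) + 2)).
  by poly_bound.
move=> n w d o M M' s t dr H.
have R := runs_probe (erefl 0) (runs_goto_edge o i i' dr) H.
apply: runs_leq R; have := word_addr_le i (5 + d i') dr; have := dr i'; lia.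
Qed.

(** The word f is printed from the registers of any digits d, and these registers
    are restored; l lists the loop indices that must be 0 beforehand because M
    loops over them.  The time bound is uniform in the game. *)
Definition prints (l : seq 'I_5) (M : prog) (f : nat -> bitseq -> digits -> bitseq) : Prop :=
  exists2 T, poly_bounded T & forall n w d o, in_range n w d -> (forall i, i \in l -> d i = 0) ->
    runs w M (regs n w d, o) (regs n w d, rev (f n w d) ++ o) (T (word_tot n w)).

Lemma prints_print l s : prints l (mprint reg s) (fun _ _ _ => s).
Proof.
exists (fun=> (size s).+1); first exact: poly_bounded_cst.
by move=> n w d o _ _; exact: runs_print.
Qed.

Lemma prints_seq l M1 M2 f1 f2 : prints l M1 f1 -> prints l M2 f2 ->
  prints l (mseq M1 M2) (fun n w d => f1 n w d ++ f2 n w d).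
Proof.
move=> [t1 p1 h1] [t2 p2 h2]; exists (fun x => t1 x + t2 x); first exact: poly_bounded_add.
move=> n w d o dr dl; apply: (runs_seq (h1 n w d o dr dl)).
by rewrite rev_cat -catA; exact: h2.
Qed.

Definition branch (Tst : prog -> prog -> prog) (M : bool -> prog) : prog :=
  Tst (M true) (M false).

(** Since the continuations may depend on the outcome b of a test, a word that is
    a function of finitely many tests is printed by a tree of branches. *)
Lemma prints_branch l Tst val (M : bool -> prog) f : decides Tst val ->
  (forall b, prints l (M b) (f b)) ->
  prints l (branch Tst M) (fun n w d => f (val n w d) n w d).
Proof.
move=> [t p h] H; have [t1 p1 h1] := H true; have [t2 p2 h2] := H false.
exists (fun x => t x + (t1 x + t2 x)); first by do ?apply: poly_bounded_add.
move=> n w d o dr dl; apply: h => //; case: (val n w d).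
  by apply: runs_leq (h1 _ _ _ _ _ _) => //; exact: leq_addr.
by apply: runs_leq (h2 _ _ _ _ _ _) => //; exact: leq_addl.
Qed.

Lemma upd_upd (A : eqType) (B : Type) (f : A -> B) x y z : upd (upd f x y) x z = upd f x z.
Proof. by apply/funext => u; rewrite /upd; case: eqP. Qed.

Lemma regs_upd n w d i x y : x = word_tot n w - y ->
  upd (upd (regs n w d) (Bar i) x) (Dig i) y = regs n w (upd d i y).
Proof.
move=> ->; apply/funext => -[k|[j|j]] //.
change ((if j == i then word_tot n w - y else word_tot n w - d j) =
  word_tot n w - (if j == i then y else d j)).
by case: eqP.
Qed.

Lemma regs_upd' n w d i x y : x = word_tot n w - y ->
  upd (upd (regs n w d) (Dig i) y) (Bar i) x = regs n w (upd d i y).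
Proof.
move=> xy; rewrite -(regs_upd d i xy); apply/funext => r; rewrite /upd.
by case: (eqVneq r (Bar i)) => [->|_].
Qed.

Definition mloop (i : 'I_5) (M : prog) : prog :=
  mseq (mwhile (nonzero (Bar i)) (mseq M (mseq (mact (Dec (Bar i))) (mact (Inc (Dig i))))))
       (mwhile (nonzero (Dig i)) (mseq (mact (Dec (Dig i))) (mact (Inc (Bar i))))).

Definition loop_out (i : 'I_5) (f : nat -> bitseq -> digits -> bitseq) n w (d : digits) : bitseq :=
  flatten [seq f n w (upd d i a) | a <- iota 0 (word_tot n w)].

Lemma prints_loop l l' i M f : i \in l -> i \notin l' -> {subset l' <= l} ->
  prints l' M f -> prints l (mloop i M) (loop_out i f).
Proof.
move=> il il' ll [t p h].
exists (fun x => (x * (t x + 2).+1).+1 + (x * 3).+1).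
  by poly_bound.
move=> n w d o dr dl; set X := word_tot n w.
pose P a := flatten [seq f n w (upd d i b) | b <- iota 0 a].
pose S a := (regs n w (upd d i a), rev (P a) ++ o).
have d0 : upd d i 0 = d by apply: upd_same; exact: dl.
have -> : (regs n w d, o) = S 0 by rewrite /S d0.
pose S' a := (regs n w (upd d i (X - a)), rev (P X) ++ o).
have -> : (regs n w d, rev (loop_out i f n w d) ++ o) = S' X by rewrite /S' subnn d0.
apply: (runs_seq (s1 := S X)).
  apply: (runs_while (S := S)) => [a aX|a aX|].
  - by rewrite /nonzero /zeros /S /= /upd eqxx -lt0n subn_gt0.
  - have ra : in_range n w (upd d i a).
      by move=> j; rewrite /upd; case: eqP => // _; exact: ltnW.
    have rl j : j \in l' -> upd d i a j = 0.
      move=> jl; rewrite /upd; case: eqP => [E|_]; last exact/dl/ll.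
      by rewrite -E jl in il'.
    apply: (runs_seq (h _ _ _ _ ra rl)).
    apply: (@runs_seq _ _ _ _ _ _ _ _ 1 1 (runs_act _ _ _ _)).
    apply: runs_act_eq; congr (_, _); last first.
      by rewrite /P -[a.+1]addn1 iotaD map_cat flatten_cat /= cats0 add0n rev_cat catA.
    have Da : regs n w (upd d i a) (Dig i) = a by rewrite /= /upd eqxx.
    have Ba : (regs n w (upd d i a) (Bar i)).-1 = X - a.+1 by rewrite /= /upd eqxx -/X; lia.
    rewrite -(upd_upd d i a a.+1) -(regs_upd (upd d i a) i (erefl (X - a.+1))) -Ba.
    congr (upd _ _ _.+1); exact: Da.
  - by rewrite /nonzero /zeros /S /= /upd eqxx subnn.
have -> : S X = S' 0 by rewrite /S' subn0.
apply: (runs_while (S := S')) => [a aX|a aX|].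
- by rewrite /nonzero /zeros /S' /= /upd eqxx -lt0n subn_gt0.
- apply: (@runs_seq _ _ _ _ _ _ _ _ 1 1 (runs_act _ _ _ _)).
  apply: runs_act_eq; congr (_, _).
  have Da : (regs n w (upd d i (X - a)) (Dig i)).-1 = X - a.+1 by rewrite /= /upd eqxx; lia.
  have Ba : (regs n w (upd d i (X - a)) (Bar i)).+1 = X - (X - a.+1).
    by rewrite /= /upd eqxx -/X; lia.
  rewrite -(upd_upd d i (X - a) (X - a.+1))
  -(regs_upd' (upd d i (X - a)) i (erefl (X - (X - a.+1)))).
  rewrite -Ba -[in RHS]Da; congr (upd _ _ _).
- by rewrite /nonzero /zeros /S' /= /upd eqxx subnn.
Qed.

(** * Printing the encoding of the semidefinite program *)

Section Program.

Let U : 'I_5 := @Ordinal 5 0 isT.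
Let P : 'I_5 := @Ordinal 5 1 isT.
Let Q : 'I_5 := @Ordinal 5 2 isT.
Let P2 : 'I_5 := @Ordinal 5 3 isT.
Let Q2 : 'I_5 := @Ordinal 5 4 isT.

Lemma decides_ext T v v' : (forall n w d, v n w d = v' n w d) -> decides T v -> decides T v'.
Proof.
by move=> vv; have -> : v' = v by apply/funext => n; apply/funext => w; apply/funext => d.
Qed.

Definition tadj i j := tand (tlt (Dig j) NumV) (tedge i j).
Lemma decides_adj i j : decides (tadj i j) (fun n w d => adj n w (d i) (d j)).
Proof. exact: decides_and (@decides_lt (Dig j) NumV isT isT isT) (decides_edge i j). Qed.

Definition tnode_edge i j :=
  tif (tflag 2 i) (teq (Dig j) NumV)
  (tif (tflag 3 i) (teq (Dig j) Mid)
  (tif (tlt (Dig i) NumV) (tadj i j)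
  (tif (tsucc (Dig i) Mid) (tflag 3 j)
  (tif (tsucc (Dig i) Tot) (tflag 4 j)
  (tor (tsucc (Dig i) (Dig j)) (tif (tlt (Dig i) Mid) (tflag 2 j) (tflag 3 j))))))).

Lemma decides_node_edge i j : i != j ->
  decides (tnode_edge i j) (fun n w d => node_edge n w (d i) (d j)).
Proof.
move=> ij.
have H := decides_if (decides_flag 2 i) (@decides_eq (Dig j) NumV isT isT isT)
  (decides_if (decides_flag 3 i) (@decides_eq (Dig j) Mid isT isT isT)
  (decides_if (@decides_lt (Dig i) NumV isT isT isT) (decides_adj i j)
  (decides_if (@decides_succ (Dig i) Mid isT isT isT) (decides_flag 3 j)
  (decides_if (@decides_succ (Dig i) Tot isT isT isT) (decides_flag 4 j)
  (decides_or (@decides_succ (Dig i) (Dig j) ij isT isT)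
  (decides_if (@decides_lt (Dig i) Mid isT isT isT) (decides_flag 2 j) (decides_flag 3 j))))))).
by apply: decides_ext H => n w d; rewrite /node_edge /= (eq_sym (d j) (d i).+1).
Qed.

Definition tnode_max i := tand (tnot (tflag 0 i))
  (tand (tflag 1 i) (tand (tnot (tflag 2 i)) (tnot (tflag 3 i)))).
Lemma decides_node_max i : decides (tnode_max i) (fun n w d => node_max n w (d i)).
Proof.
exact: decides_and (decides_not (decides_flag 0 i)) (decides_and (decides_flag 1 i)
  (decides_and (decides_not (decides_flag 2 i)) (decides_not (decides_flag 3 i)))).
Qed.

Definition tnode_rand i := tor (tflag 0 i) (tand (tnot (tlt (Dig i) NumV))
  (tand (tnot (tsucc (Dig i) Mid)) (tnot (tsucc (Dig i) Tot)))).
Lemma decides_node_rand i : decides (tnode_rand i) (fun n w d => node_rand n w (d i)).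
Proof.
exact: decides_or (decides_flag 0 i)
  (decides_and (decides_not (@decides_lt (Dig i) NumV isT isT isT))
  (decides_and (decides_not (@decides_succ (Dig i) Mid isT isT isT))
    (decides_not (@decides_succ (Dig i) Tot isT isT isT)))).
Qed.

Lemma decides_eqd i j : i != j -> decides (teq (Dig i) (Dig j)) (fun n w d => d i == d j).
Proof. by move=> ij; exact: (@decides_eq (Dig i) (Dig j) ij isT isT). Qed.

Definition enc_int (z : int) : bitseq := enc_rat z%:~R.

(** A coefficient of the program as a function of the outcomes of the thirteen
    tests on which it depends. *)
Definition coef_bits (pp' mx qp q'p epu up rd epq epq' qq' uq wi lo : bool) : int :=
  (if ~~ pp' then 0
  else if mx then if qp && q'p then epu%:R - up%:R else 0
  else if rd then if epq && epq' then if qq' then uq%:R else up%:R else 0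
  else if ~~ qq' then 0
  else if epq then uq%:R *+ (if wi then 4 else 1) - up%:R *+ (if lo then 2 else 1)
  else if lo && qp then up%:R else 0)%R.

Definition lmi_coef_word n w := lmi_coef (node_max n w) (node_rand n w) (wlose n w) (node_edge n w)
  (wt_up n w) (wt_dn n w).
Definition lmi_const_word n w := lmi_const (wlose n w).

Definition entryA : prog :=
  branch (teq (Dig P) (Dig P2)) (fun pp' => branch (tnode_max P) (fun mx =>
  branch (teq (Dig Q) (Dig P)) (fun qp => branch (teq (Dig Q2) (Dig P)) (fun q'p =>
  branch (tnode_edge P U) (fun epu => branch (teq (Dig U) (Dig P)) (fun up =>
  branch (tnode_rand P) (fun rd => branch (tnode_edge P Q) (fun epq =>
  branch (tnode_edge P Q2) (fun epq' => branch (teq (Dig Q) (Dig Q2)) (fun qq' =>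
  branch (teq (Dig U) (Dig Q)) (fun uq => branch (tflag 2 P) (fun wi =>
  branch (tflag 3 P) (fun lo =>
    mprint reg (enc_int (coef_bits pp' mx qp q'p epu up rd epq epq' qq' uq wi lo))))))))))))))).

Lemma prints_entryA l : prints l entryA
  (fun n w d => enc_int (lmi_coef_word n w (d U) (d P) (d Q) (d P2) (d Q2))).
Proof.
exact: (prints_branch (decides_eqd (i := P) (j := P2) isT) (fun pp' =>
  prints_branch (decides_node_max P) (fun mx =>
  prints_branch (decides_eqd (i := Q) (j := P) isT) (fun qp =>
  prints_branch (decides_eqd (i := Q2) (j := P) isT) (fun q'p =>
  prints_branch (decides_node_edge (i := P) (j := U) isT) (fun epu =>
  prints_branch (decides_eqd (i := U) (j := P) isT) (fun up =>
  prints_branch (decides_node_rand P) (fun rd =>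
  prints_branch (decides_node_edge (i := P) (j := Q) isT) (fun epq =>
  prints_branch (decides_node_edge (i := P) (j := Q2) isT) (fun epq' =>
  prints_branch (decides_eqd (i := Q) (j := Q2) isT) (fun qq' =>
  prints_branch (decides_eqd (i := U) (j := Q) isT) (fun uq =>
  prints_branch (decides_flag 2 P) (fun wi =>
  prints_branch (decides_flag 3 P) (fun lo =>
    prints_print l (enc_int (coef_bits pp' mx qp q'p epu up rd epq epq' qq' uq wi lo)))))))))))))))).
Qed.

Definition entryB : prog :=
  branch (teq (Dig P) (Dig P2)) (fun pp' => branch (teq (Dig Q) (Dig Q2)) (fun qq' =>
  branch (teq (Dig Q) (Dig P)) (fun qp => branch (tflag 3 P) (fun lo =>
    mprint reg (enc_int ([&& pp', qq', qp & lo]%:R)%R))))).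

Lemma prints_entryB l : prints l entryB
  (fun n w d => enc_int (lmi_const_word n w (d P) (d Q) (d P2) (d Q2))).
Proof.
exact: (prints_branch (decides_eqd (i := P) (j := P2) isT) (fun pp' =>
  prints_branch (decides_eqd (i := Q) (j := Q2) isT) (fun qq' =>
  prints_branch (decides_eqd (i := Q) (j := P) isT) (fun qp =>
  prints_branch (decides_flag 3 P) (fun lo =>
    prints_print l (enc_int ([&& pp', qq', qp & lo]%:R)%R)))))).
Qed.

Definition matrix_loops (M : prog) : prog := mloop P (mloop Q (mloop P2 (mloop Q2 M))).

Definition main : prog :=
  mseq (mloop U (mprint reg [:: true])) (mseq (mprint reg [:: false])
  (mseq (mloop P (mloop Q (mprint reg [:: true]))) (mseq (mprint reg [:: false])
  (mseq (matrix_loops entryB) (mloop U (matrix_loops entryA)))))).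

Definition matrix_out f := loop_out P (loop_out Q (loop_out P2 (loop_out Q2 f))).

Lemma prints_matrix f M : prints [::] M f ->
  prints [:: P; Q; P2; Q2] (matrix_loops M) (matrix_out f).
Proof.
move=> h.
apply: (@prints_loop _ [:: Q; P2; Q2]) => //;
  first by move=> i; rewrite !inE => /or3P [] ->; rewrite ?orbT.
apply: (@prints_loop _ [:: P2; Q2]) => //;
  first by move=> i; rewrite !inE => /orP [] ->; rewrite ?orbT.
apply: (@prints_loop _ [:: Q2]) => //; first by move=> i; rewrite !inE => ->; rewrite ?orbT.
exact: (@prints_loop _ [::]).
Qed.

Lemma prints_weaken l l' M f : {subset l' <= l} -> prints l' M f -> prints l M f.
Proof. by move=> ll [t p h]; exists t => // n w d o dr dl; apply: h => // i /ll /dl. Qed.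

Definition main_out n w d : bitseq :=
  loop_out U (fun _ _ _ => [:: true]) n w d ++ [:: false] ++
  loop_out P (loop_out Q (fun _ _ _ => [:: true])) n w d ++ [:: false] ++
  matrix_out (fun n w d => enc_int (lmi_const_word n w (d P) (d Q) (d P2) (d Q2))) n w d ++
  loop_out U (matrix_out (fun n w d =>
    enc_int (lmi_coef_word n w (d U) (d P) (d Q) (d P2) (d Q2)))) n w d.

Lemma prints_main : prints [:: U; P; Q; P2; Q2] main main_out.
Proof.
have sub (i : 'I_5) l : {subset l <= i :: l} by move=> j; rewrite inE => ->; rewrite orbT.
apply: prints_seq; first by apply: (@prints_loop _ [::]) => //; exact: prints_print.
apply: prints_seq; first exact: prints_print.
apply: prints_seq.
  apply: (@prints_loop _ [:: Q]) => //; first by move=> i; rewrite !inE => ->; rewrite ?orbT.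
  by apply: (@prints_loop _ [::]) => //; exact: prints_print.
apply: prints_seq; first exact: prints_print.
apply: prints_seq.
  by apply: (@prints_weaken _ [:: P; Q; P2; Q2]);
    [exact: sub|exact: (prints_matrix (prints_entryB _))].
apply: (@prints_loop _ [:: P; Q; P2; Q2]) => //.
exact: (prints_matrix (prints_entryA _)).
Qed.

(** Division with remainder by m identifies one loop over k m indices with two
    nested loops. *)
Lemma flatten_iota_pair (g : nat -> nat -> bitseq) k m :
  flatten [seq g (i %/ m) (i %% m) | i <- iota 0 (k * m)] =
  flatten [seq flatten [seq g p q | q <- iota 0 m] | p <- iota 0 k].
Proof.
elim: k => // k IH.
rewrite mulSn addnC iotaD map_cat flatten_cat IH -[k.+1]addn1
  [in RHS]iotaD map_cat flatten_cat /= cats0.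
congr (_ ++ flatten _); rewrite !add0n -[X in iota X m]addn0 iotaDl -map_comp.
apply/eq_in_map => q; rewrite mem_iota /= => qm.
by rewrite divnMDl ?(leq_ltn_trans _ qm) // modnMDl divn_small ?modn_small ?addn0.
Qed.

Lemma enc_ord_iota m (T : Type) (e : T -> bitseq) (f : 'I_m -> T) (g : nat -> bitseq) :
  (forall i : 'I_m, e (f i) = g i) -> enc_ord e f = flatten [seq g i | i <- iota 0 m].
Proof.
move=> H; rewrite /enc_ord -val_enum_ord -map_comp; congr flatten.
by apply: eq_map => i /=.
Qed.

Lemma enc_mx_pair m (A : 'M[rat]_(m * m)) (g : nat -> nat -> nat -> nat -> bitseq) :
  (forall i j, enc_rat (A i j) = g (i %/ m) (i %% m) (j %/ m) (j %% m)) ->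
  enc_mx A = flatten [seq flatten [seq flatten [seq flatten [seq g p q p' q'
     | q' <- iota 0 m] | p' <- iota 0 m] | q <- iota 0 m] | p <- iota 0 m].
Proof.
move=> H; rewrite /enc_mx.
rewrite (enc_ord_iota (g := fun i => flatten [seq flatten [seq g (i %/ m) (i %% m) p' q'
     | q' <- iota 0 m] | p' <- iota 0 m])).
  by rewrite (flatten_iota_pair (fun p q => flatten [seq flatten [seq g p q p' q'
     | q' <- iota 0 m] | p' <- iota 0 m])).
move=> i; rewrite (enc_ord_iota (g := fun j => g (i %/ m) (i %% m) (j %/ m) (j %% m))) //.
by rewrite (flatten_iota_pair (g (i %/ m) (i %% m))).
Qed.

Lemma flatten_true (s : seq nat) : flatten [seq [:: true] | _ <- s] = nseq (size s) true.
Proof. by elim: s => //= _ s ->. Qed.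

Lemma main_outE n w d : main_out n w d = enc_sdp (word_sdp n w).
Proof.
rewrite /main_out /enc_sdp /enc_unary -!cats1 -!catA.
congr (_ ++ _ ++ _ ++ _ ++ _ ++ _).
- by rewrite /loop_out flatten_true size_iota.
- rewrite /loop_out -(flatten_iota_pair (fun _ _ => [:: true])).
  by rewrite flatten_true size_iota.
- apply/esym; apply: (enc_mx_pair (g := fun p q p' q' => enc_int (lmi_const_word n w p q p' q'))).
  by move=> i j; rewrite mxE.
- apply/esym; apply: enc_ord_iota => u.
  apply: (enc_mx_pair (g := fun p q p' q' => enc_int (lmi_coef_word n w u p q p' q'))).
  by move=> i j; rewrite mxE.
Qed.

Definition is_true_bit : test reg := fun _ b => b == Some true.
Definition is_some_bit : test reg := fun _ b => b != None.

Definition bars : seq reg := [seq Bar i | i <- enum 'I_5].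
(** The first pass over the whole word adds its length once to the bound of the
    first chain and twice to that of the second; the second pass, over the
    initial unary number, adds the number of vertices to both.  Each Bar i starts
    from the second bound. *)
Definition step1 : seq reg := [:: Pos; Mid; Tot; Tot] ++ bars ++ bars.
Definition step2 : seq reg := [:: Pos; NumV; Mid; Tot] ++ bars.

Definition setup : prog :=
  mseq (mwhile is_some_bit (mincs step1)) (mseq (mrewind Pos)
  (mseq (mwhile is_true_bit (mincs step2)) (mrewind Pos))).

Lemma count_bars r : count_mem r bars = if r is inr (inr i) then 1 else 0.
Proof.
rewrite /bars count_map.
case: r => [k|[i|i]].
- by rewrite (eq_count (a2 := pred0)) ?count_pred0.
- by rewrite (eq_count (a2 := pred0)) ?count_pred0.
by rewrite (eq_count (a2 := pred1 i)) // count_uniq_mem ?enum_uniq // mem_enum.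
Qed.

Lemma runs_setup n w rest : w = enc_unary n ++ rest ->
  runs w setup (fun=> 0, [::]) (regs n w (fun=> 0), [::])
   ((size w * 16).+1 + ((size w * 2).+1 + ((n * 12).+1 + (n * 2).+1))).
Proof.
move=> wE; pose L := size w.
pose e1 i : env reg := fun r => i * count_mem r step1.
pose e2 i : env reg := fun r => upd (e1 L) Pos 0 r + i * count_mem r step2.
have e1P i : e1 i Pos = i by rewrite /e1 /step1 /= !count_cat !count_bars /=; lia.
have e2P i : e2 i Pos = i by rewrite /e2 /upd eqxx /step2 /= count_bars /=; lia.
have nL : n < L.
  by rewrite /L wE size_cat /enc_unary size_rcons size_nseq; lia.
apply: (runs_seq (s1 := (e1 L, [::]))).
  pose S i : store reg := (e1 i, [::]).
  have -> : (fun=> 0, [::]) = S 0 by [].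
  apply: (runs_while (S := S)) => [i iL|i iL|].
  - rewrite /is_some_bit /scan /S [(_, _).1]/= e1P; move: iL; rewrite /L.
    by elim: (w) i => [|b w1 IH] [|i] //=; exact: IH.
  - apply: runs_leq (runs_eq _ (runs_incs _ _ _ _ _));
      first by rewrite /= !size_cat /bars size_map size_enum_ord.
    by congr (_, _); apply/funext => r; rewrite /e1 mulSn addnC.
  - rewrite /is_some_bit /scan /S [(_, _).1]/= e1P /L negbK.
    by elim: (w) => [|b w1 IH].
apply: (runs_seq (s1 := (e2 0, [::]))).
  apply: runs_eq (_ : runs w _ _ (upd (e1 L) Pos 0, [::]) _).
    by congr (_, _); apply/funext => r; rewrite /e2 mul0n addn0.
  by have := runs_rewind Pos w Pos (e1 L) [::]; rewrite e1P.
apply: (runs_seq (s1 := (e2 n, [::]))).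
  pose S i : store reg := (e2 i, [::]).
  rewrite -/(S 0) -/(S n).
  apply: (runs_while (S := S)) => [i iL|i iL|].
  - rewrite /is_true_bit /scan /S [(_, _).1]/= e2P wE /enc_unary -cats1 -catA.
    by elim: (n) i iL => [|m IH] [|i] //=; exact: IH.
  - apply: runs_leq (runs_eq _ (runs_incs _ _ _ _ _)); first by rewrite /= size_map size_enum_ord.
    by congr (_, _); apply/funext => r; rewrite /e2 mulSn; lia.
  - rewrite /is_true_bit /scan /S [(_, _).1]/= e2P wE /enc_unary -cats1 -catA.
    by elim: (n).
apply: runs_eq (_ : runs w _ _ (upd (e2 n) Pos 0, [::]) _).
  congr (_, _); apply/funext => -[[[|[|[|[|[|[|k]]]]]] kl]|[i|i]] //;
    rewrite /e2 /e1 /upd /step1 /step2 /= ?count_cat ?count_bars /= /word_tot /word_mid /=; lia.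
by have := runs_rewind Pos w Pos (e2 n) [::]; rewrite e2P.
Qed.

End Program.

(** * The reduction *)

Lemma poly_bounded_horner T : poly_bounded T -> exists p : {poly nat}, forall x, T x <= p.[x]%R.
Proof.
move=> [c [d H]]; exists (c%:P * ('X + 1%:P) ^+ d)%R => x.
apply: leq_trans (H x) _.
rewrite hornerM hornerC horner_exp hornerD hornerX hornerC.
by rewrite -[(c * _)%R]/(c * _)%N leq_mul2l; apply/orP; right; rewrite -addn1;
  elim: d {H} => // d IH; rewrite expnS exprS leq_mul.
Qed.

Theorem corollary11 (R : realType) :
  polytime_reducible (stopping_ssg_problem R) (sdp_feasibility_problem R).
Proof.
pose f (x : stopping_instance R) : sdp := word_sdp (inst_size x) (enc_instance x).
exists f; split; last by move=> [n G k stop]; exact: word_sdp_correct.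
have [T pT HT] := prints_main; have [c [d H]] := pT.
have [p Hp] : exists p : {poly nat}, forall x,
    2 * (x * 32 + 4 + c * (x * 3 + 1) ^ d) + 3 <= p.[x]%R.
  apply: poly_bounded_horner.
  by poly_bound.
exists (sim_tm Pos (mseq setup main)), p => x.
set w := encode x; set n := inst_size x.
have wE : exists rest, w = enc_unary n ++ rest by eexists.
have [rest {}wE] := wE.
have nw : n < size w by rewrite wE size_cat /enc_unary size_rcons size_nseq; lia.
have z : in_range n w (fun=> 0) by [].
have [t tT e] := runs_seq (runs_setup wE) (HT n w _ [::] z (fun _ _ => erefl)).
have oE : rev (rev (main_out n w (fun=> 0)) ++ [::]) = enc_sdp (f x).
  by rewrite cats0 revK main_outE.
have := sim_tm_correct e.
rewrite -[X in tm_computes_within _ _ X]/(rev (rev (main_out n w (fun=> 0)) ++ [::])) oE.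
move=> [t' tt' out]; exists t'; last exact: out.
apply: leq_trans tt' _; apply: leq_trans (Hp (size w)).
have HT' := H (word_tot n w).
have le : (word_tot n w).+1 ^ d <= (size w * 3 + 1) ^ d.
  case: (d) => // d1; rewrite leq_exp2r // /word_tot /word_mid; lia.
have := leq_trans HT' (leq_mul (leqnn c) le).
move: (c * _) (T _) tT => B Tt; lia.
Qed.
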